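(* The Gaussian inner products converge on the minimal submodules (of the polynomial representations) for $H_{1/8}(E_6)$, $H_{1/12}(E_7)$ and $H_{1/5}(H_3)$; hence these modules are unitary.
   Context: Let $\mathcal{R}\subset\mathbb{R}^N$ be an irreducible Coxeter root system of rank $N$ with positive roots $\mathcal{R}_+$ and Coxeter group $W$ generated by the reflections $s_\alpha$, and let $c\in\mathbb{R}$ be constant. The Dunkl operators on $\mathbb{C}[x]=\mathbb{C}[x_1,\dots,x_N]$ are $\nabla_\xi=\partial_\xi-\sum_{\alpha\in\mathcal{R}_+}\frac{c(\alpha,\xi)}{(\alpha,x)}(1-s_\alpha)$, $\nabla_i=\nabla_{e_i}$. The rational Cherednik algebra $H_c(W)$ is defined by its faithful (polynomial) representation on $\mathbb{C}[x]$: it is generated by $W$ acting geometrically, by $x_i$ acting by multiplication, and by $y_i$ acting as $\nabla_i$. The minimal submodule $\mathbb{S}_c$ is the unique minimal non-zero $H_c(W)$-submodule of $\mathbb{C}[x]$. It carries a $W$-invariant nondegenerate Hermitian form, unique up to proportionality, with $(x_iu,v)=(u,y_iv)$; $\mathbb{S}_c$ is unitary if this form can be scaled to be positive definite. The Gaussian inner product converges on $\mathbb{S}_c$ if $$\int_{\mathbb{R}^N}|f(x)|^2e^{-\frac12|x|^2}\prod_{\alpha\in\mathcal{R}_+}|(\alpha,x)|^{-2c}\,dx<\infty\quad\text{for all } f\in\mathbb{S}_c.$$ *)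

(* Defs.v *)
From HB Require Import structures.
From mathcomp Require Import all_boot all_order all_algebra.
From mathcomp Require Import all_classical all_reals all_analysis.
From mathcomp Require Import complex ring.

Set Implicit Arguments.
Unset Strict Implicit.
Unset Printing Implicit Defensive.
Import Order.TTheory GRing.Theory Num.Theory.
Import numFieldNormedType.Exports.

Local Open Scope classical_set_scope.
Local Open Scope ring_scope.

Section PowerMeasure.
Context d (T : measurableType d) (R : realType).
Variable nu : {sigma_finite_measure set T -> \bar R}.

Let tcons n (p : T * n.-tuple T) : n.+1.-tuple T := [tuple of p.1 :: p.2].

Let measurable_tcons n : measurable_fun setT (@tcons n).
Proof. exact: measurable_cons. Qed.

Section Step.
Variables (n : nat) (mu : {sigma_finite_measure set (n.-tuple T) -> \bar R}).

Definition cons_measure : set (n.+1.-tuple T) -> \bar R :=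
  pushforward (nu \x mu)%E (@tcons n).

Let push : {measure set (n.+1.-tuple T) -> \bar R} :=
  measure_function_pushforward__canonical__measure_function_Measure
    (nu \x mu)%E (@measurable_tcons n).

Let cons_measure0 : cons_measure set0 = 0%E.
Proof. exact: (measure0 push). Qed.

Let cons_measure_ge0 A : (0 <= cons_measure A)%E.
Proof. exact: (measure_ge0 push). Qed.

Let cons_measure_sigma_additive : semi_sigma_additive cons_measure.
Proof. exact: (@measure_semi_sigma_additive _ _ _ push). Qed.

HB.instance Definition _ := isMeasure.Build _ _ _ cons_measure
  cons_measure0 cons_measure_ge0 cons_measure_sigma_additive.

Let cons_measure_sigma_finite : sigma_finite setT cons_measure.
Proof.
have [F FT Foo] : sigma_finite setT (nu \x mu)%E.
  have /sigma_finiteP[F [TF ndF Foo]] := sigma_finiteT nu.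
  have /sigma_finiteP[G [TG ndG Goo]] := sigma_finiteT mu.
  exists (fun k => F k `*` G k).
    rewrite -setXTT TF TG predeqE => -[x y]; split.
      move=> [/= [m _ Fmx] [k _ Gky]]; exists (maxn m k) => //; split.
      - by move: x Fmx; exact/subsetPset/ndF/leq_maxl.
      - by move: y Gky; exact/subsetPset/ndG/leq_maxr.
    by move=> [m _ []/= ? ?]; split; exists m.
  move=> k; have [? ?] := Foo k; have [? ?] := Goo k.
  split; first exact: measurableX.
  by rewrite product_measure1E// lte_mul_pinfty// ge0_fin_numE.
pose ht (t : n.+1.-tuple T) : T * n.-tuple T := (thead t, [tuple of behead t]).
have htK p : ht (tcons p) = p.
  by case: p => x t; rewrite /ht /tcons theadE; congr pair; apply: val_inj.
have mht : measurable_fun setT ht.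
  by apply/measurable_fun_pairP; split;
    [exact: (measurable_tnth ord0) | exact: measurable_behead].
exists (fun k => ht @^-1` F k).
  by rewrite -preimage_bigcup -FT preimage_setT.
move=> k; have [mF Fk] := Foo k; split.
  by rewrite -[X in measurable X]setTI; exact: mht.
rewrite /cons_measure /pushforward.
suff -> : @tcons n @^-1` (ht @^-1` F k) = F k by [].
by apply/seteqP; split => p /=; rewrite htK.
Qed.

HB.instance Definition _ := Measure_isSigmaFinite.Build _ _ _ cons_measure
  cons_measure_sigma_finite.

End Step.

(* The n-fold product of nu, on n-tuples. *)
Fixpoint power_measure n : {sigma_finite_measure set (n.-tuple T) -> \bar R} :=
  match n with
  | 0 => \d_([tuple] : 0.-tuple T)
  | k.+1 => cons_measure (power_measure k)
  end.

End PowerMeasure.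

Definition lebesgueN (R : realType) N :
    {sigma_finite_measure set (N.-tuple (measurableTypeR R)) -> \bar R} :=
  power_measure (@lebesgue_measure R) N.

(* mpoly is imported only here because it breaks the declaration of instances *)
(* on functions above, and without its notations because they clash with      *)
(* those of mathcomp-analysis.                                                *)
From mathcomp Require Import -(notations) mpoly.

Local Open Scope complex_scope.

Section RootSystems.
Variables (R : realType) (N : nat).
Implicit Types (u v alpha : 'rV[R]_N) (Phi : seq 'rV[R]_N)
  (Delta : N.-tuple 'rV[R]_N).

Definition dot u v : R := \sum_i u 0 i * v 0 i.

(* Vectors are rows: a matrix w acts on R^N by v |-> v *m w, so that the      *)
(* reflection is v |-> v - 2 (v, alpha) / (alpha, alpha) alpha.               *)
Definition reflection alpha : 'M[R]_N :=
  1%:M - (2 / dot alpha alpha) *: (alpha^T *m alpha).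

Record root_system Phi : Prop := RootSystem {
  root_uniq : uniq Phi;
  root_span : <<Phi>>%VS = fullv;
  root_neq0 : 0 \notin Phi;
  root_reduced : forall alpha (k : R),
    alpha \in Phi -> k *: alpha \in Phi -> k = 1 \/ k = -1;
  root_stable : forall alpha beta,
    alpha \in Phi -> beta \in Phi -> beta *m reflection alpha \in Phi }.

Definition nonneg_comb Delta v : Prop :=
  exists2 k : 'I_N -> R, forall i, 0 <= k i
                       & v = \sum_i k i *: tnth Delta i.

Record simple_system Phi Delta : Prop := SimpleSystem {
  simple_root : {subset Delta <= Phi};
  simple_free : free Delta;
  simple_sign : forall alpha, alpha \in Phi ->
    nonneg_comb Delta alpha \/ nonneg_comb Delta (- alpha) }.

Definition positive_roots Phi Delta : seq 'rV[R]_N :=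
  [seq alpha <- Phi | `[< nonneg_comb Delta alpha >]].

(* The angle between the simple roots i and j is pi - pi / m i j.             *)
Definition coxeter_matrix Delta (m : 'I_N -> 'I_N -> nat) : Prop :=
  forall i j, let a := tnth Delta i in let b := tnth Delta j in
  dot a b = - cos (pi / (m i j)%:R)
            * (Num.sqrt (dot a a) * Num.sqrt (dot b b)).

Definition root_system_of_type (m : 'I_N -> 'I_N -> nat) Phi Delta : Prop :=
  [/\ root_system Phi, simple_system Phi Delta & coxeter_matrix Delta m].

Inductive coxeter_group Phi : 'M[R]_N -> Prop :=
| coxeter_group1 : coxeter_group Phi 1%:M
| coxeter_groupM w alpha : coxeter_group Phi w -> alpha \in Phi ->
    coxeter_group Phi (w *m reflection alpha).

End RootSystems.

(* A Coxeter graph is given by its edges ((i, j), m_ij); m_ij = 2 for the     *)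
(* pairs i <> j that are not listed.                                          *)
Definition coxeter_graph N (edges : seq (nat * nat * nat)) (i j : 'I_N) : nat :=
  if i == j then 1%N else
  head 2%N [seq e.2 | e <- edges & (e.1 == (val i, val j))
                                   || (e.1 == (val j, val i))].

(*  0 - 1 - 2 - 3 - 4                                                         *)
(*          |                                                                 *)
(*          5                                                                 *)
Definition E6 : 'I_6 -> 'I_6 -> nat :=
  coxeter_graph [:: (0, 1, 3); (1, 2, 3); (2, 3, 3); (3, 4, 3); (2, 5, 3)]%N.

(*  0 - 1 - 2 - 3 - 4 - 5                                                     *)
(*          |                                                                 *)
(*          6                                                                 *)
Definition E7 : 'I_7 -> 'I_7 -> nat :=
  coxeter_graph [:: (0, 1, 3); (1, 2, 3); (2, 3, 3); (3, 4, 3); (4, 5, 3);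
                    (2, 6, 3)]%N.

(*    5                                                                       *)
(*  0 - 1 - 2                                                                 *)
Definition H3 : 'I_3 -> 'I_3 -> nat :=
  coxeter_graph [:: (0, 1, 5); (1, 2, 3)]%N.

Notation cpoly R N := (mpoly N R[i]).

Section CherednikAlgebra.
Variables (R : realType) (N : nat).
Variables (Phi : seq 'rV[R]_N) (Delta : N.-tuple 'rV[R]_N) (c : R).
Implicit Types (f g q : cpoly R N) (S : set (cpoly R N)).

Definition xvar (i : 'I_N) : cpoly R N := @mpolyX N R[i] (mnm1 i).

Definition linear_form (alpha : 'rV[R]_N) : cpoly R N :=
  \sum_i (alpha 0 i)%:C *: xvar i.

(* (w f)(x) = f(w^-1 x) *)
Definition geom_act (w : 'M[R]_N) f : cpoly R N :=
  comp_mpoly [tuple \sum_j (invmx w j i)%:C *: xvar j | i < N] f.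

(* The polynomial (f - s_alpha f) / (alpha, x); see root_quotientP.           *)
Definition root_quotient (alpha : 'rV[R]_N) f : cpoly R N :=
  xget 0 [set q | linear_form alpha * q = f - geom_act (reflection alpha) f].

Lemma reflectionK (alpha : 'rV[R]_N) : dot alpha alpha != 0 ->
  reflection alpha *m reflection alpha = 1%:M.
Proof.
move=> a0; rewrite /reflection; set P := alpha^T *m alpha.
have PP : P *m P = dot alpha alpha *: P.
  rewrite /P mulmxA -[_ *m _ *m alpha^T]mulmxA.
  have -> : alpha *m alpha^T = (dot alpha alpha)%:M.
    apply/matrixP => i j; rewrite !ord1 !mxE eqxx mulr1n.
    by apply: eq_bigr => k _; rewrite mxE.
  by rewrite mul_mx_scalar -scalemxAl.
rewrite mulmxBl !mulmxBr !mul1mx mulmx1 -scalemxAl -scalemxAr PP !scalerA.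
have -> : 2 / dot alpha alpha * (2 / dot alpha alpha) * dot alpha alpha
    = 2 / dot alpha alpha + 2 / dot alpha alpha by field.
by rewrite scalerDl opprB addrK subrK.
Qed.

Lemma root_quotientP (alpha : 'rV[R]_N) f : dot alpha alpha != 0 ->
  linear_form alpha * root_quotient alpha f
  = f - geom_act (reflection alpha) f.
Proof.
move=> a0; rewrite /root_quotient.
case: xgetP => [q -> //|].
suff [q Hq] : exists q, linear_form alpha * q
    = f - geom_act (reflection alpha) f by move=> /(_ q).
have sK := reflectionK a0; have [su _] := mulmx1_unit sK.
have invE : invmx (reflection alpha) = reflection alpha.
  by rewrite -[LHS]mulmx1 -sK mulmxA mulVmx// mul1mx.
pose P g := exists q, linear_form alpha * q
  = g - geom_act (reflection alpha) g.
have PM g h : P g -> P h -> P (g * h).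
  move=> [q Hq] [r Hr]; exists (q * h + geom_act (reflection alpha) g * r).
  rewrite mulrDr mulrA Hq mulrCA Hr /geom_act rmorphM/=.
  by rewrite mulrBl mulrBr addrA subrK.
have P1 : P 1 by exists 0; rewrite mulr0 /geom_act comp_mpoly1 subrr.
have PX i : P (xvar i).
  exists ((2 / dot alpha alpha * alpha 0 i)%:C%:A).
  rewrite -scalerAr mulr1 /geom_act comp_mpolyXU -tnth_nth tnth_mktuple invE.
  have -> : xvar i = \sum_j ((1%:M : 'M[R]_N) j i)%:C *: xvar j.
    rewrite (bigD1 i)//= mxE eqxx scale1r big1 ?addr0// => j ji.
    by rewrite mxE (negbTE ji) scale0r.
  rewrite -sumrB /linear_form scaler_sumr; apply: eq_bigr => j _.
  rewrite scalerA -scalerBl -rmorphM -rmorphB/=; congr (_%:C *: _).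
  rewrite !mxE big_ord_recl big_ord0 !mxE addr0 opprD opprK addrA subrr add0r.
  by rewrite mulrAC mulrA.
rewrite -/(P f); elim/mpolyind: f => [|a m g _ _ Pg].
  by exists 0; rewrite mulr0 /geom_act comp_mpoly0 subrr.
have [q Hq] : P (mpolyX R[i] m).
  rewrite (mpolyXE_id R[i] m).
  refine (@big_ind _ P 1 *%R P1 PM _ _ _ _ _) => i _.
  elim: (m i) => [|k Pk]; first exact: P1.
  by rewrite exprS; apply: PM Pk; exact: PX.
have [r Hr] := Pg; exists (a *: q + r).
rewrite mulrDr -scalerAr Hq Hr /geom_act comp_mpolyD comp_mpolyZ scalerBr.
by rewrite opprD addrACA.
Qed.

Definition dunkl (xi : 'rV[R]_N) f : cpoly R N :=
  \sum_i (xi 0 i)%:C *: mderiv i f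
  - \sum_(alpha <- positive_roots Phi Delta)
      (c * dot alpha xi)%:C *: root_quotient alpha f.

(* H_c(W), as the algebra of operators of its polynomial representation.      *)
Inductive cherednik : (cpoly R N -> cpoly R N) -> Prop :=
| cherednik_group w : coxeter_group Phi w -> cherednik (geom_act w)
| cherednik_x i : cherednik (fun f => xvar i * f)
| cherednik_y i : cherednik (dunkl (delta_mx 0 i))
| cherednik_scale (a : R[i]) h : cherednik h -> cherednik (fun f => a *: h f)
| cherednik_add h k :
    cherednik h -> cherednik k -> cherednik (fun f => h f + k f)
| cherednik_mul h k :
    cherednik h -> cherednik k -> cherednik (fun f => h (k f)).

Record submodule S : Prop := Submodule {
  submodule0 : S 0;
  submoduleD : forall f g, S f -> S g -> S (f + g);
  submoduleH : forall h f, cherednik h -> S f -> S (h f) }.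

Definition nonzero_submodule S : Prop :=
  submodule S /\ exists2 f, S f & f != 0.

(* S is the unique minimal non-zero submodule.                                *)
Definition minimal_submodule S : Prop :=
  let minimal T := nonzero_submodule T /\
    forall T', nonzero_submodule T' -> T' `<=` T -> T' = T in
  minimal S /\ forall T, minimal T -> T = S.

(* A W-invariant nondegenerate Hermitian form on S with (x_i u, v) =          *)
(* (u, y_i v); its values outside S are irrelevant.                           *)
Record contravariant_form S (B : cpoly R N -> cpoly R N -> R[i]) : Prop :=
  ContravariantForm {
  form_linear : forall (a : R[i]) u u' v, S u -> S u' -> S v ->
    B (a *: u + u') v = a * B u v + B u' v;
  form_herm : forall u v, S u -> S v -> B v u = (B u v)^*;
  form_nondeg : forall u, S u -> (forall v, S v -> B u v = 0) -> u = 0;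
  form_group : forall w u v, coxeter_group Phi w -> S u -> S v ->
    B (geom_act w u) (geom_act w v) = B u v;
  form_xy : forall i u v, S u -> S v ->
    B (xvar i * u) v = B u (dunkl (delta_mx 0 i) v) }.

Definition unitary S : Prop :=
  exists2 B, contravariant_form S B &
  exists a : R, forall u, S u -> u != 0 -> 0 < a%:C * B u u.

(* The value given to the weight on the hyperplanes (alpha, x) = 0 does not   *)
(* matter, as they have measure zero.                                         *)
Definition gaussian_integrand f (x : N.-tuple R) : R :=
  let v := \row_i tnth x i in
  complex.Re (`|meval (fun i => (tnth x i)%:C) f| ^+ 2)
  * expR (- (dot v v / 2))
  * \prod_(alpha <- positive_roots Phi Delta) `|dot alpha v| `^ (- (2 * c)).

Definition gaussian_converges S : Prop :=
  forall f, S f ->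
  (\int[lebesgueN R N]_x (gaussian_integrand f x)%:E < +oo)%E.

End CherednikAlgebra.

(* Main.v *)
(* Write K for the sum over positive roots of 1 - s_alpha.                    *)
(*                                                                            *)
(* Convergence. Some maximal parabolic subsystems, of Coxeter number 1 / c,   *)
(* make the polynomials that vanish on the W-orbits of the corresponding      *)
(* fundamental coweight lines a submodule, which contains S by minimality. On *)
(* the dominant chamber, with t_i = (alpha_i, x), the weight is compared with *)
(* prod t_i^(-19/20) times a power of max t_i, by induction on the set of     *)
(* large coordinates; the exponent has the wrong sign only for the whole set  *)
(* and for the special parabolics, where the vanishing of f compensates it.   *)
(* This bounds the integrand by a sum, over N-tuples of spanning roots, of    *)
(* integrable products of |(alpha, x)|^(-19/20) and Gaussians.                *)
(*                                                                            *)
(* Unitarity. The Euler operator E = sum x_i y_i is m - c K in degree m. If   *)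
(* the eigenvalues of K in degree m are at most m / c for m >= 3, then E is   *)
(* nonnegative there; by minimality S has no singular vector above its lowest *)
(* degree, so that E is invertible and B_(m+1)(u, v) = sum_j B_m(y_j u, y_j   *)
(* E^-1 v) builds the form from the Fischer product. The bound on K is        *)
(* subadditive in m, so that it is needed only in degrees 1, 3 and 4. For E6  *)
(* and E7 a harmonic eigenvector is treated as a symmetric trace-free tensor  *)
(* and evaluated on roots, which form a spherical 4-design; for H3 one has    *)
(* (K - 10)(K - 15) = 0 in degree 3 and K(K - 12)(K - 15) = 0 in degree 4, by *)
(* computation over Z[2 cos (pi / 5)].                                        *)
From HB Require Import structures.
From Stdlib Require Import ZArith.
Require Import Defs.
From mathcomp Require Import all_boot all_order all_algebra.
From mathcomp Require Import all_classical all_reals all_analysis measurable_realfun.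
From mathcomp Require Import complex ring lra zify ssrZ.
From mathcomp Require Import -(notations) mpoly.

Set Implicit Arguments.
Unset Strict Implicit.
Unset Printing Implicit Defensive.
Import Order.TTheory GRing.Theory Num.Theory.
Import numFieldNormedType.Exports.

Local Open Scope classical_set_scope.
Local Open Scope ring_scope.
Local Open Scope complex_scope.

(** Write c = 1 / k and let [KK] be the sum of 1 - s_alpha over the positive roots. Two facts on
    Dunkl operators drive everything: [dk_lf], the commutation of y with x, and [sum_xy], by which
    sum x_i y_i is m - c [KK] in degree m.

    Convergence. The number k is the Coxeter number of a maximal parabolic: D5 in E6, E6 in E7,
    I2(5) in H3. For it, the sum of 2 a a^T / (a, a) over its positive roots is k times the
    projection onto their span. Hence, on the line fixed by the parabolic, a Dunkl operator applied
    to a polynomial vanishing on the orbit of the line reduces to a derivative along that line,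
    which is 0. Such polynomials form a submodule ([vanishing_submodule]), which contains S by
    minimality ([minimal_vanishing]); moreover S has nothing in degrees 0 and 1 ([minimal_low]). On
    a chamber with coordinates t_i = (alpha_i, y), the weight is compared with prod t_i^(-19/20)
    through the scaling exponents [excess] of the faces. An exponent can be negative only at the
    origin, where the degree of f gives four powers, and at the special lines, where the zero of f
    gives two ([chamber_bound]). The resulting products of |linear form|^(-19/20) and Gaussians are
    integrable ([integral_psi_gau_tuple]).

    Unitarity. The form is the Fischer product in the lowest degree of S and is continued upwards by
    B'(u, v) = sum_j B(y_j u, y_j E^-1 v), with E = sum x_i y_i ([next_good]). E must be positive
    above the lowest degree. By minimality S has no further singular vectors, which makes E
    injective ([eop_inj]), so it suffices that [KK] is at most k m in each degree m >= 3. Such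
    bounds add up under splitting a degree ([bd_add]), which leaves degrees 1, 3 and 4. For E6 and
    E7 the eigenvalues come from evaluating harmonic tensors on roots ([eigen3], [eigen4]); for H3 a
    product of [KK] - kap is computed to be 0 ([spectrum]).

    All finite facts on roots are computed on lists over Z[2 cos (pi / 5)] that are proved to be the
    positive system ([pos_perm_vec]). *)

(** * Polynomials *)

(* f(x) |-> f(x M). This and the other locked operations are opaque because  *)
(* unification diverges when it unfolds operations on polynomials.            *)
HB.lock Definition lsub (R : realType) N (M : 'M[R]_N) (f : cpoly R N) : cpoly R N :=
  comp_mpoly [tuple \sum_j (M j i)%:C *: @xvar R N j | i < N] f.

HB.lock Definition dird (R : realType) N (v : 'rV[R]_N) (f : cpoly R N) : cpoly R N :=
  \sum_i (v 0 i)%:C *: mderiv i f.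

HB.lock Definition comp_hom (R : realType) N d (f : cpoly R N) : cpoly R N :=
  pihomog mdeg d f.

HB.lock Definition lform (R : realType) N (v : 'rV[R]_N) : cpoly R N := linear_form v.

Section Polynomials.
Variables (R : realType) (N : nat).
Local Notation C := R[i].
Local Notation P := (cpoly R N).
Local Notation V := 'rV[R]_N.
Implicit Types (f g : P) (u v w : V) (d : nat) (M : 'M[R]_N).

Local Notation x_ := (@xvar R N).

Lemma xvarE i : x_ i = @mpolyX N C (mnm1 i).
Proof. by []. Qed.

(** A monomial is built by multiplying by one variable at a time, so identities between algebra
    morphisms and derivations need only be checked on constants, sums and products x_i * f. *)
Lemma mpoly_alg_ind (Q : P -> Prop) :
  (forall a, Q (a *: 1)) -> (forall f g, Q f -> Q g -> Q (f + g)) ->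
  (forall i f, Q f -> Q (x_ i * f)) -> forall f, Q f.
Proof.
move=> Q1 QD QX; elim/mpolyind => [|a m g _ _ Qg].
  by have := Q1 0; rewrite scale0r.
apply: QD Qg => {g}.
have -> : a *: mpolyX C m = mpolyX C m * (a *: 1) by rewrite -scalerAr mulr1.
rewrite (mpolyXE_id C m).
have : forall (s : seq 'I_N) g, Q g -> Q ((\prod_(i <- s) x_ i ^+ m i) * g).
  elim=> [|i s IH] g Qg; first by rewrite big_nil mul1r.
  rewrite big_cons -mulrA; have := IH _ Qg.
  elim: (m i) => [|k Qk]; first by rewrite expr0 mul1r.
  by move=> h; rewrite exprS -mulrA; apply: QX; apply: Qk.
by apply; exact: Q1.
Qed.

Definition hom d f := f \is @ishomog1 N C d mdeg.

Lemma homP d f : hom d f -> forall m, m \in msupp f -> mdeg m = d.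
Proof. by move=> /dhomogP hf m /hf. Qed.

Lemma hom0 d : hom d 0. Proof. exact: dhomog0. Qed.

Lemma homD d f g : hom d f -> hom d g -> hom d (f + g).
Proof. exact: dhomogD. Qed.

Lemma homZ d a f : hom d f -> hom d (a *: f).
Proof. exact: dhomogZ. Qed.

Lemma homN d f : hom d f -> hom d (- f).
Proof. by rewrite -scaleN1r; exact: homZ. Qed.

Lemma homB d f g : hom d f -> hom d g -> hom d (f - g).
Proof. by move=> hf /homN; exact: homD. Qed.

Lemma hom_sum d (I : Type) (r : seq I) (p : pred I) (F : I -> P) :
  (forall i, p i -> hom d (F i)) -> hom d (\sum_(i <- r | p i) F i).
Proof. by move=> h; apply: (big_ind (hom d)) => //; [exact: hom0|exact: homD]. Qed.

Lemma homM d e f g : hom d f -> hom e g -> hom (d + e) (f * g).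
Proof. exact: dhomogM. Qed.

Lemma hom_xvar i : hom 1 (x_ i).
Proof. by rewrite /hom dhomogX; apply/eqP; exact: mdeg1. Qed.

Lemma hom_cst a : hom 0 (a *: 1).
Proof. by apply: homZ; exact: dhomog1. Qed.

Lemma homX d i f : hom d f -> hom d.+1 (x_ i * f).
Proof. by move=> hf; rewrite -add1n; apply: homM => //; exact: hom_xvar. Qed.

Lemma comp_homP d f : hom d (comp_hom d f).
Proof. by rewrite comp_hom.unlock; exact: pihomogP. Qed.

Lemma comp_hom_id d f : hom d f -> comp_hom d f = f.
Proof. by rewrite comp_hom.unlock; exact: pihomog_dE. Qed.

Lemma comp_hom_neq d e f : hom d f -> d != e -> comp_hom e f = 0.
Proof. by move=> hf de; rewrite comp_hom.unlock; apply: pihomog_ne0 hf. Qed.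

Lemma comp_hom_is_linear d : linear (@comp_hom R N d).
Proof. by rewrite comp_hom.unlock; exact: pihomog_is_linear. Qed.
HB.instance Definition _ d := GRing.isLinear.Build C P P _ (@comp_hom R N d)
  (comp_hom_is_linear d).

Lemma comp_homD d f g : comp_hom d (f + g) = comp_hom d f + comp_hom d g.
Proof. exact: linearD. Qed.

Lemma comp_homZ d a f : comp_hom d (a *: f) = a *: comp_hom d f.
Proof. exact: linearZ. Qed.

Lemma comp_hom0 d : comp_hom d 0 = 0 :> P.
Proof. exact: linear0. Qed.

Lemma comp_homsum d (I : Type) (r : seq I) (p : pred I) (F : I -> P) :
  comp_hom d (\sum_(i <- r | p i) F i) = \sum_(i <- r | p i) comp_hom d (F i).
Proof. exact: linear_sum. Qed.

Lemma comp_hom_sumW k f : (mmeasure mdeg f <= k)%N -> f = \sum_(d < k) comp_hom d f.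
Proof. by rewrite comp_hom.unlock; exact: pihomog_partitionE. Qed.

Lemma comp_hom_sum f : f = \sum_(d < mmeasure mdeg f) comp_hom d f.
Proof. exact: comp_hom_sumW. Qed.

Lemma comp_hom_eq0 f d : (mmeasure mdeg f <= d)%N -> comp_hom d f = 0.
Proof.
move=> h; rewrite [in LHS](comp_hom_sumW h) comp_homsum big1// => i _.
by apply: (@comp_hom_neq i); [exact: comp_homP|rewrite neq_ltn ltn_ord].
Qed.

Lemma xderivE (f : P) m i :
  x_ i * mderiv i (mpolyX C m) = (m i)%:R *: mpolyX C m.
Proof.
rewrite mderivX -scalerAr xvarE -mpolyXD.
have [->|mi] := eqVneq (m i) 0%N; first by rewrite !scale0r.
congr (_ *: mpolyX C _); apply/mnmP => j; rewrite mnmDE mnmBE mnm1E.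
have [<-|//] := eqVneq i j; last by rewrite subn0.
by rewrite addnC subnK// lt0n.
Qed.

Lemma euler d f : hom d f -> \sum_i x_ i * mderiv i f = d%:R *: f.
Proof.
move=> /homP hf; rewrite {1 2}[f]mpolyE scaler_sumr.
under eq_bigr do rewrite linear_sum/= mulr_sumr.
rewrite exchange_big/= big_seq [RHS]big_seq; apply: eq_bigr => m /hf dm.
under eq_bigr do rewrite linearZ/= -scalerAr xderivE//.
by rewrite -scaler_sumr -scaler_suml scalerA mulrC scalerA -natr_sum -mdegE dm.
Qed.

Lemma hom_mderiv d i f : hom d f -> hom d.-1 (mderiv i f).
Proof.
move=> /homP hf; apply/dhomogP => m; rewrite mcoeff_msupp mcoeff_deriv => h.
have /hf : mnm_add m (mnm1 i) \in msupp f.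
  by rewrite mcoeff_msupp; apply: contra_neq h => ->; rewrite mul0rn.
by rewrite mdegD mdeg1 addn1 => <-.
Qed.

Lemma hom0E f : hom 0 f -> exists a, f = a *: 1.
Proof.
move=> /homP hf; exists (mcoeff (@mnm0 N) f).
apply/mpolyP => m; rewrite mcoeffZ mcoeff1.
have [->|m0] := eqVneq m (@mnm0 N); first by rewrite mulr1.
rewrite mulr0; apply/eqP/contraT => fm.
by move: (hf m); rewrite mcoeff_msupp => /(_ fm) /eqP; rewrite mdeg_eq0 (negbTE m0).
Qed.

Lemma hom_mderiv_eq0 d f : (0 < d)%N -> hom d f ->
  (forall i, mderiv i f = 0) -> f = 0.
Proof.
move=> d0 hf h; have := euler hf.
rewrite big1 => [|i _]; last by rewrite h mulr0.
move/esym/eqP; rewrite scaler_eq0 pnatr_eq0 => /orP[|/eqP//].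
by rewrite eqn0Ngt d0.
Qed.

(** Euler's identity writes a form of degree d + 1 as a combination of the x_i times forms of degree
    d, so the induction never leaves homogeneous polynomials. *)
Lemma hom_ind (Q : nat -> P -> Prop) :
  (forall a, Q 0%N (a *: 1)) -> (forall d, Q d 0) ->
  (forall d f g, Q d f -> Q d g -> Q d (f + g)) ->
  (forall d a f, Q d f -> Q d (a *: f)) ->
  (forall d i f, hom d f -> Q d f -> Q d.+1 (x_ i * f)) ->
  forall d f, hom d f -> Q d f.
Proof.
move=> Q1 Q0 QD QZ QX; elim=> [f /hom0E[a ->]//|d IH f hf].
have -> : f = d.+1%:R^-1 *: \sum_i x_ i * mderiv i f.
  by rewrite (euler hf) scalerA mulVf ?scale1r// pnatr_eq0.
apply: QZ; apply: (big_ind (Q d.+1)) => [||i _]; [exact: Q0|exact: QD|].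
have h := hom_mderiv i hf.
by apply: QX => //; exact: IH.
Qed.

Lemma lsubE M f : lsub M f = comp_mpoly [tuple \sum_j (M j i)%:C *: x_ j | i < N] f.
Proof. by rewrite lsub.unlock. Qed.

Lemma geom_actE M f : geom_act M f = lsub (invmx M) f.
Proof. by rewrite lsubE. Qed.

Lemma lsub_is_linear M : linear (@lsub R N M).
Proof. by move=> a f g; rewrite !lsubE linearP. Qed.
HB.instance Definition _ M := GRing.isLinear.Build C P P _ (@lsub R N M)
  (lsub_is_linear M).

Lemma lsubD M f g : lsub M (f + g) = lsub M f + lsub M g.
Proof. exact: linearD. Qed.

Lemma lsubB M f g : lsub M (f - g) = lsub M f - lsub M g.
Proof. exact: linearB. Qed.

Lemma lsubZ M a f : lsub M (a *: f) = a *: lsub M f.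
Proof. exact: linearZ. Qed.

Lemma lsub0 M : lsub M 0 = 0.
Proof. exact: linear0. Qed.

Lemma lsub_sum M (I : Type) (r : seq I) (p : pred I) (F : I -> P) :
  lsub M (\sum_(i <- r | p i) F i) = \sum_(i <- r | p i) lsub M (F i).
Proof. exact: linear_sum. Qed.

Lemma lsubM M f g : lsub M (f * g) = lsub M f * lsub M g.
Proof. by rewrite !lsubE; exact: rmorphM. Qed.

Lemma lsub_one M : lsub M 1 = 1. Proof. by rewrite lsubE; exact: comp_mpoly1. Qed.

Lemma lsubX M i : lsub M (x_ i) = \sum_j (M j i)%:C *: x_ j.
Proof. by rewrite lsubE comp_mpolyXU -tnth_nth tnth_mktuple. Qed.

Lemma lsub1 f : lsub 1%:M f = f.
Proof.
elim/mpoly_alg_ind: f => [a|f g Hf Hg|i f Hf].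
- by rewrite lsubZ lsub_one.
- by rewrite lsubD Hf Hg.
- rewrite lsubM Hf lsubX (bigD1 i)//= mxE eqxx scale1r big1 ?addr0// => j ji.
  by rewrite mxE (negbTE ji) scale0r.
Qed.

Lemma lsub_mul M M' f : lsub M (lsub M' f) = lsub (M *m M') f.
Proof.
elim/mpoly_alg_ind: f => [a|f g Hf Hg|i f Hf].
- by rewrite !lsubZ !lsub_one.
- by rewrite !lsubD Hf Hg.
- rewrite !lsubM Hf !lsubX lsub_sum; congr (_ * _).
  under eq_bigr do rewrite lsubZ lsubX scaler_sumr.
  rewrite exchange_big/=; apply: eq_bigr => k _.
  rewrite mxE rmorph_sum scaler_suml; apply: eq_bigr => j _.
  by rewrite scalerA mulrC -rmorphM.
Qed.

Lemma hom_lsub d M f : hom d f -> hom d (lsub M f).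
Proof.
move=> hf; elim/hom_ind: hf => {d f}[a|d|d f g Hf Hg|d a f Hf|d i f _ Hf].
- by rewrite lsubZ lsub_one; exact: hom_cst.
- by rewrite lsub0; exact: hom0.
- by rewrite lsubD; exact: homD.
- by rewrite lsubZ; exact: homZ.
- rewrite lsubM lsubX -add1n; apply: homM => //.
  by apply: hom_sum => j _; apply: homZ; exact: hom_xvar.
Qed.

Lemma comp_hom_lsub d M f : comp_hom d (lsub M f) = lsub M (comp_hom d f).
Proof.
rewrite [in LHS](comp_hom_sum f) lsub_sum comp_homsum [in RHS](comp_hom_sum f) comp_homsum lsub_sum.
apply: eq_bigr => i _; have h := comp_homP i f.
have [<-|ne] := eqVneq (i : nat) d.
  by rewrite (comp_hom_id h) (comp_hom_id (hom_lsub M h)).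
by rewrite (comp_hom_neq h ne) (comp_hom_neq (hom_lsub M h) ne) lsub0.
Qed.

Definition evl (f : P) (z : 'I_N -> C) : C := meval z f.

Lemma evl_lsub M f z :
  evl (lsub M f) z = evl f (fun i => \sum_j z j * (M j i)%:C).
Proof.
rewrite /evl lsubE comp_mpoly_meval; apply: meval_eq => i.
rewrite tnth_mktuple linear_sum/=; apply: eq_bigr => j _.
by rewrite mevalZ mevalXU mulrC.
Qed.

Lemma dirdE v f : dird v f = \sum_i (v 0 i)%:C *: mderiv i f.
Proof. by rewrite dird.unlock. Qed.

Lemma dird_is_linear v : linear (@dird R N v).
Proof.
move=> a f g; rewrite !dirdE scaler_sumr -big_split; apply: eq_bigr => i _ /=.
by rewrite linearP/= scalerDr !scalerA mulrC.
Qed.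
HB.instance Definition _ v := GRing.isLinear.Build C P P _ (@dird R N v)
  (dird_is_linear v).

Lemma dirdD v f g : dird v (f + g) = dird v f + dird v g.
Proof. exact: linearD. Qed.

Lemma dirdB v f g : dird v (f - g) = dird v f - dird v g.
Proof. exact: linearB. Qed.

Lemma dirdZ v a f : dird v (a *: f) = a *: dird v f.
Proof. exact: linearZ. Qed.

Lemma dird0 v : dird v 0 = 0.
Proof. exact: linear0. Qed.

Lemma dird_sum v (I : Type) (r : seq I) (p : pred I) (F : I -> P) :
  dird v (\sum_(i <- r | p i) F i) = \sum_(i <- r | p i) dird v (F i).
Proof. exact: linear_sum. Qed.

Lemma dirdDl u v f : dird (u + v) f = dird u f + dird v f.
Proof.
rewrite !dirdE -big_split; apply: eq_bigr => i _ /=.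
by rewrite mxE rmorphD scalerDl.
Qed.

Lemma dirdZl (a : R) v f : dird (a *: v) f = a%:C *: dird v f.
Proof.
rewrite !dirdE scaler_sumr; apply: eq_bigr => i _ /=.
by rewrite mxE rmorphM scalerA.
Qed.

Lemma dird0l f : dird 0 f = 0.
Proof. by rewrite -(scale0r (0 : V)) dirdZl scale0r. Qed.

Lemma dirdNl v f : dird (- v) f = - dird v f.
Proof. by rewrite -scaleN1r dirdZl rmorphN rmorph1 scaleN1r. Qed.

Lemma dirdBl u v f : dird (u - v) f = dird u f - dird v f.
Proof. by rewrite dirdDl dirdNl. Qed.

Lemma dird_suml (I : Type) (r : seq I) (p : pred I) (F : I -> V) f :
  dird (\sum_(i <- r | p i) F i) f = \sum_(i <- r | p i) dird (F i) f.
Proof.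
by apply: (big_morph (fun v => dird v f)) => [u v|]; rewrite ?dirdDl ?dird0l.
Qed.

Lemma dird_delta i f : dird (delta_mx 0 i) f = mderiv i f.
Proof.
rewrite !dirdE (bigD1 i)//= mxE !eqxx scale1r big1 ?addr0// => j ji.
by rewrite mxE (negbTE ji) andbF scale0r.
Qed.

Lemma dirdM v f g : dird v (f * g) = dird v f * g + f * dird v g.
Proof.
rewrite !dirdE mulr_suml mulr_sumr -big_split; apply: eq_bigr => i _ /=.
by rewrite mderivM scalerDr -scalerAl -scalerAr.
Qed.

Lemma dird_one v : dird v 1 = 0.
Proof. by rewrite !dirdE big1// => i _; rewrite mderivC scaler0. Qed.

Lemma dirdX v i : dird v (x_ i) = (v 0 i)%:C *: 1.
Proof.
rewrite !dirdE (bigD1 i)//= big1 ?addr0 => [|j ji].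
  rewrite mderivX mnm1E eqxx scale1r; congr (_ *: _).
  have -> : mnm_sub (mnm1 i) (mnm1 i) = @mnm0 N by apply/mnmP => k; rewrite mnmBE subnn mnm0E.
  exact: mpolyX0.
by rewrite mderivX mnm1E eq_sym (negbTE ji) scale0r scaler0.
Qed.

Lemma dird_dirdE u v f : dird u (dird v f) =
  \sum_i \sum_j ((u 0 i)%:C * (v 0 j)%:C) *: mderiv i (mderiv j f).
Proof.
rewrite [LHS]dirdE; apply: eq_bigr => i _.
rewrite dirdE (raddf_sum (mderiv i)) scaler_sumr; apply: eq_bigr => j _.
by rewrite /= mderivZ scalerA.
Qed.

Lemma dird_comm u v f : dird u (dird v f) = dird v (dird u f).
Proof.
rewrite !dird_dirdE exchange_big; apply: eq_bigr => i _; apply: eq_bigr => j _.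
by rewrite mulrC mderiv_comm.
Qed.

Lemma dird_lsub v M f : dird v (lsub M f) = lsub M (dird (v *m M) f).
Proof.
elim/mpoly_alg_ind: f => [a|f g Hf Hg|i f Hf].
- by rewrite lsubZ !dirdZ lsub_one !dird_one !lsubZ lsub0.
- by rewrite lsubD !dirdD lsubD Hf Hg.
- rewrite lsubM !dirdM lsubD !lsubM Hf; congr (_ * _ + _).
  rewrite lsubX dirdX dird_sum lsubZ lsub_one mxE rmorph_sum scaler_suml.
  by apply: eq_bigr => j _; rewrite dirdZ dirdX scalerA mulrC rmorphM.
Qed.

Lemma hom_dird d v f : hom d f -> hom d.-1 (dird v f).
Proof.
by move=> hf; rewrite dirdE; apply: hom_sum => i _; apply: homZ; exact: hom_mderiv.
Qed.

Lemma dotC u v : dot u v = dot v u.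
Proof. by apply: eq_bigr => i _; rewrite mulrC. Qed.

Lemma dotDl u v w : dot (u + v) w = dot u w + dot v w.
Proof. by rewrite /dot -big_split; apply: eq_bigr => i _; rewrite mxE mulrDl. Qed.

Lemma dotZl (a : R) u v : dot (a *: u) v = a * dot u v.
Proof. by rewrite /dot mulr_sumr; apply: eq_bigr => i _; rewrite mxE mulrA. Qed.

Lemma dot0l v : dot 0 v = 0.
Proof. by rewrite -(scale0r (0 : V)) dotZl mul0r. Qed.

Lemma dotNl u v : dot (- u) v = - dot u v.
Proof. by rewrite -scaleN1r dotZl mulN1r. Qed.

Lemma dotBl u v w : dot (u - v) w = dot u w - dot v w.
Proof. by rewrite dotDl dotNl. Qed.

Lemma dotDr u v w : dot u (v + w) = dot u v + dot u w.
Proof. by rewrite dotC dotDl !(dotC u). Qed.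

Lemma dotZr (a : R) u v : dot u (a *: v) = a * dot u v.
Proof. by rewrite dotC dotZl dotC. Qed.

Lemma dotNr u v : dot u (- v) = - dot u v.
Proof. by rewrite dotC dotNl dotC. Qed.

Lemma dotBr u v w : dot u (v - w) = dot u v - dot u w.
Proof. by rewrite dotDr dotNr. Qed.

Lemma dot_suml (I : Type) (r : seq I) (p : pred I) (F : I -> V) v :
  dot (\sum_(i <- r | p i) F i) v = \sum_(i <- r | p i) dot (F i) v.
Proof. by apply: (big_morph (fun u => dot u v)) => [u w|]; rewrite ?dotDl ?dot0l. Qed.

Lemma dot_sumr (I : Type) (r : seq I) (p : pred I) (F : I -> V) v :
  dot v (\sum_(i <- r | p i) F i) = \sum_(i <- r | p i) dot v (F i).
Proof. by rewrite dotC dot_suml; apply: eq_bigr => i _; rewrite dotC. Qed.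

Lemma dot_ge0 v : 0 <= dot v v.
Proof. by apply: sumr_ge0 => i _; rewrite -expr2 sqr_ge0. Qed.

Lemma dot_eq0 v : (dot v v == 0) = (v == 0).
Proof.
apply/idP/eqP => [|->]; last by rewrite dot0l.
rewrite /dot psumr_eq0 => [/allP h|i _]; last by rewrite -expr2 sqr_ge0.
apply/rowP => i; rewrite mxE; apply/eqP.
by have := h i (mem_index_enum i); rewrite mulf_eq0 orbb.
Qed.

Lemma dot_gt0 v : v != 0 -> 0 < dot v v.
Proof. by move=> v0; rewrite lt_def dot_ge0 dot_eq0 v0. Qed.

Lemma dot_delta v i : dot v (delta_mx 0 i) = v 0 i.
Proof.
rewrite /dot (bigD1 i)//= mxE !eqxx mulr1 big1 ?addr0// => j ji.
by rewrite mxE (negbTE ji) andbF mulr0.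
Qed.

Lemma dot_mul M u v : dot (u *m M) v = dot u (v *m M^T).
Proof.
rewrite /dot; under eq_bigr do rewrite mxE mulr_suml.
rewrite exchange_big/=; apply: eq_bigr => i _; rewrite mxE mulr_sumr.
by apply: eq_bigr => j _; rewrite mxE -mulrA [M i j * _]mulrC.
Qed.

Lemma dot_inj u v : (forall w, dot u w = dot v w) -> u = v.
Proof.
by move=> h; apply/rowP => i; have := h (delta_mx 0 i); rewrite !dot_delta.
Qed.

Local Notation lf := (@lform R N).

Lemma linear_formD u v : lf (u + v) = lf u + lf v.
Proof.
rewrite lform.unlock /linear_form -big_split; apply: eq_bigr => i _ /=.
by rewrite mxE rmorphD scalerDl.
Qed.

Lemma linear_formZ (a : R) v : lf (a *: v) = a%:C *: lf v.
Proof.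
rewrite lform.unlock /linear_form scaler_sumr; apply: eq_bigr => i _ /=.
by rewrite mxE rmorphM scalerA.
Qed.

Lemma linear_form0 : lf 0 = 0.
Proof. by rewrite -(scale0r (0 : V)) linear_formZ scale0r. Qed.

Lemma linear_formN v : lf (- v) = - lf v.
Proof. by rewrite -scaleN1r linear_formZ rmorphN rmorph1 scaleN1r. Qed.

Lemma linear_formB u v : lf (u - v) = lf u - lf v.
Proof. by rewrite linear_formD linear_formN. Qed.

Lemma linear_form_delta i : lf (delta_mx 0 i) = x_ i.
Proof.
rewrite lform.unlock /linear_form (bigD1 i)//= mxE !eqxx scale1r big1 ?addr0// => j ji.
by rewrite mxE (negbTE ji) andbF scale0r.
Qed.

Lemma dird_linear_form v u : dird v (lf u) = (dot u v)%:C *: 1.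
Proof.
rewrite lform.unlock /linear_form dird_sum /dot rmorph_sum scaler_suml.
by apply: eq_bigr => i _; rewrite dirdZ dirdX scalerA rmorphM.
Qed.

Lemma lsub_linear_form M u : lsub M (lf u) = lf (u *m M^T).
Proof.
rewrite lform.unlock /linear_form lsub_sum; under eq_bigr do rewrite lsubZ lsubX scaler_sumr.
rewrite exchange_big/=; apply: eq_bigr => j _; rewrite mxE rmorph_sum scaler_suml.
by apply: eq_bigr => i _; rewrite scalerA mxE rmorphM.
Qed.

Lemma evl_linear_form u z : evl (lf u) z = \sum_i (u 0 i)%:C * z i.
Proof.
rewrite /evl lform.unlock /linear_form linear_sum/=; apply: eq_bigr => i _.
by rewrite mevalZ mevalXU.
Qed.

Lemma linear_form_eq0 u : (lf u == 0) = (u == 0).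
Proof.
apply/eqP/eqP => [h|->]; last exact: linear_form0.
apply/rowP => i; rewrite mxE.
have := congr1 (dird (delta_mx 0 i)) h; rewrite dird_linear_form dird0 dot_delta.
move/eqP; rewrite scaler_eq0 oner_eq0 orbF => /eqP h1.
by have := congr1 (@complex.Re R) h1.
Qed.

End Polynomials.

(** * Reflections and root systems *)

HB.lock Definition rquo (R : realType) N (alpha : 'rV[R]_N) (f : cpoly R N) : cpoly R N :=
  root_quotient alpha f.

Section Reflections.
Variables (R : realType) (N : nat).
Local Notation C := R[i].
Local Notation P := (cpoly R N).
Local Notation V := 'rV[R]_N.
Implicit Types (f g : P) (u v w alpha beta : V) (d : nat).
Local Notation lf := (@lform R N).

(* The coefficient of alpha in v - s_alpha v. *)
Definition cox alpha v : R := 2 * dot alpha v / dot alpha alpha.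

Lemma coxDr alpha u v : cox alpha (u + v) = cox alpha u + cox alpha v.
Proof. by rewrite /cox dotDr mulrDr mulrDl. Qed.

Lemma coxZr alpha (a : R) v : cox alpha (a *: v) = a * cox alpha v.
Proof. by rewrite /cox dotZr; ring. Qed.

Lemma coxNr alpha v : cox alpha (- v) = - cox alpha v.
Proof. by rewrite /cox dotNr; ring. Qed.

Lemma coxNl alpha v : cox (- alpha) v = - cox alpha v.
Proof. by rewrite /cox !dotNl dotNr opprK; ring. Qed.

Lemma cox_self alpha : alpha != 0 -> cox alpha alpha = 2.
Proof. by move=> a0; rewrite /cox mulfK// dot_eq0. Qed.

Lemma reflectE alpha v : v *m reflection alpha = v - cox alpha v *: alpha.
Proof.
rewrite /reflection mulmxBr mulmx1 -scalemxAr mulmxA.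
have -> : v *m alpha^T = (dot v alpha)%:M.
  apply/matrixP => i j; rewrite !ord1 !mxE eqxx mulr1n.
  by apply: eq_bigr => k _; rewrite mxE.
by rewrite mul_scalar_mx scalerA /cox (dotC v) mulrAC.
Qed.

Lemma trmx_reflection alpha : (reflection alpha)^T = reflection alpha.
Proof. by rewrite /reflection linearB/= linearZ/= trmx_mul trmxK trmx1. Qed.

Lemma reflectionN alpha : reflection (- alpha) = reflection alpha.
Proof.
rewrite /reflection dotNl dotNr opprK (_ : (- alpha)^T = - alpha^T).
  by rewrite mulNmx mulmxN opprK.
by apply/matrixP => i j; rewrite !mxE.
Qed.

Definition refl alpha f : P := lsub (reflection alpha) f.

Lemma reflD alpha f g : refl alpha (f + g) = refl alpha f + refl alpha g.
Proof. exact: lsubD. Qed.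

Lemma reflB alpha f g : refl alpha (f - g) = refl alpha f - refl alpha g.
Proof. exact: lsubB. Qed.

Lemma reflZ alpha a f : refl alpha (a *: f) = a *: refl alpha f.
Proof. exact: lsubZ. Qed.

Lemma reflM alpha f g : refl alpha (f * g) = refl alpha f * refl alpha g.
Proof. exact: lsubM. Qed.

Lemma refl_neg alpha f : refl (- alpha) f = refl alpha f.
Proof. by rewrite /refl reflectionN. Qed.

Section Alpha.
Variable alpha : V.
Hypothesis a0 : alpha != 0.

Lemma reflection_invol : reflection alpha *m reflection alpha = 1%:M.
Proof. by apply: reflectionK; rewrite dot_eq0. Qed.

Lemma dot_reflect u v :
  dot (u *m reflection alpha) (v *m reflection alpha) = dot u v.
Proof. by rewrite dot_mul trmx_reflection -mulmxA reflection_invol mulmx1. Qed.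

Lemma reflection_unit : reflection alpha \in unitmx.
Proof. by have [] := mulmx1_unit reflection_invol. Qed.

Lemma invmx_reflection : invmx (reflection alpha) = reflection alpha.
Proof. by rewrite -[LHS]mulmx1 -reflection_invol mulKmx// reflection_unit. Qed.

Lemma geom_act_refl f : geom_act (reflection alpha) f = refl alpha f.
Proof. by rewrite geom_actE invmx_reflection. Qed.

Lemma reflK f : refl alpha (refl alpha f) = f.
Proof. by rewrite /refl lsub_mul reflection_invol lsub1. Qed.

Lemma refl_lf v : refl alpha (lf v) = lf v - (cox alpha v)%:C *: lf alpha.
Proof.
by rewrite /refl lsub_linear_form trmx_reflection reflectE linear_formB linear_formZ.
Qed.

Lemma root_quotientE f : lf alpha * rquo alpha f = f - refl alpha f.
Proof.
have da0 : dot alpha alpha != 0 by rewrite dot_eq0.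
by rewrite rquo.unlock lform.unlock (root_quotientP f da0) geom_act_refl.
Qed.

(** Polynomials form a domain, so the divided difference is determined by its equation; the later
    rules for [rquo] are checked after multiplication by alpha. *)
Lemma root_quotient_eq f q :
  lf alpha * q = f - refl alpha f -> rquo alpha f = q.
Proof.
move=> h; apply: (@mulfI _ (lf alpha)); first by rewrite linear_form_eq0.
by rewrite h root_quotientE.
Qed.

Lemma root_quotientD f g :
  rquo alpha (f + g) = rquo alpha f + rquo alpha g.
Proof.
apply: root_quotient_eq; rewrite mulrDr !root_quotientE reflD.
by rewrite opprD addrACA.
Qed.

Lemma root_quotientZ a f : rquo alpha (a *: f) = a *: rquo alpha f.
Proof.
by apply: root_quotient_eq; rewrite -scalerAr root_quotientE reflZ scalerBr.
Qed.

Lemma root_quotient0 : rquo alpha 0 = 0.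
Proof. by have := root_quotientZ 0 0; rewrite !scale0r. Qed.

Lemma root_quotient_one : rquo alpha 1 = 0.
Proof. by apply: root_quotient_eq; rewrite mulr0 /refl lsub_one subrr. Qed.

(** The twisted Leibniz rule of a divided difference, for a linear left factor. *)
Lemma root_quotient_lf v f : rquo alpha (lf v * f) =
  lf v * rquo alpha f + (cox alpha v)%:C *: refl alpha f.
Proof.
apply: root_quotient_eq.
rewrite mulrDr mulrCA root_quotientE reflM refl_lf -scalerAr mulrBr mulrBl.
by rewrite -scalerAl opprB -addrA; congr (_ + _); rewrite addrC.
Qed.

Lemma hom_root_quotient d f : hom d f -> hom d.-1 (rquo alpha f).
Proof.
move=> hf; elim/hom_ind: hf => {d f}[a|d|d f g Hf Hg|d a f Hf|d i f hf Hf].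
- by rewrite root_quotientZ root_quotient_one scaler0; exact: hom0.
- by rewrite root_quotient0; exact: hom0.
- by rewrite root_quotientD; exact: homD.
- by rewrite root_quotientZ; exact: homZ.
- rewrite -linear_form_delta root_quotient_lf linear_form_delta/=.
  apply: homD; last by apply: homZ; exact: hom_lsub.
  case: d hf Hf => [|d] hf Hf; last exact: homX.
  have [a ->] := hom0E hf.
  by rewrite root_quotientZ root_quotient_one scaler0 mulr0; exact: hom0.
Qed.

End Alpha.

Lemma root_quotientN alpha f : alpha != 0 ->
  rquo (- alpha) f = - rquo alpha f.
Proof.
move=> a0; apply: root_quotient_eq; first by rewrite oppr_eq0.
by rewrite linear_formN mulrNN root_quotientE// refl_neg.
Qed.

Section Orthogonal.
Variable M : 'M[R]_N.
Hypothesis MT : M *m M^T = 1%:M.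

Lemma orth_trmx : M^T *m M = 1%:M.
Proof. exact: mulmx1C. Qed.

Lemma orth_dot u v : dot (u *m M) (v *m M) = dot u v.
Proof. by rewrite dot_mul -mulmxA MT mulmx1. Qed.

Lemma orth_dotT u v : dot (u *m M^T) (v *m M^T) = dot u v.
Proof. by rewrite dot_mul trmxK -mulmxA orth_trmx mulmx1. Qed.

Lemma orth_eq0T u : (u *m M^T == 0) = (u == 0).
Proof. by rewrite -(dot_eq0 (u *m _)) orth_dotT dot_eq0. Qed.

Lemma reflection_orth alpha :
  reflection (alpha *m M^T) *m M = M *m reflection alpha.
Proof.
rewrite /reflection orth_dotT trmx_mul trmxK mulmxBl mulmxBr mul1mx mulmx1.
rewrite -scalemxAl -scalemxAr; congr (_ - _ *: _).
by rewrite -!mulmxA orth_trmx mulmx1.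
Qed.

Lemma refl_orth alpha f : refl (alpha *m M^T) (lsub M f) = lsub M (refl alpha f).
Proof. by rewrite /refl !lsub_mul reflection_orth. Qed.

Lemma root_quotient_orth alpha f : alpha != 0 ->
  rquo (alpha *m M^T) (lsub M f) = lsub M (rquo alpha f).
Proof.
move=> a0; apply: root_quotient_eq; first by rewrite orth_eq0T.
by rewrite -lsub_linear_form -lsubM root_quotientE// lsubB refl_orth.
Qed.

End Orthogonal.

End Reflections.

(** * Positive systems, the Coxeter group and chambers *)

Section RootSystem.
Variables (R : realType) (N : nat).
Local Notation C := R[i].
Local Notation P := (cpoly R N).
Local Notation V := 'rV[R]_N.
Implicit Types (f g : P) (u v alpha beta : V) (d : nat).
Variables (Phi : seq V) (Delta : N.-tuple V).
Hypothesis Phi_root : root_system Phi.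
Hypothesis Delta_simple : simple_system Phi Delta.
Local Notation Pos := (positive_roots Phi Delta).
Local Notation simple i := (tnth Delta i).

Lemma root_nonzero alpha : alpha \in Phi -> alpha != 0.
Proof. by move=> aP; apply: contraNneq (root_neq0 Phi_root) => <-. Qed.

Lemma rootN alpha : alpha \in Phi -> - alpha \in Phi.
Proof.
move=> aP; have := root_stable Phi_root aP aP.
rewrite reflectE cox_self ?root_nonzero//.
by rewrite -{1}(scale1r alpha) -scalerBl (_ : 1 - 2 = -1) ?scaleN1r//; ring.
Qed.

Lemma simpleP i : simple i \in Phi.
Proof. by apply: (simple_root Delta_simple); exact: mem_tnth. Qed.

Lemma simple_indep (k : 'I_N -> R) :
  \sum_i k i *: simple i = 0 -> forall i, k i = 0.
Proof.
have /freeP h := simple_free Delta_simple.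
move=> k0 i; apply: (h k) => //.
by rewrite -[RHS]k0; apply: eq_bigr => j _; rewrite (tnth_nth 0).
Qed.

Lemma simple_coord_inj (k l : 'I_N -> R) :
  \sum_i k i *: simple i = \sum_i l i *: simple i -> k =1 l.
Proof.
move=> kl i; apply/eqP; rewrite -subr_eq0; apply/eqP.
apply: (@simple_indep (fun i => k i - l i)).
under eq_bigr do rewrite scalerBl.
by rewrite sumrB kl subrr.
Qed.

Lemma simple_span v : exists k : 'I_N -> R, v = \sum_i k i *: simple i.
Proof.
have : v \in <<Delta>>%VS.
  have -> : <<Delta>>%VS = fullv :> {vspace V}; last exact: memvf.
  apply/eqP; rewrite eqEdim subvf/=.
  have /eqP -> := simple_free Delta_simple.
  by rewrite size_tuple dimvf/= /dim/= mul1n.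
move=> /coord_span vE; exists (fun i => coord Delta i v).
by rewrite {1}vE; apply: eq_bigr => i _; rewrite (tnth_nth 0).
Qed.

Lemma simple_dot_inj u v : (forall i, dot u (simple i) = dot v (simple i)) -> u = v.
Proof.
move=> h; apply: dot_inj => w; have [k ->] := simple_span w.
by rewrite !dot_sumr; apply: eq_bigr => i _; rewrite !dotZr h.
Qed.

Lemma mem_pos alpha : (alpha \in Pos) = (alpha \in Phi) && `[< nonneg_comb Delta alpha >].
Proof. by rewrite mem_filter andbC. Qed.

Lemma pos_root alpha : alpha \in Pos -> alpha \in Phi.
Proof. by rewrite mem_pos => /andP[]. Qed.

Lemma pos_nonzero alpha : alpha \in Pos -> alpha != 0.
Proof. by move=> /pos_root/root_nonzero. Qed.

Lemma pos_uniq : uniq Pos.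
Proof. by apply: filter_uniq; exact: root_uniq Phi_root. Qed.

Lemma posN alpha : alpha \in Pos -> (- alpha \in Pos) = false.
Proof.
move=> aP; apply/negP => naP.
move: (aP) naP; rewrite !mem_pos => /andP[_ /asboolP[k k0 ak]] /andP[_ /asboolP[l l0 al]].
have kl0 i : k i + l i = 0.
  apply: (@simple_indep (fun i => k i + l i)).
  under eq_bigr do rewrite scalerDl.
  by rewrite big_split/= -ak -al subrr.
have : alpha != 0 by exact: pos_nonzero aP.
rewrite ak big1 ?eqxx// => i _.
have /eqP := kl0 i; rewrite paddr_eq0// => /andP[/eqP -> _].
by rewrite scale0r.
Qed.

Lemma posVneg alpha : alpha \in Phi -> (alpha \in Pos) || (- alpha \in Pos).
Proof.
move=> aP; rewrite !mem_pos aP rootN//=.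
by have [h|h] := simple_sign Delta_simple aP; apply/orP; [left|right]; apply/asboolP.
Qed.

Definition to_pos alpha : V := if alpha \in Pos then alpha else - alpha.

Lemma to_pos_mem alpha : alpha \in Phi -> to_pos alpha \in Pos.
Proof. by move=> /posVneg; rewrite /to_pos; case: ifP. Qed.

Lemma to_posP alpha : to_pos alpha = alpha \/ to_pos alpha = - alpha.
Proof. by rewrite /to_pos; case: ifP; [left|right]. Qed.

(** Of alpha and - alpha exactly one is positive, and M permutes these pairs; [to_pos] picks the
    positive representative. *)
Lemma pos_perm (M : 'M[R]_N) : M *m M^T = 1%:M ->
  (forall alpha, alpha \in Phi -> alpha *m M \in Phi) ->
  perm_eq [seq to_pos (alpha *m M) | alpha <- Pos] Pos.
Proof.
move=> MT MP.
have uM : uniq [seq to_pos (alpha *m M) | alpha <- Pos].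
  rewrite map_inj_in_uniq ?pos_uniq// => a b aP bP h.
  have {h} : a *m M = b *m M \/ a *m M = (- b) *m M.
    rewrite mulNmx; move: h.
    have [-> | ->] := to_posP (a *m M); have [-> | ->] := to_posP (b *m M).
    - by left.
    - by right.
    - by move=> <-; right; rewrite opprK.
    - by move=> /oppr_inj; left.
  have injM : injective (mulmxr M : V -> V).
    by move=> x y /= /(congr1 (mulmxr M^T)) /=; rewrite -!mulmxA MT !mulmx1.
  case=> /injM // ab; by move: aP; rewrite ab posN.
apply: uniq_perm => //; first exact: pos_uniq.
have sub : {subset [seq to_pos (alpha *m M) | alpha <- Pos] <= Pos}.
  by move=> _ /mapP[a aP ->]; apply: to_pos_mem; apply: MP; exact: pos_root.
have [//|_ h] := uniq_min_size uM sub.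
by rewrite size_map.
by move=> x; rewrite h.
Qed.

Lemma big_pos_perm (T : Type) (idx : T) (op : Monoid.com_law idx) (F : V -> T)
  (M : 'M[R]_N) : M *m M^T = 1%:M ->
  (forall alpha, alpha \in Phi -> alpha *m M \in Phi) ->
  (forall alpha, alpha \in Phi -> F (- alpha) = F alpha) ->
  \big[op/idx]_(alpha <- Pos) F (alpha *m M) = \big[op/idx]_(alpha <- Pos) F alpha.
Proof.
move=> MT MP Fe; rewrite -[RHS](perm_big _ (pos_perm MT MP))/= big_map.
rewrite big_seq [RHS]big_seq; apply: eq_bigr => a /pos_root/MP aP.
by have [-> | ->] := to_posP (a *m M); rewrite ?Fe.
Qed.

Lemma coxeter_orth w : coxeter_group Phi w -> w *m w^T = 1%:M.
Proof.
elim=> [|{}w a _ IH aP]; first by rewrite trmx1 mulmx1.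
rewrite trmx_mul trmx_reflection mulmxA -(mulmxA w) reflection_invol ?mulmx1//.
exact: root_nonzero.
Qed.

Lemma coxeter_root w alpha : coxeter_group Phi w -> alpha \in Phi ->
  alpha *m w \in Phi.
Proof.
move=> wW; elim: wW alpha => [a|{}w b _ IH bP a aP]; first by rewrite mulmx1.
by rewrite mulmxA; apply: (root_stable Phi_root) => //; exact: IH.
Qed.

Lemma coxeter_rootT w alpha : coxeter_group Phi w -> alpha \in Phi ->
  alpha *m w^T \in Phi.
Proof.
move=> wW; elim: wW alpha => [a|{}w b _ IH bP a aP]; first by rewrite trmx1 mulmx1.
rewrite trmx_mul trmx_reflection mulmxA; apply: IH.
exact: (root_stable Phi_root).
Qed.

Lemma coxeter_geom_act w f : coxeter_group Phi w -> geom_act w f = lsub w^T f.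
Proof.
move=> /coxeter_orth ww; rewrite geom_actE; congr lsub.
by have [wu _] := mulmx1_unit ww; rewrite -[LHS]mulmx1 -ww mulKmx.
Qed.

Lemma coxeter_reflection alpha : alpha \in Phi ->
  coxeter_group Phi (reflection alpha).
Proof. by move=> aP; rewrite -(mul1mx (reflection _)); constructor=> //; constructor. Qed.

Lemma coxeter_mul w w' : coxeter_group Phi w -> coxeter_group Phi w' ->
  coxeter_group Phi (w *m w').
Proof.
move=> wW; elim=> [|{}w' b _ IH bP]; first by rewrite mulmx1.
by rewrite mulmxA; constructor.
Qed.

Lemma coxeter_tr w : coxeter_group Phi w -> coxeter_group Phi w^T.
Proof.
elim=> [|{}w b _ IH bP]; first by rewrite trmx1; constructor.
by rewrite trmx_mul trmx_reflection; apply: coxeter_mul => //; exact: coxeter_reflection.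
Qed.

Lemma simple_pos i : simple i \in Pos.
Proof.
rewrite mem_pos simpleP/=; apply/asboolP; exists (fun j => (j == i)%:R).
  by move=> j; rewrite ler0n.
rewrite (bigD1 i)//= eqxx scale1r big1 ?addr0// => j ji.
by rewrite (negbTE ji) scale0r.
Qed.

(** Since the system is reduced, alpha has a positive coordinate other than i. The reflection
    changes only the coordinate i, so the image cannot be a negative root. *)
Lemma simple_reflect_pos i alpha : alpha \in Pos -> alpha != simple i ->
  alpha *m reflection (simple i) \in Pos.
Proof.
move=> aP ai; have aPhi := pos_root aP.
have rP := root_stable Phi_root (simpleP i) aPhi.
move: (aP); rewrite mem_pos aPhi/= => /asboolP[k k0 ak].
have [j ji kj] : exists2 j, j != i & k j != 0.
  apply: contrapT => h.
  have {}ak : alpha = k i *: simple i.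
    rewrite ak (bigD1 i)//= big1 ?addr0// => j ji.
    have [->|kj] := eqVneq (k j) 0; first by rewrite scale0r.
    by exfalso; apply: h; exists j.
  have [k1|k1] := root_reduced Phi_root (simpleP i) (etrans (congr1 (mem Phi) (esym ak)) aPhi).
    by move: ai; rewrite ak k1 scale1r eqxx.
  by move: (k0 i); rewrite k1 ler0N1.
case/orP: (posVneg rP) => // nP; exfalso.
move: nP; rewrite mem_pos => /andP[_ /asboolP[l l0]].
rewrite reflectE opprB => h.
have : \sum_m (l m + k m) *: simple m = \sum_m (if m == i then cox (simple i) alpha else 0) *: simple m.
  under eq_bigr do rewrite scalerDl.
  rewrite big_split/= -h -ak subrK [RHS](bigD1 i)//= eqxx big1 ?addr0// => m mi.
  by rewrite (negbTE mi) scale0r.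
move=> /simple_coord_inj /(_ j); rewrite (negbTE ji) => /eqP.
by rewrite paddr_eq0// (negbTE kj) andbF.
Qed.

(** Induction on the number of positive roots that are negative at x. If a simple root is negative
    there, its reflection makes it positive and permutes the other positive roots, so the number
    drops. *)
Lemma dominant x : exists2 w, coxeter_group Phi w &
  forall i, 0 <= dot (x *m w) (simple i).
Proof.
move: {2}(count _ _) (leqnn (count (fun a => dot a x < 0) Pos)) => n.
elim: n x => [|n IH] x.
  rewrite leqn0 => /eqP h; exists 1%:M; first by constructor.
  move=> i; rewrite mulmx1 leNgt; apply/negP => xi.
  have : has (fun a => dot a x < 0) Pos.
    by apply/hasP; exists (simple i); [exact: simple_pos|rewrite dotC].
  by rewrite has_count h.
move=> hn.
have [h|/existsNP[i /negP]] := pselect (forall i, 0 <= dot x (simple i)).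
  by exists 1%:M; [constructor|move=> i; rewrite mulmx1].
rewrite -ltNge => xi.
have iP := simpleP i; have i0 := root_nonzero iP.
have := IH (x *m reflection (simple i)); case=> [|w wW h].
  have iPos := simple_pos i.
  set s := reflection (simple i); set Q := rem (simple i) Pos.
  have uQ : uniq (simple i :: Q) by rewrite -(perm_uniq (perm_to_rem iPos)) pos_uniq.
  have QE a : (a \in Q) = (a \in Pos) && (a != simple i).
    by rewrite /Q mem_rem_uniq ?pos_uniq// inE andbC.
  have sQ : perm_eq [seq a *m s | a <- Q] Q.
    have uM : uniq [seq a *m s | a <- Q].
      rewrite map_inj_uniq; first by case/andP: uQ.
      move=> a b /(congr1 (mulmxr s)) /=.
      by rewrite -!mulmxA reflection_invol// !mulmx1.
    apply: uniq_perm => //; first by case/andP: uQ.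
    have sub : {subset [seq a *m s | a <- Q] <= Q}.
      move=> _ /mapP[a + ->]; rewrite !QE => /andP[aPos ai].
      rewrite simple_reflect_pos//=; apply/eqP => /(congr1 (mulmxr s)) /=.
      rewrite -mulmxA reflection_invol// mulmx1 reflectE cox_self// => aE.
      have {}aE : a = - simple i by rewrite aE -{1}[simple i]scale1r -scalerBl (_ : 1 - 2 = -1) ?scaleN1r//; ring.
      by move: aPos; rewrite aE posN.
    have [//|_ h] := uniq_min_size uM sub.
      by rewrite size_map.
    by move=> y; rewrite h.
  move: hn; rewrite !(permP (perm_to_rem iPos))/= -/Q.
  rewrite [dot (simple i) x]dotC xi add1n ltnS; apply: leq_trans.
  have -> : dot (simple i) (x *m s) < 0 = false.
    rewrite dotC dot_mul trmx_reflection reflectE cox_self// dotBr dotZr.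
    by apply/negbTE; rewrite -leNgt; lra.
  rewrite add0n -[X in (_ <= X)%N](permP sQ) count_map.
  rewrite (@eq_count _ (fun a => dot a (x *m s) < 0) (preim (mulmxr s) (fun a => dot a x < 0)))// => a /=.
  by rewrite dotC dot_mul trmx_reflection dotC.
exists (reflection (simple i) *m w); last by move=> j; rewrite mulmxA.
by apply: coxeter_mul => //; exact: coxeter_reflection.
Qed.

End RootSystem.

(** * Dunkl operators *)

HB.lock Definition dk (R : realType) N (Phi : seq 'rV[R]_N)
    (Delta : N.-tuple 'rV[R]_N) (c : R) (xi : 'rV[R]_N) (f : cpoly R N) : cpoly R N :=
  dunkl Phi Delta c xi f.

HB.lock Definition KK (R : realType) N (Phi : seq 'rV[R]_N)
    (Delta : N.-tuple 'rV[R]_N) (f : cpoly R N) : cpoly R N :=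
  \sum_(alpha <- positive_roots Phi Delta) (f - refl alpha f).

Section Dunkl.
Variables (R : realType) (N : nat).
Local Notation C := R[i].
Local Notation P := (cpoly R N).
Local Notation V := 'rV[R]_N.
Implicit Types (f g : P) (u v xi eta alpha beta : V) (d : nat).
Variables (Phi : seq V) (Delta : N.-tuple V) (c : R).
Hypothesis Phi_root : root_system Phi.
Hypothesis Delta_simple : simple_system Phi Delta.
Local Notation Pos := (positive_roots Phi Delta).
Local Notation lf := (@lform R N).
Local Notation x_ := (@xvar R N).
Local Notation dk := (@dk R N Phi Delta c).
Local Notation KK := (@KK R N Phi Delta).
Local Notation y_ i := (dk (delta_mx 0 i)).

Lemma dkE xi f : dk xi f =
  dird xi f - \sum_(alpha <- Pos) (c * dot alpha xi)%:C *: rquo alpha f.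
Proof. by rewrite dk.unlock dird.unlock rquo.unlock. Qed.

Lemma dkD xi f g : dk xi (f + g) = dk xi f + dk xi g.
Proof.
rewrite !dkE dirdD addrACA -opprD -big_split/=; congr (_ - _).
rewrite big_seq [RHS]big_seq; apply: eq_bigr => a aP.
by rewrite (root_quotientD (pos_nonzero Phi_root aP)) scalerDr.
Qed.

Lemma dkZ xi a f : dk xi (a *: f) = a *: dk xi f.
Proof.
rewrite !dkE dirdZ scalerBr; congr (_ - _); rewrite scaler_sumr.
rewrite big_seq [RHS]big_seq; apply: eq_bigr => b bP.
by rewrite (root_quotientZ (pos_nonzero Phi_root bP)) !scalerA mulrC.
Qed.

Lemma dk0 xi : dk xi 0 = 0.
Proof. by have := dkZ xi 0 0; rewrite !scale0r. Qed.

Lemma dk_sum xi (I : Type) (r : seq I) (p : pred I) (F : I -> P) :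
  dk xi (\sum_(i <- r | p i) F i) = \sum_(i <- r | p i) dk xi (F i).
Proof. by apply: (big_morph (dk xi)) => [f g|]; [exact: dkD|exact: dk0]. Qed.

Lemma dk_one xi : dk xi 1 = 0.
Proof.
rewrite dkE dird_one big_seq big1 ?subrr// => a aP.
by rewrite (root_quotient_one (pos_nonzero Phi_root aP)) scaler0.
Qed.

Lemma dkDl xi eta f : dk (xi + eta) f = dk xi f + dk eta f.
Proof.
rewrite !dkE dirdDl addrACA -opprD -big_split/=; congr (_ - _).
by apply: eq_bigr => a _; rewrite dotDr mulrDr rmorphD scalerDl.
Qed.

Lemma dkZl (a : R) xi f : dk (a *: xi) f = a%:C *: dk xi f.
Proof.
rewrite !dkE dirdZl scalerBr; congr (_ - _); rewrite scaler_sumr.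
by apply: eq_bigr => b _; rewrite dotZr mulrCA scalerA -rmorphM.
Qed.

Lemma dk0l f : dk 0 f = 0.
Proof. by have := dkZl 0 0 f; rewrite !scale0r. Qed.

Lemma dk_suml (I : Type) (r : seq I) (p : pred I) (F : I -> V) f :
  dk (\sum_(i <- r | p i) F i) f = \sum_(i <- r | p i) dk (F i) f.
Proof. by apply: (big_morph (fun v => dk v f)) => [u v|]; rewrite ?dkDl ?dk0l. Qed.

Lemma dk_y xi f : dk xi f = \sum_i (xi 0 i)%:C *: y_ i f.
Proof.
rewrite {1}[xi]row_sum_delta dk_suml; apply: eq_bigr => i _.
by rewrite dkZl.
Qed.

(** The commutation relation of the rational Cherednik algebra between y_xi and x_eta, from the
    Leibniz rules of the derivative and of the divided differences. *)
Lemma dk_lf xi eta f : dk xi (lf eta * f) =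
  lf eta * dk xi f + (dot xi eta)%:C *: f
  - \sum_(alpha <- Pos) (c * dot alpha xi * cox alpha eta)%:C *: refl alpha f.
Proof.
rewrite !dkE dirdM dird_linear_form -scalerAl mul1r dotC.
set A := \sum_(_ <- _) _ *: rquo _ (_ * _); set B := \sum_(_ <- _) _ *: rquo _ _.
set D := \sum_(_ <- _) _ *: refl _ _.
have -> : A = lf eta * B + D.
  rewrite /B mulr_sumr -big_split/=.
  rewrite /A big_seq [RHS]big_seq; apply: eq_bigr => a aP.
  rewrite (root_quotient_lf (pos_nonzero Phi_root aP)) scalerDr scalerA -rmorphM.
  by congr (_ + _); exact: scalerAr.
rewrite mulrBr opprD [LHS]addrA; congr (_ - _).
by rewrite [LHS]addrAC [LHS]addrC addrA addrAC.
Qed.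

Lemma dk_lsub (M : 'M[R]_N) xi f : M *m M^T = 1%:M ->
  (forall alpha, alpha \in Phi -> alpha *m M^T \in Phi) ->
  lsub M (dk xi f) = dk (xi *m M^T) (lsub M f).
Proof.
move=> MT MP; rewrite !dkE lsubB dird_lsub -mulmxA (orth_trmx MT) mulmx1.
congr (_ - _); rewrite lsub_sum.
have MT' : M^T *m M^T^T = 1%:M by rewrite trmxK; exact: orth_trmx.
rewrite -[RHS](@big_pos_perm _ _ Phi Delta Phi_root Delta_simple _ _ _ _ M^T MT' MP)/=.
  rewrite big_seq [RHS]big_seq; apply: eq_bigr => a aP.
  by rewrite lsubZ (orth_dotT MT) (root_quotient_orth MT _ (pos_nonzero Phi_root aP)).
move=> a aP; rewrite (root_quotientN _ (root_nonzero Phi_root aP)) dotNl.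
by rewrite mulrN rmorphN scaleNr scalerN opprK.
Qed.

Lemma refl_dk alpha xi f : alpha \in Phi ->
  refl alpha (dk xi f) = dk (xi *m reflection alpha) (refl alpha f).
Proof.
move=> aP; rewrite /refl dk_lsub ?trmx_reflection//.
  by rewrite reflection_invol ?(root_nonzero Phi_root).
by move=> b bP; apply: (root_stable Phi_root).
Qed.

Lemma hom_dk d xi f : hom d f -> hom d.-1 (dk xi f).
Proof.
move=> hf; rewrite dkE; apply: homB; first exact: hom_dird.
rewrite big_seq; apply: hom_sum => a aP; apply: homZ.
by apply: hom_root_quotient => //; exact: (pos_nonzero Phi_root aP).
Qed.

Lemma hom0_dk xi f : hom 0 f -> dk xi f = 0.
Proof. by move=> /hom0E[a ->]; rewrite dkZ dk_one scaler0. Qed.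

Lemma KKE f : KK f = \sum_(alpha <- Pos) (f - refl alpha f).
Proof. by rewrite KK.unlock. Qed.

Lemma KKD f g : KK (f + g) = KK f + KK g.
Proof.
rewrite !KKE -big_split; apply: eq_bigr => a _ /=.
by rewrite reflD opprD addrACA.
Qed.

Lemma KKZ a f : KK (a *: f) = a *: KK f.
Proof. by rewrite !KKE scaler_sumr; apply: eq_bigr => b _; rewrite reflZ scalerBr. Qed.

Lemma KK0 : KK 0 = 0.
Proof. by have := KKZ 0 0; rewrite !scale0r. Qed.

Lemma KKN f : KK (- f) = - KK f.
Proof. by rewrite -scaleN1r KKZ scaleN1r. Qed.

Lemma KKB f g : KK (f - g) = KK f - KK g.
Proof. by rewrite KKD KKN. Qed.

Lemma KK_sum (I : Type) (r : seq I) (p : pred I) (F : I -> P) :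
  KK (\sum_(i <- r | p i) F i) = \sum_(i <- r | p i) KK (F i).
Proof. by apply: (big_morph KK) => [f g|]; [exact: KKD|exact: KK0]. Qed.

Lemma hom_KK d f : hom d f -> hom d (KK f).
Proof.
by move=> hf; rewrite KKE; apply: hom_sum => a _; apply: homB => //; exact: hom_lsub.
Qed.

Lemma KK_lsub (M : 'M[R]_N) f : M *m M^T = 1%:M ->
  (forall alpha, alpha \in Phi -> alpha *m M^T \in Phi) ->
  KK (lsub M f) = lsub M (KK f).
Proof.
move=> MT MP; rewrite !KKE lsub_sum.
have MT' : M^T *m M^T^T = 1%:M by rewrite trmxK; exact: orth_trmx.
rewrite -[LHS](@big_pos_perm _ _ Phi Delta Phi_root Delta_simple _ _ _ _ M^T MT' MP)/=.
  by apply: eq_bigr => a _; rewrite (refl_orth MT) lsubB.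
by move=> a _; rewrite refl_neg.
Qed.

Lemma KK_refl alpha f : alpha \in Phi -> KK (refl alpha f) = refl alpha (KK f).
Proof.
move=> aP; rewrite /refl KK_lsub ?trmx_reflection//.
  by rewrite reflection_invol ?(root_nonzero Phi_root).
by move=> b bP; apply: (root_stable Phi_root).
Qed.

(** Contracting a difference term with x turns the coefficients (alpha, e_i) into the linear form
    alpha, which cancels the denominator and leaves f - s_alpha f. *)
Lemma sum_xy f : \sum_i x_ i * y_ i f = \sum_i x_ i * mderiv i f - c%:C *: KK f.
Proof.
under eq_bigr do rewrite dkE dird_delta mulrBr.
rewrite sumrB; congr (_ - _).
under eq_bigr do rewrite mulr_sumr.
rewrite exchange_big/= KKE scaler_sumr big_seq [RHS]big_seq.
apply: eq_bigr => a aP; rewrite -(root_quotientE (pos_nonzero Phi_root aP)).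
rewrite lform.unlock /linear_form mulr_suml scaler_sumr; apply: eq_bigr => i _.
by rewrite -scalerAr -scalerAl scalerA dot_delta rmorphM.
Qed.

Lemma sum_xy_hom d f : hom d f -> \sum_i x_ i * y_ i f = d%:R *: f - c%:C *: KK f.
Proof. by move=> hf; rewrite sum_xy (euler hf). Qed.

(** * Submodules are graded *)

Section Submodule.
Variable S : set P.
Hypothesis S_sub : submodule Phi Delta c S.

Lemma sub0 : S 0. Proof. exact: (submodule0 S_sub). Qed.

Lemma subD f g : S f -> S g -> S (f + g). Proof. exact: (submoduleD S_sub). Qed.

Lemma geom_act1 f : geom_act 1%:M f = f.
Proof. by rewrite geom_actE invmx1 lsub1. Qed.

Lemma subZ a f : S f -> S (a *: f).
Proof.
move=> Sf.
have := submoduleH S_sub (cherednik_scale a (cherednik_group Delta c (coxeter_group1 Phi))) Sf.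
by rewrite geom_act1.
Qed.

Lemma subN f : S f -> S (- f).
Proof. by rewrite -scaleN1r; exact: subZ. Qed.

Lemma subB f g : S f -> S g -> S (f - g).
Proof. by move=> Sf /subN; exact: subD. Qed.

Lemma sub_sum (I : eqType) (r : seq I) (p : pred I) (F : I -> P) :
  (forall i, i \in r -> p i -> S (F i)) -> S (\sum_(i <- r | p i) F i).
Proof.
move=> h; rewrite big_seq_cond; apply: (big_ind S); [exact: sub0|exact: subD|].
by move=> i /andP[]; exact: h.
Qed.

Lemma sub_geom w f : coxeter_group Phi w -> S f -> S (geom_act w f).
Proof. by move=> wW; apply: (submoduleH S_sub); constructor. Qed.

Lemma sub_refl alpha f : alpha \in Phi -> S f -> S (refl alpha f).
Proof.
move=> aP; rewrite -geom_act_refl ?(root_nonzero Phi_root)//.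
by apply: sub_geom; exact: coxeter_reflection.
Qed.

Lemma sub_x i f : S f -> S (x_ i * f).
Proof. by apply: (submoduleH S_sub (h := fun f => x_ i * f)); constructor. Qed.

Lemma sub_y i f : S f -> S (y_ i f).
Proof.
rewrite dk.unlock; apply: (submoduleH S_sub (h := fun f => dunkl Phi Delta c _ f)).
exact: cherednik_y.
Qed.

Lemma sub_dk xi f : S f -> S (dk xi f).
Proof. by move=> Sf; rewrite dk_y; apply: sub_sum => i _ _; apply: subZ; exact: sub_y. Qed.

Lemma sub_mul g f : S f -> S (g * f).
Proof.
move=> Sf; elim/mpoly_alg_ind: g => [a|g h Hg Hh|i g Hg].
- by rewrite -scalerAl mul1r; exact: subZ.
- by rewrite mulrDl; exact: subD.
- by rewrite -mulrA; exact: sub_x.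
Qed.

Lemma sub_KK f : S f -> S (KK f).
Proof.
move=> Sf; rewrite KKE; apply: sub_sum => a /pos_root aP _.
by apply: subB => //; exact: sub_refl.
Qed.

Lemma sub_euler f : S f -> S (\sum_i x_ i * mderiv i f).
Proof.
move=> Sf; have -> : \sum_i x_ i * mderiv i f = \sum_i x_ i * y_ i f + c%:C *: KK f.
  by rewrite sum_xy subrK.
apply: subD; last by apply: subZ; exact: sub_KK.
by apply: sub_sum => i _ _; apply: sub_x; exact: sub_y.
Qed.

(** The Euler operator preserves S. Subtracting k times a sum of components from its Euler image
    kills the top degree k and multiplies the component of degree e by the nonzero number e - k, so
    induction on the number of components isolates each of them. *)
Lemma sub_comp_hom d f : S f -> S (comp_hom d f).
Proof.
move=> Sf.
have key k (g : nat -> P) : (forall e, hom e (g e)) ->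
    S (\sum_(e < k) g e) -> forall e, (e < k)%N -> S (g e).
  elim: k g => [//|k IH] g hg Sg.
  have h e : (e < k)%N -> S (g e).
    move=> ek; have k0 : (e%:R - k%:R : C) != 0.
      by rewrite subr_eq0 eqr_nat neq_ltn ek.
    rewrite -[g e]scale1r -(mulVf k0) -scalerA; apply: subZ.
    apply: (IH (fun e => (e%:R - k%:R) *: g e)) => // [e'|]; first exact: homZ.
    have : S (\sum_(e < k.+1) (e%:R - k%:R) *: g e).
      under eq_bigr do rewrite scalerBl -(euler (hg _)).
      rewrite sumrB; apply: subB; last by rewrite -scaler_sumr; exact: subZ.
      rewrite exchange_big/=; under eq_bigr do rewrite -mulr_sumr -raddf_sum.
      exact: sub_euler.
    by rewrite big_ord_recr/= subrr scale0r addr0.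
  move=> e; rewrite ltnS leq_eqVlt => /predU1P[->|/h//].
  have -> : g k = \sum_(e < k.+1) g e - \sum_(e < k) g e.
    by rewrite big_ord_recr/= addrC addrK.
  by apply: subB => //; apply: sub_sum => i _ _; exact: h.
have [h|h] := leqP (mmeasure mdeg f) d; first by rewrite comp_hom_eq0//; exact: sub0.
apply: (key (mmeasure mdeg f) (fun e => comp_hom e f)) => //.
- by move=> e; exact: comp_homP.
- by rewrite -comp_hom_sum.
Qed.

End Submodule.

End Dunkl.

(** * The Fischer form *)

Lemma conj_realC (R : realType) (x : R) : (x%:C)^*%C = x%:C.
Proof. by apply/eqP; rewrite eq_complex /= oppr0 !eqxx. Qed.

Section Fischer.
Variables (R : realType) (N : nat).
Local Notation C := R[i].
Local Notation P := (cpoly R N).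
Local Notation V := 'rV[R]_N.
Implicit Types (u v w f g : P) (B : P -> P -> C).

Definition sesqui B := (forall (a : C) u u' v, B (a *: u + u') v = a * B u v + B u' v)
  /\ (forall u v, B v u = (B u v)^*%C).

Section Sesqui.
Variable B : P -> P -> C.
Hypothesis sB : sesqui B.

Lemma sesquiC u v : B v u = (B u v)^*%C. Proof. exact: sB.2. Qed.

Lemma sesquiDl u u' v : B (u + u') v = B u v + B u' v.
Proof. by rewrite -(scale1r u) sB.1 mul1r scale1r. Qed.

Lemma sesqui0l v : B 0 v = 0.
Proof. by apply: (addrI (B 0 v)); rewrite -sesquiDl !addr0. Qed.

Lemma sesquiZl a u v : B (a *: u) v = a * B u v.
Proof. by rewrite -(addr0 (a *: u)) sB.1 sesqui0l addr0. Qed.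

Lemma sesquiNl u v : B (- u) v = - B u v.
Proof. by rewrite -scaleN1r sesquiZl mulN1r. Qed.

Lemma sesquiBl u u' v : B (u - u') v = B u v - B u' v.
Proof. by rewrite sesquiDl sesquiNl. Qed.

Lemma sesqui_suml (I : Type) (r : seq I) (p : pred I) (F : I -> P) v :
  B (\sum_(i <- r | p i) F i) v = \sum_(i <- r | p i) B (F i) v.
Proof. by apply: (big_morph (B^~ v)) => [f g|]; [exact: sesquiDl|exact: sesqui0l]. Qed.

Lemma sesquiDr u v v' : B u (v + v') = B u v + B u v'.
Proof. by rewrite sesquiC sesquiDl rmorphD /= -!sesquiC. Qed.

Lemma sesqui0r u : B u 0 = 0.
Proof. by rewrite sesquiC sesqui0l conjc0. Qed.

Lemma sesquiZr a u v : B u (a *: v) = a^*%C * B u v.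
Proof. by rewrite sesquiC sesquiZl rmorphM /= -sesquiC. Qed.

Lemma sesquiNr u v : B u (- v) = - B u v.
Proof. by rewrite sesquiC sesquiNl rmorphN /= -sesquiC. Qed.

Lemma sesquiBr u v v' : B u (v - v') = B u v - B u v'.
Proof. by rewrite sesquiDr sesquiNr. Qed.

Lemma sesqui_sumr (I : Type) (r : seq I) (p : pred I) (F : I -> P) u :
  B u (\sum_(i <- r | p i) F i) = \sum_(i <- r | p i) B u (F i).
Proof. by apply: (big_morph (B u)) => [f g|]; [exact: sesquiDr|exact: sesqui0r]. Qed.

End Sesqui.

Definition contr B u v := \sum_i B (mderiv i u) (mderiv i v).

Definition tcontr (s : 'M[R]_N) B u v :=
  \sum_i B (mderiv i u) (dird (delta_mx 0 i *m s) v).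

Definition fisch0 u v : C := mcoeff (@mnm0 N) u * (mcoeff (@mnm0 N) v)^*%C.

(** The Fischer product in degree m: the Hermitian product of the tensors of m-th derivatives at 0.
    It sees only the components of degree m. *)
Definition fisch m : P -> P -> C := iter m contr fisch0.

Lemma fischS m u v : fisch m.+1 u v = \sum_i fisch m (mderiv i u) (mderiv i v).
Proof. by []. Qed.

Lemma contr_sesqui B : sesqui B -> sesqui (contr B).
Proof.
move=> sB; split=> [a u u' v|u v]; rewrite /contr.
  rewrite mulr_sumr -big_split; apply: eq_bigr => i _ /=.
  by rewrite mderivD mderivZ (sB.1).
by rewrite rmorph_sum; apply: eq_bigr => i _; rewrite (sB.2).
Qed.

Lemma fisch_sesqui m : sesqui (fisch m).
Proof.
elim: m => [|m IH]; last exact: contr_sesqui.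
split=> [a u u' v|u v]; rewrite /fisch/= /fisch0.
  by rewrite mcoeffD mcoeffZ mulrDl mulrA.
by rewrite rmorphM/= conjcK mulrC.
Qed.

Lemma fisch_ge0 m u : 0 <= fisch m u u.
Proof.
elim: m u => [|m IH] u; first exact: mulcJ_ge0.
by rewrite fischS; apply: sumr_ge0 => i _; exact: IH.
Qed.

Lemma fisch_eq0 m u : hom m u -> fisch m u u = 0 -> u = 0.
Proof.
elim: m u => [|m IH] u hu.
  have [a ->] := hom0E hu; rewrite /fisch/= /fisch0 mcoeffZ mcoeff1 eqxx mulr1.
  by move/eqP; rewrite mulf_eq0 conjc_eq0 orbb => /eqP ->; rewrite scale0r.
rewrite fischS => h; apply: (hom_mderiv_eq0 _ hu) => // i.
apply: IH; first exact: (hom_mderiv i hu).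
apply/eqP; move/eqP: h; rewrite psumr_eq0 => [/allP/(_ i)|j _]; last exact: fisch_ge0.
by rewrite mem_index_enum => /(_ isT).
Qed.

Lemma fisch_gt0 m u : hom m u -> u != 0 -> 0 < fisch m u u.
Proof.
move=> hu u0; rewrite lt_def fisch_ge0 andbT.
by apply: contra_neq u0; exact: fisch_eq0.
Qed.

Lemma sum_dird_orth B (M : 'M[R]_N) u v : sesqui B -> M *m M^T = 1%:M ->
  \sum_i B (dird (delta_mx 0 i *m M) u) (dird (delta_mx 0 i *m M) v) = contr B u v.
Proof.
move=> sB MT.
have dE i f : dird (delta_mx 0 i *m M) f = \sum_j (M i j)%:C *: mderiv j f.
  by rewrite dirdE; apply: eq_bigr => j _; rewrite -rowE mxE.
have E i : B (dird (delta_mx 0 i *m M) u) (dird (delta_mx 0 i *m M) v)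
   = \sum_j \sum_k (M i j * M i k)%:C * B (mderiv j u) (mderiv k v).
  rewrite !dE (sesqui_suml sB); apply: eq_bigr => j _.
  rewrite (sesqui_sumr sB); apply: eq_bigr => k _.
  by rewrite (sesquiZl sB) (sesquiZr sB) mulrA conj_realC rmorphM.
under eq_bigr do rewrite E.
rewrite exchange_big/=; apply: eq_bigr => j _.
rewrite exchange_big/= (bigD1 j)//= [X in _ + X]big1 ?addr0 => [|k kj].
  rewrite -mulr_suml -rmorph_sum/=.
  have -> : \sum_i M i j * M i j = (M^T *m M) j j.
    by rewrite mxE; apply: eq_bigr => i _; rewrite mxE.
  by rewrite (orth_trmx MT) mxE eqxx mul1r.
rewrite -mulr_suml -rmorph_sum/=.
have -> : \sum_i M i j * M i k = (M^T *m M) j k.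
  by rewrite mxE; apply: eq_bigr => i _; rewrite mxE.
by rewrite (orth_trmx MT) mxE eq_sym (negbTE kj) mul0r.
Qed.

Lemma mderiv_lsub i (M : 'M[R]_N) f :
  mderiv i (lsub M f) = lsub M (dird (delta_mx 0 i *m M) f).
Proof. by rewrite -dird_delta dird_lsub. Qed.

Lemma contr_orth B (M : 'M[R]_N) : sesqui B -> M *m M^T = 1%:M ->
  (forall u v, B (lsub M u) (lsub M v) = B u v) ->
  forall u v, contr B (lsub M u) (lsub M v) = contr B u v.
Proof.
move=> sB MT BM u v; rewrite -(sum_dird_orth u v sB MT) /contr.
by apply: eq_bigr => i _; rewrite !mderiv_lsub BM.
Qed.

Lemma mcoeff0_lsub (M : 'M[R]_N) u : mcoeff (@mnm0 N) (lsub M u) = mcoeff (@mnm0 N) u.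
Proof.
elim/mpoly_alg_ind: u => [a|f g Hf Hg|i f Hf].
- by rewrite lsubZ lsub_one.
- by rewrite lsubD !mcoeffD Hf Hg.
- have m0 j : mcoeff (@mnm0 N) (xvar R j) = 0.
    by rewrite xvarE mcoeffX mnm1_eq0.
  rewrite lsubM !rmorphM/= m0 mul0r lsubX raddf_sum big1 ?mul0r// => j _.
  by rewrite /= mcoeffZ m0 mulr0.
Qed.

Lemma fisch_orth m (M : 'M[R]_N) u v : M *m M^T = 1%:M ->
  fisch m (lsub M u) (lsub M v) = fisch m u v.
Proof.
move=> MT; elim: m u v => [|m IH] u v; first by rewrite /fisch/= /fisch0 !mcoeff0_lsub.
by apply: contr_orth => //; exact: fisch_sesqui.
Qed.

Lemma fisch_refl m (a : V) u v : a != 0 -> fisch m (refl a u) v = fisch m u (refl a v).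
Proof.
move=> a0; rewrite -{1}[v](reflK a0); apply: fisch_orth.
by rewrite trmx_reflection reflection_invol.
Qed.

(* Splitting a polynomial of degree k + l into tensors of orders k and l: the *)
(* twisted and the plain contractions commute.                                *)
Lemma tcontr_contr s B : tcontr s (contr B) = contr (tcontr s B).
Proof.
apply/funext => u; apply/funext => v; rewrite /tcontr /contr exchange_big.
apply: eq_bigr => i _; apply: eq_bigr => j _.
by rewrite mderiv_comm -!dird_delta [dird (delta_mx 0 i) (dird (_ *m s) _)]dird_comm.
Qed.

Lemma iter_tcontr_contr k l s B :
  iter l (tcontr s) (iter k contr B) = iter k contr (iter l (tcontr s) B).
Proof.
have H k' B' : tcontr s (iter k' contr B') = iter k' contr (tcontr s B').
  by elim: k' => //= k' IH; rewrite tcontr_contr IH.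
by elim: l => //= l ->; rewrite H.
Qed.

Section Split.
Variable a : V.
Hypothesis a0 : a != 0.
Local Notation s := (reflection a).

(* F_k(., s .) on the l-th derivatives *)
Definition part k l := iter l contr (fun u v => fisch k u (refl a v)).

Lemma partS k l u v : part k l.+1 u v = \sum_i part k l (mderiv i u) (mderiv i v).
Proof. by []. Qed.

Lemma part_refl k l u v : part k l u (refl a v) = iter l (tcontr s) (fisch k) u v.
Proof.
elim: l u v => [|l IH] u v; first by rewrite /part/= reflK.
rewrite partS /= {1}/tcontr; apply: eq_bigr => i _.
by rewrite /refl mderiv_lsub -/(refl a _) IH.
Qed.

(** Reflecting all slots of v cancels the reflection in the k twisted slots and puts one in the l
    plain slots; the order of the slots is immaterial since derivatives commute. *)
Lemma part_swap k l u v : part k l u (refl a v) = part l k u v.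
Proof.
have H f g : iter l (tcontr s) fisch0 f g = fisch l f (refl a g).
  elim: l f g => [|l IH] f g; first by rewrite /fisch/= /fisch0 /refl mcoeff0_lsub.
  rewrite iterS fischS {1}/tcontr; apply: eq_bigr => i _.
  by rewrite IH /refl mderiv_lsub.
rewrite part_refl {1}/fisch iter_tcontr_contr /part; congr (iter k contr _ u v).
by apply/funext => f; apply/funext => g; rewrite H.
Qed.

Lemma part_sesqui k l : sesqui (part k l).
Proof.
elim: l => [|l IH]; last exact: contr_sesqui.
have sF := fisch_sesqui k; split=> [b u u' v|u v]; rewrite /part/=.
  by rewrite (sF.1).
by rewrite -(fisch_refl _ _ _ a0) (sF.2).
Qed.

Lemma part_invar k l u v : part k l (refl a u) (refl a v) = part k l u v.
Proof.
have sT : s *m s^T = 1%:M by rewrite trmx_reflection reflection_invol.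
elim: l u v => [|l IH] u v; first by rewrite /part/= fisch_orth.
by apply: contr_orth => //; exact: part_sesqui.
Qed.

Lemma fisch_CS k u : fisch k u (refl a u) <= fisch k u u.
Proof.
have sF := fisch_sesqui k; have := fisch_ge0 k (u - refl a u).
rewrite (sesquiBl sF) !(sesquiBr sF).
have -> : fisch k (refl a u) (refl a u) = fisch k u u.
  by rewrite (fisch_refl _ _ _ a0) reflK.
rewrite (fisch_refl _ u u a0) opprB addrACA -opprD -mulr2n -[X in _ - X]mulr2n.
by rewrite -mulrnBl pmulrn_lge0// subr_ge0.
Qed.

Lemma part_le k l u : part k l u u <= fisch (l + k) u u.
Proof.
elim: l u => [|l IH] u; first exact: fisch_CS.
by rewrite addSn partS fischS; apply: ler_sum => i _; exact: IH.
Qed.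

(** With s acting on k slots and s' on the other l, 1 - s s' = (1 - s) + (1 - s') - (1 - s)(1 - s'),
    and the last product is nonnegative, its factors being commuting nonnegative operators. The
    proof reads this off from [part_le] at u + s s' u. *)
Lemma split_refl k l u :
  fisch (l + k) u (u - refl a u) <=
  (fisch (l + k) u u - part k l u u) + (fisch (l + k) u u - part l k u u).
Proof.
have sF := fisch_sesqui (l + k); have sP := part_sesqui k l.
rewrite -(part_swap k l) (sesquiBr sF).
have := part_le k l (u + refl a u).
rewrite (sesquiDl sF) !(sesquiDr sF) (sesquiDl sP) !(sesquiDr sP).
have -> : fisch (l + k) (refl a u) (refl a u) = fisch (l + k) u u.
  by rewrite (fisch_refl _ _ _ a0) reflK.
rewrite (fisch_refl _ u u a0) part_invar.
have -> : part k l (refl a u) u = part k l u (refl a u).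
  by rewrite -[in LHS](part_invar) reflK.
set x := fisch _ _ _; set y := fisch _ _ _; set z := part _ _ _ _; set t := part _ _ _ _.
rewrite [t + z]addrC [y + x]addrC -!mulr2n ler_pMn2r// => h.
rewrite -subr_ge0 (_ : _ - _ = (x + y) - (z + t)) ?subr_ge0//; ring.
Qed.

End Split.

End Fischer.

(** * Spectral theory of [KK] and bounds by degree *)

Section Spectral.
Variables (R : realType) (N : nat).
Local Notation C := R[i].
Local Notation P := (cpoly R N).
Local Notation V := 'rV[R]_N.
Implicit Types (u v w f g : P).
Variables (Phi : seq V) (Delta : N.-tuple V).
Hypothesis Phi_root : root_system Phi.
Local Notation Pos := (positive_roots Phi Delta).
Local Notation KK := (@KK R N Phi Delta).

Lemma fisch_KK m u v : fisch m (KK u) v = fisch m u (KK v).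
Proof.
have sF := fisch_sesqui R N m.
rewrite !KKE (sesqui_suml sF) (sesqui_sumr sF) big_seq [RHS]big_seq.
apply: eq_bigr => a aP.
by rewrite (sesquiBl sF) (sesquiBr sF) (fisch_refl _ _ _ (pos_nonzero Phi_root aP)).
Qed.

Lemma eigen_real m u (k : C) : hom m u -> u != 0 -> KK u = k *: u ->
  k = (complex.Re k)%:C.
Proof.
move=> hu u0 Ku; have := fisch_KK m u u; have sF := fisch_sesqui R N m.
rewrite Ku (sesquiZl sF) (sesquiZr sF) => /mulIf h.
have : k = k^*%C by apply: h; rewrite gt_eqF// fisch_gt0.
case: k {h Ku} => x y [] /eqP; rewrite -subr_eq0 opprK -mulr2n mulrn_eq0/= => /eqP ->.
by [].
Qed.

Definition act (q : {poly C}) u : P := \sum_(i < size q) q`_i *: iter i KK u.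

Lemma actE n (q : {poly C}) u : (size q <= n)%N -> act q u = \sum_(i < n) q`_i *: iter i KK u.
Proof.
move=> h; rewrite /act (big_ord_widen n (fun i => q`_i *: iter i KK u))// big_mkcond.
apply: eq_bigr => i _; case: ltnP => // hi.
by rewrite nth_default// scale0r.
Qed.

Lemma iter_KK_linear i a u v : iter i KK (a *: u + v) = a *: iter i KK u + iter i KK v.
Proof. by elim: i => //= i ->; rewrite KKD KKZ. Qed.

Lemma actXsubC (q : {poly C}) z u : act (q * ('X - z%:P)) u = act q (KK u - z *: u).
Proof.
rewrite (@actE (size q).+1); last first.
  by rewrite (leq_trans (size_polyMleq _ _))// size_XsubC addn2.
under eq_bigr do rewrite mulrBr coefB coefMX coefMC scalerBl.
rewrite sumrB big_ord_recl eqxx scale0r add0r big_ord_recr/= nth_default// mul0r scale0r addr0.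
rewrite -sumrB /act; apply: eq_bigr => i _.
have -> : KK u - z *: u = (- z) *: u + KK u by rewrite scaleNr addrC.
by rewrite iter_KK_linear scalerDr scalerA mulrN scaleNr -iterSr addrC.
Qed.

(** Forms of degree m have finitely many coefficients, so enough iterates of [KK] on u are linearly
    dependent; the dependence is a polynomial in [KK], which splits over the complex numbers. *)
Lemma annihilator m u : hom m u -> exists s : seq C, act (\prod_(z <- s) ('X - z%:P)) u = 0.
Proof.
move=> hu; pose I : finType := bmultinom N m.+1.
pose D := #|I|; pose mon (j : 'I_D) : multinom N := bmnm (enum_val j).
pose A : 'M[C]_(D.+1, D) := \matrix_(i, j) mcoeff (mon j) (iter i KK u).
have [r r0 rA] : exists2 r : 'rV[C]_D.+1, r != 0 & r *m A = 0.
  exists (nz_row (kermx A)).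
    rewrite nz_row_eq0 kermx_eq0 /row_free neq_ltn.
    by rewrite (leq_ltn_trans (rank_leq_col A)).
  by apply/sub_kermxP; exact: nz_row_sub.
pose q : {poly C} := \poly_(i < D.+1) r 0 (inord i).
have qu : act q u = 0.
  rewrite (@actE D.+1) ?size_poly//.
  have hK i : hom m (iter i KK u) by elim: i => //= i; exact: hom_KK.
  have hs : hom m (\sum_(i < D.+1) q`_i *: iter i KK u).
    by apply: hom_sum => i _; apply: homZ.
  apply/mpolyP => mu; rewrite mcoeff0.
  have [dm|dm] := eqVneq (mdeg mu) m; last first.
    apply/eqP/contraT => h; case/eqP: dm; apply: (homP hs).
    by rewrite mcoeff_msupp.
  have mu_lt : (mdeg mu < m.+1)%N by rewrite dm.
  pose j : 'I_D := enum_rank (BMultinom mu_lt).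
  have mj : mon j = mu by rewrite /mon enum_rankK.
  have := congr1 (fun M : 'rV_D => M 0 j) rA; rewrite !mxE => hj; rewrite -[RHS]hj.
  rewrite raddf_sum/=; apply: eq_bigr => i _.
  by rewrite mcoeffZ !mxE mj /q coef_poly ltn_ord inord_val.
have q0 : q != 0.
  apply: contra_neq r0 => q0; apply/rowP => i; rewrite mxE.
  by have := congr1 (fun p : {poly C} => p`_i) q0; rewrite /= /q coef_poly ltn_ord inord_val coef0.
have [s qE] := closed_field_poly_normal q; exists s.
set pr := \prod_(z <- s) _ in qE *.
have l0 : lead_coef q != 0 by rewrite lead_coef_eq0.
have sz : size pr = size q by rewrite [in RHS]qE size_scale.
have := qu; rewrite (@actE (size q))// (@actE (size q) pr) ?sz//.
have -> : \sum_(i < size q) q`_i *: iter i KK u =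
    \sum_(i < size q) (lead_coef q *: pr)`_i *: iter i KK u by rewrite -qE.
under eq_bigr do rewrite coefZ -scalerA.
rewrite -scaler_sumr => /eqP; rewrite scaler_eq0 lead_coef_eq0 (negbTE q0)/=.
by move/eqP.
Qed.

Record kk_stable (T : set P) : Prop := KKStable {
  kk_stable0 : T 0;
  kk_stableD : forall f g, T f -> T g -> T (f + g);
  kk_stableZ : forall a f, T f -> T (a *: f);
  kk_stableK : forall f, T f -> T (KK f) }.

(** Induction on the roots of an annihilating polynomial, carried out inside T so that eigenvectors
    stay in a submodule. Self-adjointness of [KK] for the Fischer product excludes Jordan blocks. *)
Lemma spectral (T : set P) m u : kk_stable T -> hom m u -> T u ->
  exists s : seq (R * P), [/\ u = \sum_(p <- s) p.2, uniq [seq p.1 | p <- s] &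
    forall p, p \in s -> [/\ hom m p.2, T p.2 & KK p.2 = p.1%:C *: p.2]].
Proof.
move=> sT hu; have [z] := annihilator hu.
elim: z u hu => [|a z IH] u hu.
  rewrite big_nil (@actE 1) ?size_poly1// big_ord_recl big_ord0 coef1 scale1r addr0 /=.
  by move=> -> _; exists [::]; rewrite big_nil.
rewrite big_cons mulrC actXsubC => au Tu.
pose v := KK u - a *: u.
have hv : hom m v by apply: homB; [exact: hom_KK|exact: homZ].
have Tv : T v.
  rewrite /v -scaleNr; apply: (kk_stableD sT); first exact: (kk_stableK sT).
  exact: (kk_stableZ sT).
have [s [vE us sP]] := IH v hv au Tv.
(* The components of v with eigenvalue other than a are divided by that eigenvalue minus a. Their
   sum accounts for u up to a vector u' with ([KK] - a) u' = w. *)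
pose s' := [seq (p.1, (p.1%:C - a)^-1 *: p.2) | p <- s & p.1%:C != a].
pose u' := u - \sum_(p <- s') p.2.
have s'P p : p \in s' -> [/\ hom m p.2, T p.2 & KK p.2 = p.1%:C *: p.2].
  move=> /mapP[b]; rewrite mem_filter => /andP[_ /sP[hb Tb Kb] ->] /=; split.
  - exact: homZ.
  - exact: (kk_stableZ sT).
  - by rewrite KKZ Kb !scalerA mulrC.
have hu' : hom m u'.
  apply: homB => //; rewrite big_seq; apply: hom_sum => p /s'P[] //.
have Tu' : T u'.
  rewrite /u' -scaleN1r; apply: (kk_stableD sT) => //; apply: (kk_stableZ sT).
  rewrite big_seq; apply: (big_ind T); [exact: kk_stable0|exact: kk_stableD|].
  by move=> p /s'P[].
have us' : uniq [seq p.1 | p <- s'].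
  rewrite /s' -map_comp/=; apply: subseq_uniq us.
  by rewrite map_subseq ?filter_subseq.
pose w := \sum_(p <- s | p.1%:C == a) p.2.
have Kw : KK w = a *: w.
  rewrite KK_sum scaler_sumr big_seq_cond [RHS]big_seq_cond.
  by apply: eq_bigr => p /andP[/sP[_ _ ->] /eqP ->].
have Ku' : KK u' - a *: u' = w.
  have -> : KK u' - a *: u' = v - (\sum_(p <- s') (KK p.2 - a *: p.2)).
    by rewrite sumrB -KK_sum -scaler_sumr /u' /v KKB scalerBr !opprB addrACA [RHS]addrACA; congr (_ + _); rewrite addrC.
  have -> : \sum_(p <- s') (KK p.2 - a *: p.2) = \sum_(p <- s | p.1%:C != a) p.2.
    rewrite /s' big_map big_filter big_seq_cond [RHS]big_seq_cond.
    apply: eq_bigr => p /andP[/sP[_ _ Kp] pa] /=.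
    by rewrite KKZ Kp !scalerA -scalerBl [_^-1 * _]mulrC -mulrBl mulfV ?scale1r// subr_eq0.
  by rewrite vE (bigID (fun p => p.1%:C == a))/= addrK.
have hw : hom m w.
  by rewrite /w big_seq_cond; apply: hom_sum => p /andP[/sP[]].
(* w lies in the image and in the kernel of [KK] - a, which is self-adjoint once a is known to be
   real. *)
have w0 : w = 0.
  apply/eqP/contraT => w0.
  have aR := eigen_real hw w0 Kw.
  have sF := fisch_sesqui R N m.
  case/eqP: w0; apply: (fisch_eq0 hw).
  rewrite -{1}Ku' (sesquiBl sF) fisch_KK Kw (sesquiZl sF) (sesquiZr sF).
  by rewrite [in X in X - _]aR conj_realC -aR subrr.
have {}Ku' : KK u' = a *: u' by apply/eqP; rewrite -subr_eq0 Ku' w0.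
have uE : u = u' + \sum_(p <- s') p.2 by rewrite subrK.
have [u'0|u'0] := eqVneq u' 0.
  by exists s'; split => //; rewrite {1}uE u'0 add0r.
have aR := eigen_real hu' u'0 Ku'.
exists ((complex.Re a, u') :: s'); split.
- by rewrite big_cons.
- rewrite /= us' andbT; apply/negP => /mapP[p /mapP[b]].
  rewrite mem_filter => /andP[ba _ ->] /= ab.
  by move: ba; rewrite -ab -aR eqxx.
- by move=> p; rewrite inE => /predU1P[->|/s'P//]; split => //=; rewrite -aR.
Qed.

(** A bound on the quadratic form rather than on eigenvalues: quadratic forms are what adds up when
    a degree is split in [bd_add]. *)
Definition bd m (mu : R) := forall u, hom m u -> fisch m (KK u) u <= mu%:C * fisch m u u.

Lemma eigen_bd m mu : (forall (k : R) u, hom m u -> u != 0 -> KK u = k%:C *: u -> k <= mu) ->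
  bd m mu.
Proof.
move=> H u hu; have sF := fisch_sesqui R N m.
have sT : kk_stable [set: P] by split.
have [s [uE us sP]] := spectral sT hu I.
have uniqs : uniq s by apply: (map_uniq us).
have orth p q : p \in s -> q \in s -> p != q -> fisch m p.2 q.2 = 0.
  move=> ps qs pq; have [_ _ Kp] := sP p ps; have [_ _ Kq] := sP q qs.
  have := fisch_KK m p.2 q.2; rewrite Kp Kq (sesquiZl sF) (sesquiZr sF) conj_realC.
  move=> /eqP; rewrite -subr_eq0 -mulrBl -rmorphB mulf_eq0 => /orP[|/eqP//].
  move=> /eqP/(congr1 (@complex.Re R))/= /eqP; rewrite subr_eq0 => /eqP pq1.
  case/eqP: pq; apply/eqP; move: us => /(nth_uniq 0) us.
  have := us (index p s) (index q s); rewrite !size_map !index_mem => /(_ ps qs).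
  rewrite !(nth_map p) ?index_mem// !nth_index// pq1 eqxx => /esym/eqP.
  by move=> /(congr1 (nth p s)); rewrite !nth_index// => ->.
have diag (F : R * P -> C) : \sum_(p <- s) F p * fisch m p.2 u = \sum_(p <- s) F p * fisch m p.2 p.2.
  rewrite big_seq [RHS]big_seq; apply: eq_bigr => p ps; congr (_ * _).
  rewrite {1}uE (sesqui_sumr sF) (bigD1_seq p)//= big_seq_cond big1 ?addr0//.
  by move=> q /andP[qs qp]; rewrite orth// eq_sym.
have -> : fisch m (KK u) u = \sum_(p <- s) p.1%:C * fisch m p.2 p.2.
  rewrite -diag {1}uE KK_sum (sesqui_suml sF) big_seq [RHS]big_seq.
  by apply: eq_bigr => p /sP[_ _ ->]; rewrite (sesquiZl sF).
have -> : fisch m u u = \sum_(p <- s) 1 * fisch m p.2 p.2.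
  by rewrite -diag {1}uE (sesqui_suml sF); apply: eq_bigr => p _; rewrite mul1r.
rewrite mulr_sumr big_seq [leRHS]big_seq; apply: ler_sum => p /sP[hp _ Kp].
rewrite mul1r; have [->|p0] := eqVneq p.2 0; first by rewrite (sesqui0l sF) !mulr0.
by rewrite ler_wpM2r ?fisch_ge0// lecR; exact: H hp p0 Kp.
Qed.

Lemma bd_eigen m mu (k : R) u : bd m mu -> hom m u -> u != 0 -> KK u = k%:C *: u -> k <= mu.
Proof.
move=> H hu u0 Ku; have := H u hu; rewrite Ku (sesquiZl (fisch_sesqui R N m)).
by rewrite ler_pM2r ?fisch_gt0// lecR.
Qed.

Lemma bd_le m mu nu : mu <= nu -> bd m mu -> bd m nu.
Proof.
move=> mn H u hu; apply: le_trans (H u hu) _.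
by rewrite ler_wpM2r ?fisch_ge0// lecR.
Qed.

(** Summed over the positive roots, [split_refl] bounds the form of [KK] in degree k + l by that of
    its action on k slots plus that of its action on l slots. *)
Lemma bd_add k l mu nu : bd k mu -> bd l nu -> bd (k + l) (mu + nu).
Proof.
move=> Hk Hl.
(* After n derivatives only m slots remain, and the bound in degree m applies to every n-th
   derivative of u. *)
have key m n rho : bd m rho -> forall u, hom (n + m) u ->
    \sum_(a <- Pos) (fisch (n + m) u u - part a m n u u) <= rho%:C * fisch (n + m) u u.
  move=> Hm; elim: n => [|n IH] u hu.
    apply: le_trans (Hm u hu); rewrite add0n fisch_KK KKE (sesqui_sumr (fisch_sesqui R N m)).
    by apply: ler_sum => a _; rewrite (sesquiBr (fisch_sesqui R N m)).
  rewrite addSn fischS mulr_sumr.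
  under eq_bigr do rewrite partS -sumrB.
  rewrite exchange_big/=; apply: ler_sum => i _; apply: IH.
  exact: (hom_mderiv i hu).
move=> u hu; rewrite fisch_KK KKE (sesqui_sumr (fisch_sesqui R N _)).
have h1 := key k l mu Hk u; rewrite [(l + k)%N]addnC in h1.
have h2 := key l k nu Hl u hu.
rewrite rmorphD mulrDl; apply: le_trans (lerD (h1 hu) h2).
rewrite -big_split/= big_seq [leRHS]big_seq; apply: ler_sum => a aP.
have := split_refl (pos_nonzero Phi_root aP) k l u.
by rewrite [(l + k)%N]addnC.
Qed.

(** Every degree from 6 on is 3 plus a smaller degree that is at least 3. *)
Lemma bd3n mu : bd 3 (mu * 3) -> bd 4 (mu * 4) -> bd 5 (mu * 5) ->
  forall m, (3 <= m)%N -> bd m (mu * m%:R).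
Proof.
move=> b3 b4 b5 m; elim/ltn_ind: m => m IH m3.
case: m m3 IH => [|[|[|[//|[//|[//|m]]]]]] // _ IH.
rewrite -[m.+4.+2]/(3 + m.+3)%N natrD mulrDr; apply: bd_add => //.
by apply: IH => //; rewrite !ltnS -[m.+2]addn2 leq_addr.
Qed.

End Spectral.

(** * Unitarity *)

Section Forms.
Variables (R : realType) (N : nat).
Local Notation C := R[i].
Local Notation P := (cpoly R N).
Variable T : set P.
Hypothesis T0 : T 0.
Hypothesis TD : forall f g, T f -> T g -> T (f + g).
Hypothesis TZ : forall a f, T f -> T (a *: f).
Implicit Types (B : P -> P -> C) (u v : P).

(** The forms built below go through chosen preimages, which make sense only on a graded piece of S;
    hence the restriction to T. *)
Definition sesqui_on B :=
  (forall (a : C) u u' v, T u -> T u' -> T v -> B (a *: u + u') v = a * B u v + B u' v)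
  /\ (forall u v, T u -> T v -> B v u = (B u v)^*%C).

Variable B : P -> P -> C.
Hypothesis sB : sesqui_on B.

Lemma onDl u u' v : T u -> T u' -> T v -> B (u + u') v = B u v + B u' v.
Proof. by move=> Tu Tu' Tv; rewrite -(scale1r u) sB.1// mul1r scale1r. Qed.

Lemma on0l v : T v -> B 0 v = 0.
Proof. by move=> Tv; apply: (addrI (B 0 v)); rewrite -onDl// !addr0. Qed.

Lemma onZl a u v : T u -> T v -> B (a *: u) v = a * B u v.
Proof. by move=> Tu Tv; rewrite -(addr0 (a *: u)) sB.1// on0l// addr0. Qed.

Lemma on_suml (I : eqType) (r : seq I) (F : I -> P) v :
  (forall i, i \in r -> T (F i)) -> T v ->
  T (\sum_(i <- r) F i) /\ B (\sum_(i <- r) F i) v = \sum_(i <- r) B (F i) v.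
Proof.
move=> TF Tv; elim: r TF => [|i r IH] TF; first by rewrite !big_nil on0l.
have [|Tr Br] := IH; first by move=> j jr; apply: TF; rewrite inE jr orbT.
have Ti : T (F i) by apply: TF; rewrite inE eqxx.
by rewrite !big_cons onDl// Br; split => //; exact: TD.
Qed.

Lemma onDr u v v' : T u -> T v -> T v' -> B u (v + v') = B u v + B u v'.
Proof.
by move=> Tu Tv Tv'; rewrite sB.2 ?onDl ?rmorphD/= -?sB.2//; exact: TD.
Qed.

Lemma on0r u : T u -> B u 0 = 0.
Proof. by move=> Tu; rewrite sB.2// on0l// conjc0. Qed.

Lemma onZr a u v : T u -> T v -> B u (a *: v) = a^*%C * B u v.
Proof.
by move=> Tu Tv; rewrite sB.2 ?onZl ?rmorphM/= -?sB.2//; exact: TZ.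
Qed.

Lemma on_sumr (I : eqType) (r : seq I) (F : I -> P) u :
  (forall i, i \in r -> T (F i)) -> T u ->
  B u (\sum_(i <- r) F i) = \sum_(i <- r) B u (F i).
Proof.
move=> TF Tu; have [Ts Bs] := on_suml TF Tu.
rewrite sB.2// Bs rmorph_sum big_seq [RHS]big_seq; apply: eq_bigr => i ir /=.
by rewrite -sB.2//; exact: TF.
Qed.

Lemma onBl u u' v : T u -> T u' -> T v -> B (u - u') v = B u v - B u' v.
Proof.
by move=> Tu Tu' Tv; rewrite onDl ?onZl ?mulN1r// -scaleN1r ?onZl ?mulN1r//; exact: TZ.
Qed.

Lemma onBr u v v' : T u -> T v -> T v' -> B u (v - v') = B u v - B u v'.
Proof.
move=> Tu Tv Tv'; rewrite -scaleN1r onDr ?onZr//; last exact: TZ.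
by rewrite rmorphN rmorph1 mulN1r.
Qed.

End Forms.

(** * Submodules generated by singular vectors *)

Section Generated.
Variables (R : realType) (N : nat).
Local Notation C := R[i].
Local Notation P := (cpoly R N).
Local Notation V := 'rV[R]_N.
Implicit Types (f g u v : P) (xi : V).
Variables (Phi : seq V) (Delta : N.-tuple V) (c : R).
Hypothesis Phi_root : root_system Phi.
Hypothesis Delta_simple : simple_system Phi Delta.
Local Notation Pos := (positive_roots Phi Delta).
Local Notation x_ := (@xvar R N).
Local Notation dk := (@dk R N Phi Delta c).
Local Notation KK := (@KK R N Phi Delta).
Local Notation y_ i := (dk (delta_mx 0 i)).

Lemma submodule_gen (G : set P) :
  G 0 -> (forall f g, G f -> G g -> G (f + g)) -> (forall a f, G f -> G (a *: f)) ->
  (forall i f, G f -> G (x_ i * f)) ->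
  (forall alpha f, alpha \in Phi -> G f -> G (refl alpha f)) ->
  (forall i f, G f -> G (y_ i f)) -> submodule Phi Delta c G.
Proof.
move=> G0 GD GZ GX Gr Gy; split => // h f hh.
elim: hh f => {h}[w wW|i|i|a h _ IH|h k _ IHh _ IHk|h k _ IHh _ IHk] f Gf.
- rewrite (coxeter_geom_act Phi_root f wW).
  elim: wW f Gf => [|{}w b wW IH bP] f Gf; first by rewrite trmx1 lsub1.
  by rewrite trmx_mul trmx_reflection -lsub_mul; apply: Gr => //; exact: IH.
- exact: GX.
- by have := Gy i f Gf; rewrite dk.unlock.
- by apply: GZ; exact: IH.
- by apply: GD; [exact: IHh|exact: IHk].
- by apply: IHh; exact: IHk.
Qed.

Lemma comp_hom_x d i f : comp_hom d.+1 (x_ i * f) = x_ i * comp_hom d f.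
Proof.
rewrite [in LHS](comp_hom_sum f) mulr_sumr comp_homsum.
rewrite [in RHS](comp_hom_sum f) comp_homsum mulr_sumr; apply: eq_bigr => e _.
have h := comp_homP e f; have hx := homX i h.
have [<-|ne] := eqVneq (e : nat) d; first by rewrite (comp_hom_id h) (comp_hom_id hx).
by rewrite (comp_hom_neq h ne) (comp_hom_neq hx) ?mulr0.
Qed.

Lemma comp_hom_x0 i f : comp_hom 0 (x_ i * f) = 0.
Proof.
rewrite (comp_hom_sum f) mulr_sumr comp_homsum big1// => e _.
by apply: (comp_hom_neq (homX i (comp_homP e f))).
Qed.

Lemma comp_hom_dk d xi f : comp_hom d (dk xi f) = dk xi (comp_hom d.+1 f).
Proof.
rewrite [in LHS](comp_hom_sum f) (dk_sum _ _ Phi_root) comp_homsum.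
rewrite [in RHS](comp_hom_sum f) comp_homsum (dk_sum _ _ Phi_root); apply: eq_bigr => e _.
have h := comp_homP e f; have hd := hom_dk Delta c Phi_root xi h.
have [e1|ne] := eqVneq (e : nat) d.+1.
  by move: h hd; rewrite e1/= => h hd; rewrite (comp_hom_id h) (comp_hom_id hd).
rewrite (comp_hom_neq h ne) (dk0 _ _ Phi_root).
case: (nat_of_ord e) h hd ne => [|e'] h hd ne.
  by rewrite (hom0_dk _ _ Phi_root) ?comp_hom0.
by apply: (comp_hom_neq hd).
Qed.

Inductive generated (T : set P) : P -> Prop :=
| gen_base f : T f -> generated T f
| gen_x i f : generated T f -> generated T (x_ i * f)
| gen_add f g : generated T f -> generated T g -> generated T (f + g)
| gen_scale a f : generated T f -> generated T (a *: f).

Variable S : set P.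
Hypothesis S_min : minimal_submodule Phi Delta c S.

Let S_sub : submodule Phi Delta c S. Proof. by case: S_min => [[[]]]. Qed.

Definition singular m : set P :=
  [set u | [/\ S u, hom m u & forall i, y_ i u = 0]].

Lemma singular0 m : singular m 0.
Proof. by split; [exact: (submodule0 S_sub)|exact: hom0|move=> i; exact: dk0]. Qed.

Lemma singularD m f g : singular m f -> singular m g -> singular m (f + g).
Proof.
move=> [Sf hf yf] [Sg hg yg]; split; [exact: (submoduleD S_sub)|exact: homD|].
by move=> i; rewrite (dkD _ _ Phi_root) yf yg addr0.
Qed.

Lemma singularZ m a f : singular m f -> singular m (a *: f).
Proof.
move=> [Sf hf yf]; split; [exact: (subZ S_sub)|exact: homZ|].
by move=> i; rewrite (dkZ _ _ Phi_root) yf scaler0.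
Qed.

Lemma singular_dk m f xi : singular m f -> dk xi f = 0.
Proof. by move=> [_ _ yf]; rewrite dk_y big1// => i _; rewrite yf scaler0. Qed.

(** Polynomial multiples of singular vectors are stable under the y_i, by the commutation relation,
    and under W, which preserves the singular vectors of degree m. They form a nonzero submodule
    inside S, and minimality makes it all of S. *)
Lemma generated_singular m u : singular m u -> u != 0 -> S = generated (singular m).
Proof.
move=> Tu u0; set G := generated (singular m).
have GS f : G f -> S f.
  elim=> {f}[f []//|i f _|f g _ Sf _ Sg|a f _].
  - exact: (sub_x S_sub).
  - exact: (submoduleD S_sub).
  - exact: (subZ S_sub).
have Gsum (F : 'I_N -> P) : (forall i, G (F i)) -> G (\sum_i F i).
  move=> h; apply: (big_ind G) => //; first by constructor; exact: singular0.
  by move=> f g Gf Gg; apply: gen_add.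
have Gr alpha f : alpha \in Phi -> G f -> G (refl alpha f).
  move=> aP; elim=> {f}[f Tf|i f _ IH|f g _ Gf _ Gg|a f _ Gf].
  - constructor; case: (Tf) => Sf hf yf.
    split; [exact: (sub_refl Phi_root S_sub)|exact: hom_lsub|move=> i].
    have a0 := root_nonzero Phi_root aP.
    rewrite -[delta_mx 0 i](mulmx1) -(reflection_invol a0) mulmxA.
    by rewrite -(refl_dk _ Phi_root Delta_simple)// (singular_dk _ Tf) /refl lsub0.
  - rewrite reflM {1}/refl lsubX mulr_suml; apply: Gsum => j.
    by rewrite -scalerAl; apply: gen_scale; apply: gen_x.
  - by rewrite reflD; apply: gen_add.
  - by rewrite reflZ; apply: gen_scale.
have Gy i f : G f -> G (y_ i f).
  elim=> {f}[f Tf|j f Gf IH|f g _ Gf _ Gg|a f _ Gf].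
  - by constructor; rewrite (singular_dk _ Tf); exact: singular0.
  - rewrite -linear_form_delta (dk_lf _ _ Phi_root) linear_form_delta.
    apply: gen_add; first by apply: gen_add; [exact: gen_x|exact: gen_scale].
    rewrite -scaleN1r; apply: gen_scale.
    rewrite big_seq; apply: (big_ind G) => [|g h|b bP].
    + by constructor; exact: singular0.
    + exact: gen_add.
    + by apply: gen_scale; apply: Gr => //; exact: (pos_root bP).
  - by rewrite (dkD _ _ Phi_root); apply: gen_add.
  - by rewrite (dkZ _ _ Phi_root); apply: gen_scale.
case: S_min => [[_ minS] _]; apply/esym; apply: minS => //; split.
  apply: submodule_gen => //.
  - by constructor; exact: singular0.
  - by move=> f g; apply: gen_add.
  - by move=> a f; apply: gen_scale.
  - by move=> i f; apply: gen_x.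
by exists u => //; constructor.
Qed.

Lemma generated_low m k f : (k < m)%N -> generated (singular m) f -> comp_hom k f = 0.
Proof.
move=> km Gf; elim: Gf k km => {f}[f [_ hf _]|i f _ IH|f g _ IHf _ IHg|a f _ IH] k km.
- by apply: (comp_hom_neq hf); rewrite gtn_eqF.
- case: k km => [|k] km; first exact: comp_hom_x0.
  by rewrite comp_hom_x IH ?mulr0// ltnW.
- by rewrite comp_homD IHf// IHg// addr0.
- by rewrite comp_homZ IH// scaler0.
Qed.

Lemma generated_split m f : generated (singular m) f ->
  exists f0 (g : 'I_N -> P), [/\ singular m f0, forall i, S (g i) & f = f0 + \sum_i x_ i * g i].
Proof.
have S0 : S 0 by exact: (submodule0 S_sub).
elim=> {f}[f Tf|i f _ [f0 [g [Tf0 Sg fE]]]|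
  f f' _ [f0 [g [Tf0 Sg fE]]] _ [f0' [g' [Tf0' Sg' fE']]]|a f _ [f0 [g [Tf0 Sg fE]]]].
- by exists f, (fun=> 0); split => //; rewrite big1 ?addr0// => i _; rewrite mulr0.
- exists 0, (fun j => if j == i then f else 0); split; first exact: singular0.
    move=> j; case: ifP => // _; rewrite fE; apply: (submoduleD S_sub).
      by case: Tf0.
    by apply: (sub_sum S_sub) => k _ _; exact: (sub_x S_sub).
  rewrite add0r (bigD1 i)//= eqxx big1 ?addr0// => j ji.
  by rewrite (negbTE ji) mulr0.
- exists (f0 + f0'), (fun j => g j + g' j); split; first exact: singularD.
    by move=> j; exact: (submoduleD S_sub).
  by rewrite fE fE' addrACA -big_split/=; congr (_ + _); apply: eq_bigr => j _; rewrite mulrDr.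
- exists (a *: f0), (fun j => a *: g j); split; first exact: singularZ.
    by move=> j; exact: (subZ S_sub).
  by rewrite fE scalerDr scaler_sumr; congr (_ + _); apply: eq_bigr => j _; rewrite scalerAr.
Qed.

End Generated.

(** * The contravariant form, degree by degree *)

Section Unitarity.
Variables (R : realType) (N : nat).
Local Notation C := R[i].
Local Notation P := (cpoly R N).
Local Notation V := 'rV[R]_N.
Implicit Types (f g u v w : P) (xi : V).
Variables (Phi : seq V) (Delta : N.-tuple V) (c : R).
Hypothesis Phi_root : root_system Phi.
Hypothesis Delta_simple : simple_system Phi Delta.
Local Notation Pos := (positive_roots Phi Delta).
Local Notation x_ := (@xvar R N).
Local Notation dk := (@dk R N Phi Delta c).
Local Notation KK := (@KK R N Phi Delta).
Local Notation y_ i := (dk (delta_mx 0 i)).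
Variable S : set P.
Hypothesis S_min : minimal_submodule Phi Delta c S.
Hypothesis c_gt0 : 0 < c.
Hypothesis S_deg : forall m u, (m < 2)%N -> S u -> hom m u -> u = 0.
Hypothesis K_bound : forall m, (3 <= m)%N -> bd Phi Delta m (c^-1 * m%:R).

Let S_sub : submodule Phi Delta c S. Proof. by case: S_min => [[[]]]. Qed.

Let T k : set P := [set u | S u /\ hom k u].

Let T0 k : T k 0. Proof. by split; [exact: (sub0 S_sub)|exact: hom0]. Qed.
Let TD k f g : T k f -> T k g -> T k (f + g).
Proof. by move=> [? ?] [? ?]; split; [exact: (subD S_sub)|exact: homD]. Qed.
Let TZ k a f : T k f -> T k (a *: f).
Proof. by move=> [? ?]; split; [exact: (subZ S_sub)|exact: homZ]. Qed.
Let TB k f g : T k f -> T k g -> T k (f - g).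
Proof. by move=> Tf Tg; apply: TD => //; rewrite -scaleN1r; exact: TZ. Qed.
Let Tr k alpha f : alpha \in Phi -> T k f -> T k (refl alpha f).
Proof. by move=> aP [? ?]; split; [exact: (sub_refl Phi_root S_sub)|exact: hom_lsub]. Qed.
Let TK k f : T k f -> T k (KK f).
Proof. by move=> [? ?]; split; [exact: (sub_KK Phi_root S_sub)|exact: hom_KK]. Qed.
Let Tx k i f : T k f -> T k.+1 (x_ i * f).
Proof. by move=> [? ?]; split; [exact: (sub_x S_sub)|exact: homX]. Qed.
Let Tdk k xi f : T k.+1 f -> T k (dk xi f).
Proof.
by move=> [? h]; split; [exact: (sub_dk S_sub)|exact: (hom_dk Delta c Phi_root xi h)].
Qed.
Let Tcomp k f : S f -> T k (comp_hom k f).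
Proof. by move=> Sf; split; [exact: (sub_comp_hom Phi_root S_sub)|exact: comp_homP]. Qed.

Lemma lowest_degree : exists m0, [/\ (2 <= m0)%N, (exists2 u, T m0 u & u != 0) &
  forall k u, (k < m0)%N -> T k u -> u = 0].
Proof.
have [[[_ [f Sf f0]] _] _] := S_min.
have ex : exists k, `[< exists2 u, T k u & u != 0 >].
  apply: contrapT => h; case/eqP: f0.
  rewrite (comp_hom_sum f) big1// => i _; apply/eqP/contraT => fi.
  by exfalso; apply: h; exists i; apply/asboolP; exists (comp_hom i f) => //; exact: Tcomp.
case: (ex_minnP ex) => m0 /asboolP h0 hmin; exists m0; split => //.
  rewrite leqNgt; apply/negP => m2; have [u [Su hu]] := h0.
  by rewrite (S_deg m2 Su hu) eqxx.
move=> k u km Tu; apply/eqP/contraT => u0.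
have : `[< exists2 u, T k u & u != 0 >] by apply/asboolP; exists u.
by move=> /hmin; rewrite leqNgt km.
Qed.

Section Lowest.
Variable m0 : nat.
Hypothesis m0_ge2 : (2 <= m0)%N.
Variable u0 : P.
Hypothesis Tu0 : T m0 u0.
Hypothesis u0_neq0 : u0 != 0.
Hypothesis T_low : forall k u, (k < m0)%N -> T k u -> u = 0.

Let dk_low xi u : T m0 u -> dk xi u = 0.
Proof.
move=> Tu; case: m0 m0_ge2 Tu T_low => // m _ Tu low.
by apply: (low m) => //; exact: Tdk.
Qed.

(** A singular vector of degree k would make S generated in degree k, hence zero below k, while S is
    nonzero in degree m0. *)
Lemma no_singular k u : (m0 < k)%N -> T k u -> (forall i, y_ i u = 0) -> u = 0.
Proof.
move=> mk [Su hu] yu; apply/eqP/contraT => un0; exfalso.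
have := generated_singular Phi_root Delta_simple S_min (m := k) (u := u).
move=> /(_ (And3 Su hu yu) un0) SE; case: Tu0 => Su0 hu0.
have Gu0 : generated (singular Phi Delta c S k) u0 by rewrite -SE.
case/eqP: u0_neq0; rewrite -(comp_hom_id hu0).
exact: (generated_low mk Gu0).
Qed.

(** All vectors of lowest degree are singular, so S is obtained from them by multiplication by
    polynomials. *)
Lemma Tx_span k u : (m0 <= k)%N -> T k.+1 u ->
  exists2 g : 'I_N -> P, forall i, T k (g i) & u = \sum_i x_ i * g i.
Proof.
move=> mk [Su hu]; case: (Tu0) => Su0 hu0.
have sing0 : singular Phi Delta c S m0 u0 by split => // i; exact: dk_low.
have SE := generated_singular Phi_root Delta_simple S_min sing0 u0_neq0.
have [|f0 [g [[_ hf0 _] Sg uE]]] := @generated_split _ _ Phi Delta c Phi_root S S_min m0 u.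
  by rewrite -SE.
exists (fun i => comp_hom k (g i)); first by move=> i; exact: Tcomp.
rewrite -(comp_hom_id hu) [in LHS]uE comp_homD (comp_hom_neq hf0) ?add0r ?comp_homsum.
  by apply: eq_bigr => i _; rewrite comp_hom_x.
by rewrite neq_ltn ltnS mk.
Qed.

(** The operator sum x_i y_i in degree k, by [sum_xy_hom]; called E in the comments below. *)
Definition eop k u : P := k%:R *: u - c%:C *: KK u.

Let eopE k u : hom k u -> eop k u = \sum_i x_ i * y_ i u.
Proof. by move=> hu; rewrite (sum_xy_hom Delta c Phi_root hu). Qed.

Let Teop k u : T k u -> T k (eop k u).
Proof. by move=> Tu; apply: TB; apply: TZ => //; exact: TK. Qed.

Lemma eop_linear k a u v : eop k (a *: u + v) = a *: eop k u + eop k v.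
Proof.
rewrite /eop KKD KKZ !scalerDr opprD addrACA scalerN !scalerA.
by rewrite [_ * a]mulrC [c%:C * a]mulrC.
Qed.

(** [good_swap] is the part of contravariance that stays within one degree; the construction of the
    next degree uses it and reproduces it. *)
Record good k (B : P -> P -> C) : Prop := Good {
  good_sesqui : sesqui_on (T k) B;
  good_refl : forall alpha u v, alpha \in Phi -> T k u -> T k v ->
    B (refl alpha u) (refl alpha v) = B u v;
  good_pos : forall u, T k u -> u != 0 -> 0 < B u u;
  good_swap : forall i j u v, T k u -> T k v ->
    B (x_ i * y_ j u) v = B u (x_ j * y_ i v) }.

Section Step.
Variables (k : nat) (B : P -> P -> C).
Hypothesis mk : (m0 <= k)%N.
Hypothesis gB : good k B.

Let sB := good_sesqui gB.

(** For the form sought in degree k + 1, A(u, v) has to be (u, sum x_j y_j v) = (u, E v). *)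
Let A u v := \sum_j B (y_ j u) (y_ j v).

Let B_ge0 u : T k u -> 0 <= B u u.
Proof.
move=> Tu; have [->|un0] := eqVneq u 0; last exact/ltW/(good_pos gB).
by rewrite (on0l (T0 k) sB).
Qed.

Let sA : sesqui_on (T k.+1) A.
Proof.
split=> [a u u' v Tu Tu' Tv|u v Tu Tv]; rewrite /A.
  rewrite mulr_sumr -big_split; apply: eq_bigr => i _ /=.
  by rewrite (dkD _ _ Phi_root) (dkZ _ _ Phi_root) (sB.1)//; exact: Tdk.
by rewrite rmorph_sum; apply: eq_bigr => i _; rewrite sB.2//; exact: Tdk.
Qed.

Let A_pos u : T k.+1 u -> u != 0 -> 0 < A u u.
Proof.
move=> Tu un0; rewrite lt_def sumr_ge0 => [|i _]; last by apply: B_ge0; exact: Tdk.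
rewrite andbT; apply: contra_neq un0 => /eqP; rewrite psumr_eq0 => [/allP h|i _]; last first.
  by apply: B_ge0; exact: Tdk.
apply: (no_singular _ Tu) => // i; apply/eqP/contraT => yi.
have := good_pos gB (Tdk (delta_mx 0 i) Tu) yi.
by have /eqP -> := h i (mem_index_enum i); rewrite ltxx.
Qed.

Let A_orth alpha u v : alpha \in Phi -> T k.+1 u -> T k.+1 v ->
  \sum_i B (dk (delta_mx 0 i *m reflection alpha) u) (dk (delta_mx 0 i *m reflection alpha) v) = A u v.
Proof.
move=> aP Tu Tv; set M := reflection alpha.
have MT : M *m M^T = 1%:M.
  by rewrite trmx_reflection reflection_invol// (root_nonzero Phi_root).
have dE i f : dk (delta_mx 0 i *m M) f = \sum_j (M i j)%:C *: y_ j f.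
  by rewrite dk_y; apply: eq_bigr => j _; rewrite -rowE mxE.
have TM i f : T k.+1 f -> forall j, T k ((M i j)%:C *: y_ j f).
  by move=> Tf j; apply: TZ; exact: Tdk.
have E i : B (dk (delta_mx 0 i *m M) u) (dk (delta_mx 0 i *m M) v)
   = \sum_j \sum_l (M i j * M i l)%:C * B (y_ j u) (y_ l v).
  have Tv' : T k (dk (delta_mx 0 i *m M) v) by exact: Tdk.
  rewrite [X in B X _]dE (on_suml (T0 k) (@TD k) sB (fun j _ => TM i u Tu j) Tv').2.
  apply: eq_bigr => j _; have Tj := TM i u Tu j.
  rewrite dE (on_sumr (T0 k) (@TD k) sB (fun j _ => TM i v Tv j) Tj).
  apply: eq_bigr => l _; have Tl := TM i v Tv l.
  have Tyj := Tdk (delta_mx 0 j) Tu; have Tyl := Tdk (delta_mx 0 l) Tv.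
  rewrite (onZl (T0 k) sB _ Tyj Tl) (onZr (T0 k) (@TZ k) sB _ Tyj Tyl).
  by rewrite mulrA conj_realC rmorphM.
under eq_bigr do rewrite E.
rewrite exchange_big/=; apply: eq_bigr => j _.
have MM l : \sum_i M i j * M i l = (j == l)%:R.
  have -> : (j == l)%:R = (M^T *m M) j l by rewrite (orth_trmx MT) mxE.
  by rewrite [RHS]mxE; apply: eq_bigr => i _; rewrite [M^T _ _]mxE.
rewrite exchange_big/= (bigD1 j)//= [X in _ + X]big1 ?addr0 => [|l lj].
  by rewrite -mulr_suml -rmorph_sum/= MM eqxx rmorph1 mul1r.
by rewrite -mulr_suml -rmorph_sum/= MM eq_sym (negbTE lj) rmorph0 mul0r.
Qed.

Let A_refl alpha u v : alpha \in Phi -> T k.+1 u -> T k.+1 v ->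
  A (refl alpha u) (refl alpha v) = A u v.
Proof.
move=> aP Tu Tv; rewrite -(A_orth aP Tu Tv); apply: eq_bigr => i _.
have a0 := root_nonzero Phi_root aP.
have H w : y_ i (refl alpha w) = refl alpha (dk (delta_mx 0 i *m reflection alpha) w).
  rewrite (refl_dk _ Phi_root Delta_simple)// -mulmxA.
  by rewrite (reflection_invol a0) mulmx1.
by rewrite !H (good_refl gB)//; exact: Tdk.
Qed.

Let A_KK u v : T k.+1 u -> T k.+1 v -> A (KK u) v = A u (KK v).
Proof.
move=> Tu Tv; rewrite !KKE.
have TT f : T k.+1 f -> forall a, a \in Pos -> T k.+1 (f - refl a f).
  by move=> Tf a /pos_root aP; apply: TB => //; exact: Tr.
rewrite (on_suml (T0 _) (@TD _) sA (TT u Tu) Tv).2.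
rewrite (on_sumr (T0 _) (@TD _) sA (TT v Tv) Tu).
rewrite big_seq [RHS]big_seq; apply: eq_bigr => a /pos_root aP.
have Tru := Tr aP Tu; have Trv := Tr aP Tv.
rewrite (onBl (T0 _) (@TZ _) sA)// (onBr (T0 _) (@TD _) (@TZ _) sA)//; congr (_ - _).
by rewrite -{1}[v](reflK (root_nonzero Phi_root aP)) A_refl.
Qed.

Let A_eop u v : T k.+1 u -> T k.+1 v -> A (eop k.+1 u) v = A u (eop k.+1 v).
Proof.
move=> Tu Tv; have TKu := TK Tu; have TKv := TK Tv.
rewrite /eop (onBl (T0 _) (@TZ _) sA) ?(onBr (T0 _) (@TD _) (@TZ _) sA)//; try exact: TZ.
rewrite !(onZl (T0 _) sA)// !(onZr (T0 _) (@TZ _) sA)// A_KK//.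
by rewrite conj_realC rmorph_nat.
Qed.

(* Both sides expand, by the relation between x_i and y_j, into the same terms. *)
Let A_x i u v : T k u -> T k.+1 v -> A (x_ i * u) v = B u (y_ i (eop k.+1 v)).
Proof.
move=> Tu Tv; have [_ hv] := Tv; rewrite (eopE hv) (dk_sum _ _ Phi_root).
have Tyv j : T k (y_ j v) by exact: Tdk.
pose cf (al : V) a b : C := (c * dot al (delta_mx 0 a) * cox al (delta_mx 0 b))%:C.
have cfC al a b : cf al a b = cf al b a.
  by rewrite /cf /cox; congr (_%:C); ring.
have yx a b f : y_ a (x_ b * f) = x_ b * y_ a f + (a == b)%:R *: f
    - \sum_(al <- Pos) cf al a b *: refl al f.
  rewrite -linear_form_delta (dk_lf _ _ Phi_root) linear_form_delta.
  congr (_ + _ *: _ - _); rewrite dot_delta mxE eqxx/= eq_sym.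
  by case: (a == b); rewrite ?rmorph1 ?rmorph0.
have Txy a b f : T k f -> T k (x_ a * y_ b f).
  move=> Tf; case: k mk Tf => [|k'] mk' Tf.
    by move: (leq_trans m0_ge2 mk').
  by apply: Tx; exact: Tdk.
have Tref f : T k f -> forall a b al, al \in Pos -> T k (cf al a b *: refl al f).
  by move=> Tf a b al /pos_root alP; apply: TZ; exact: Tr.
have TS f a b : T k f -> T k (\sum_(al <- Pos) cf al a b *: refl al f).
  by move=> Tf; have [] := on_suml (T0 k) (@TD k) sB (Tref f Tf a b) (T0 k).
have Tyx a b f : T k f -> T k (y_ a (x_ b * f)).
  by move=> Tf; apply: Tdk; exact: Tx.
rewrite (on_sumr (T0 k) (@TD k) sB (fun j _ => Tyx i j _ (Tyv j)) Tu).
rewrite /A; apply: eq_bigr => j _; rewrite !yx.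
have T1 := Txy i j u Tu; have T2 := Txy j i _ (Tyv j).
have T3 : T k ((j == i)%:R *: u) by exact: TZ.
have T4 : T k ((i == j)%:R *: y_ j v) by exact: TZ.
have T5 := TS u j i Tu; have T6 := TS _ i j (Tyv j).
have Tv0 := Tyv j.
rewrite (onBl (T0 k) (@TZ k) sB) ?(onBr (T0 k) (@TD k) (@TZ k) sB) ?(onDl sB) ?(onDr (@TD k) sB)//;
  try exact: TD.
congr (_ + _ - _).
- exact: (good_swap gB).
- by rewrite (onZl (T0 k) sB)// (onZr (T0 k) (@TZ k) sB)// rmorph_nat eq_sym.
- rewrite (on_suml (T0 k) (@TD k) sB (Tref u Tu j i) Tv0).2.
  rewrite (on_sumr (T0 k) (@TD k) sB (Tref _ Tv0 i j) Tu).
  rewrite big_seq [RHS]big_seq; apply: eq_bigr => al alPos; have alP := pos_root alPos.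
  have r1 := Tr alP Tu; have r2 := Tr alP Tv0.
  rewrite (onZl (T0 k) sB)// (onZr (T0 k) (@TZ k) sB)// conj_realC cfC; congr (_ * _).
  by rewrite -{1}[y_ j v](reflK (root_nonzero Phi_root alP)) (good_refl gB).
Qed.

(** Write w as sum x_i g_i. By [A_x], A(w, w) is the sum of the B(g_i, y_i E w), which is 0 if E w =
    0, whereas A is positive because S has no singular vector in this degree. *)
Let eop_inj w : T k.+1 w -> eop k.+1 w = 0 -> w = 0.
Proof.
move=> Tw Ew; apply/eqP/contraT => w0; have := A_pos Tw w0.
have [g Tg wE] := Tx_span mk Tw.
rewrite {1}wE (on_suml (T0 _) (@TD _) sA (fun i _ => Tx i (Tg i)) Tw).2.
rewrite big1 ?ltxx// => i _.
by rewrite A_x// Ew (dk0 _ _ Phi_root) (on0r (T0 k) sB).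
Qed.

(** The bound on [KK] gives the weak inequality and injectivity of [eop] makes it strict. The bound
    is available since k + 1 is at least 3. *)
Let eop_eigen (p : R) w : T k.+1 w -> w != 0 -> KK w = p%:C *: w ->
  0 < k.+1%:R - c * p.
Proof.
move=> Tw w0 Kw; have [_ hw] := Tw.
have k3 : (3 <= k.+1)%N by rewrite ltnS (leq_trans m0_ge2).
have := bd_eigen (K_bound k3) hw w0 Kw.
rewrite -(ler_pM2l c_gt0) mulrA mulfV ?gt_eqF// mul1r => h.
rewrite lt_def subr_ge0 h andbT; apply: contra_neq w0 => h0.
apply: eop_inj => //; rewrite /eop Kw scalerA -scalerBl -rmorphM.
have -> : k.+1%:R = (k.+1%:R : R)%:C by rewrite rmorph_nat.
by rewrite -rmorphB h0 rmorph0 scale0r.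
Qed.

Let eop_eq (p : R) w : KK w = p%:C *: w -> eop k.+1 w = (k.+1%:R - c * p)%:C *: w.
Proof.
move=> Kw; rewrite /eop Kw scalerA -scalerBl -rmorphM rmorphB; congr ((_ - _) *: _).
by rewrite rmorph_nat.
Qed.

Let kT : kk_stable Phi Delta (T k.+1).
Proof. by split; [exact: T0|exact: TD|exact: TZ|exact: TK]. Qed.

Definition einv v : P := xget 0 [set w | T k.+1 w /\ eop k.+1 w = v].

Let einvP v : T k.+1 v -> T k.+1 (einv v) /\ eop k.+1 (einv v) = v.
Proof.
move=> Tv; rewrite /einv; case: xgetP => [w _ //|] H; exfalso.
(* A preimage is found by dividing each eigencomponent of v by its eigenvalue under [eop], which is
   positive by [eop_eigen]. *)
have [s [vE us sP]] := spectral Phi_root kT Tv.2 Tv.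
pose lam (p : R * P) : C := (k.+1%:R - c * p.1)%:C.
apply: (H (\sum_(p <- s) (lam p)^-1 *: p.2)); split.
  rewrite big_seq; apply: (big_ind (T k.+1)); [exact: T0|exact: TD|].
  by move=> p /sP[_ Tp _]; exact: TZ.
rewrite /eop KK_sum !scaler_sumr -sumrB vE big_seq [RHS]big_seq.
apply: eq_bigr => p /sP[_ Tp Kp].
have [->|p0] := eqVneq p.2 0; first by rewrite scaler0 KK0 !scaler0 subrr.
have -> : k.+1%:R *: ((lam p)^-1 *: p.2) - c%:C *: KK ((lam p)^-1 *: p.2) = eop k.+1 ((lam p)^-1 *: p.2) by [].
have := eop_linear k.+1 (lam p)^-1 p.2 0.
rewrite /eop KK0 !scaler0 subr0 !addr0 -!/(eop _ _) => ->.
rewrite (eop_eq Kp) scalerA mulVf ?scale1r// /lam.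
by rewrite -(rmorph0 (real_complex R)) (inj_eq (@complexI R)) gt_eqF// (eop_eigen Tp p0 Kp).
Qed.

Let einv_eq v w : T k.+1 w -> eop k.+1 w = v -> einv v = w.
Proof.
move=> Tw Ew; have Tv : T k.+1 v by rewrite -Ew; exact: Teop.
have [Te Ee] := einvP Tv; apply/eqP; rewrite -subr_eq0; apply/eqP.
apply: eop_inj; first exact: TB.
have := eop_linear k.+1 (-1) w (einv v).
by rewrite !scaleN1r addrC => ->; rewrite Ew Ee addrC subrr.
Qed.

(** A(u, E^-1 v), as forced by the reading of A(u, v) as (u, E v). *)
Definition next u v := \sum_j B (y_ j u) (y_ j (einv v)).

Let nextE u v : next u v = A u (einv v). Proof. by []. Qed.

Lemma next_x i u v : T k u -> T k.+1 v -> next (x_ i * u) v = B u (y_ i v).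
Proof. by move=> Tu Tv; have [Te Ee] := einvP Tv; rewrite nextE A_x// Ee. Qed.

Lemma next_good : good k.+1 next.
Proof.
have herm u v : T k.+1 u -> T k.+1 v -> next v u = (next u v)^*%C.
  move=> Tu Tv; have [Teu Eu] := einvP Tu; have [Tev Ev] := einvP Tv.
  by rewrite !nextE -{1}Ev A_eop// Eu sA.2.
split => //.
- split=> // a u u' v Tu Tu' Tv; have [Tev Ev] := einvP Tv.
  by rewrite !nextE sA.1.
- move=> al u v alP Tu Tv; have [Tev Ev] := einvP Tv.
  have -> : next (refl al u) (refl al v) = A (refl al u) (refl al (einv v)).
    rewrite nextE; congr (A _ _); apply: einv_eq; first exact: Tr.
    by rewrite /eop KK_refl// -!reflZ -reflB -/(eop _ _) Ev.
  by rewrite A_refl.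
- move=> v Tv v0; have [Te Ee] := einvP Tv; rewrite nextE -{1}Ee.
  have e0 : einv v != 0.
    by apply: contra_neq v0 => e0; rewrite -Ee e0 /eop KK0 !scaler0 subr0.
  set w := einv v in Te e0 *.
  (* With v = E w, the value A(E w, w) is the sum of the positive eigenvalues of E times the A-norms
     of the A-orthogonal components of w. *)
  have [s [wE us sP]] := spectral Phi_root kT Te.2 Te.
  have Ts p : p \in s -> T k.+1 p.2 by move=> /sP[].
  pose lam (p : R * P) : R := k.+1%:R - c * p.1.
  have orth p : p \in s -> A p.2 w = A p.2 p.2.
    move=> ps; rewrite {1}wE (on_sumr (T0 _) (@TD _) sA Ts (Ts p ps)).
    rewrite (bigD1_seq p)//= ?(map_uniq us)//.
    rewrite big_seq_cond big1 ?addr0// => q /andP[qs qp].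
    have [_ _ Kp] := sP p ps; have [_ _ Kq] := sP q qs.
    have Tp := Ts p ps; have Tq := Ts q qs; have := A_KK Tp Tq.
    rewrite Kp Kq (onZl (T0 _) sA _ Tp Tq) (onZr (T0 _) (@TZ _) sA _ Tp Tq) conj_realC.
    move=> /eqP; rewrite -subr_eq0 -mulrBl -rmorphB mulf_eq0 => /orP[|/eqP//].
    move=> /eqP/(congr1 (@complex.Re R))/= /eqP; rewrite subr_eq0 => /eqP pq1.
    case/eqP: qp; move: us => /(nth_uniq 0) us.
    have := us (index p s) (index q s); rewrite !size_map !index_mem => /(_ ps qs).
    rewrite !(nth_map p) ?index_mem// !nth_index// pq1 eqxx => /esym/eqP.
    by move=> /(congr1 (nth p s)); rewrite !nth_index// => ->.
  have -> : A (eop k.+1 w) w = \sum_(p <- s) (lam p)%:C * A p.2 p.2.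
    have -> : eop k.+1 w = \sum_(p <- s) (lam p)%:C *: p.2.
      rewrite {1}wE /eop KK_sum !scaler_sumr -sumrB big_seq [RHS]big_seq.
      by apply: eq_bigr => p /sP[_ _ Kp]; rewrite -/(eop _ _) (eop_eq Kp).
    rewrite (on_suml (T0 _) (@TD _) sA _ Te).2; last by move=> p ps; apply: TZ; exact: Ts.
    rewrite big_seq [RHS]big_seq; apply: eq_bigr => p ps.
    by rewrite (onZl (T0 _) sA) ?orth//; exact: Ts.
  have ge0 p : p \in s -> 0 <= (lam p)%:C * A p.2 p.2.
    move=> ps; have [_ _ Kp] := sP p ps; have Tp := Ts p ps.
    have [->|p0] := eqVneq p.2 0; first by rewrite (on0l (T0 _) sA) ?mulr0.
    by rewrite mulr_ge0 ?ler0c ?ltW// ?(eop_eigen Tp)// A_pos.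
  rewrite lt_def big_seq sumr_ge0 => [|p ps]; last exact: ge0.
  rewrite andbT -big_seq; apply: contra_neq e0 => /eqP.
  rewrite big_seq psumr_eq0 // => /allP h.
  rewrite wE big_seq big1// => p ps; apply/eqP/contraT => p0.
  have [_ _ Kp] := sP p ps; have Tp := Ts p ps.
  have := h p ps; rewrite ps/= mulf_eq0 => /orP[/eqP|].
    move=> /(congr1 (@complex.Re R))/= l0.
    by have := eop_eigen Tp p0 Kp; rewrite -/(lam p) l0 ltxx.
  by rewrite gt_eqF// A_pos.
(* Both sides are B(y_j u, y_i v), the right one after exchanging the arguments by Hermitian
   symmetry. *)
- move=> i j u v Tu Tv; rewrite next_x//; last exact: Tdk.
  rewrite (herm (x_ j * y_ i v))//; last by apply: Tx; exact: Tdk.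
  rewrite next_x//; last exact: Tdk.
  by rewrite -sB.2//; exact: Tdk.
Qed.

End Step.

Fixpoint bs n : P -> P -> C :=
  if n is n'.+1 then next (m0 + n') (bs n') else fisch m0.

Lemma bs_good n : good (m0 + n) (bs n).
Proof.
elim: n => [|n IH]; last by rewrite addnS; apply: next_good => //; exact: leq_addr.
have sF := fisch_sesqui R N m0; rewrite addn0; split.
- split=> [a u u' v _ _ _|u v _ _]; [exact: sF.1|exact: sF.2].
- move=> al u v alP _ _; apply: fisch_orth.
  by rewrite trmx_reflection reflection_invol// (root_nonzero Phi_root).
- by move=> u [_ hu] u1; exact: fisch_gt0.
(* The y_j vanish on the lowest degree, so both sides are 0. *)
- move=> i j u v Tu Tv; rewrite !dk_low// !mulr0.
  by rewrite /bs (sesqui0l sF) (sesqui0r sF).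
Qed.

Lemma bs_x n i u v : T (m0 + n) u -> T (m0 + n.+1) v ->
  bs n.+1 (x_ i * u) v = bs n u (y_ i v).
Proof.
rewrite addnS => Tu Tv; apply: next_x => //; first exact: leq_addr.
exact: bs_good.
Qed.

Local Notation cmp n u := (comp_hom (m0 + n) u).

(** Distinct degrees are orthogonal. The range is symmetric in u and v; by [formE] any range
    covering the degree of u gives the same value. *)
Definition form u v : C := \sum_(n < mmeasure mdeg u + mmeasure mdeg v) bs n (cmp n u) (cmp n v).

Let bs0l n v : T (m0 + n) v -> bs n 0 v = 0.
Proof. by move=> Tv; rewrite (on0l (T0 _) (good_sesqui (bs_good n))). Qed.
Lemma formE K u v : S u -> S v -> (mmeasure mdeg u <= K)%N ->
  form u v = \sum_(n < K) bs n (cmp n u) (cmp n v).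
Proof.
move=> Su Sv uK.
have vanish n : (mmeasure mdeg u <= n)%N -> bs n (cmp n u) (cmp n v) = 0.
  move=> h; rewrite comp_hom_eq0 ?bs0l//; first exact: Tcomp.
  by rewrite (leq_trans h)// leq_addl.
have key K' : (mmeasure mdeg u <= K')%N ->
   \sum_(n < K') bs n (cmp n u) (cmp n v) = \sum_(n < mmeasure mdeg u) bs n (cmp n u) (cmp n v).
  move=> h; rewrite [RHS](big_ord_widen K' (fun n => bs n (cmp n u) (cmp n v)))//.
  rewrite [RHS]big_mkcond; apply: eq_bigr => n _.
  by case: ltnP => // hn; rewrite vanish.
by rewrite /form !key// leq_addr.
Qed.

Lemma form_pos u : S u -> u != 0 -> 0 < form u u.
Proof.
move=> Su un0; rewrite (formE Su Su (leqnn _)).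
have ge0 n : 0 <= bs n (cmp n u) (cmp n u).
  have Tn : T (m0 + n) (cmp n u) by exact: Tcomp.
  have [->|h] := eqVneq (cmp n u) 0; first by rewrite bs0l.
  exact/ltW/(good_pos (bs_good n)).
rewrite lt_def sumr_ge0// andbT; apply: contra_neq un0 => /eqP.
rewrite psumr_eq0// => /allP h.
have cn n : cmp n u = 0.
  have [hn|hn] := leqP (mmeasure mdeg u) n.
    by rewrite comp_hom_eq0// (leq_trans hn)// leq_addl.
  apply/eqP/contraT => c0.
  have := good_pos (bs_good n) (Tcomp (m0 + n) Su) c0.
  by have /eqP -> := h (Ordinal hn) (mem_index_enum _); rewrite ltxx.
rewrite (comp_hom_sum u) big1// => d _.
have [dm|dm] := ltnP d m0; first by apply: T_low dm _; exact: Tcomp.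
by rewrite -(subnKC dm) cn.
Qed.

Lemma form_ok : contravariant_form Phi Delta c S form.
Proof.
have herm u v : S u -> S v -> form v u = (form u v)^*%C.
  move=> Su Sv; rewrite (@formE (mmeasure mdeg u + mmeasure mdeg v))// ?leq_addl//.
  rewrite rmorph_sum; apply: eq_bigr => n _ /=.
  by rewrite (good_sesqui (bs_good n)).2//; exact: Tcomp.
have refl_inv al u v : al \in Phi -> S u -> S v -> form (refl al u) (refl al v) = form u v.
  move=> alP Su Sv; pose K := (mmeasure mdeg u + mmeasure mdeg (refl al u))%N.
  rewrite (@formE K) ?leq_addl//; try exact: (sub_refl Phi_root S_sub).
  rewrite (@formE K _ _ Su Sv) ?leq_addr//; apply: eq_bigr => n _.
  by rewrite !comp_hom_lsub (good_refl (bs_good n))//; exact: Tcomp.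
split => //.
- move=> a u u' v Su Su' Sv.
  have Sau : S (a *: u + u') by apply: (subD S_sub) => //; exact: (subZ S_sub).
  pose K := (mmeasure mdeg u + mmeasure mdeg u' + mmeasure mdeg (a *: u + u'))%N.
  rewrite (@formE K _ _ Sau Sv) ?leq_addl// (@formE K _ _ Su Sv); last by rewrite /K -addnA leq_addr.
  rewrite (@formE K _ _ Su' Sv); last by rewrite /K addnAC leq_addl.
  rewrite mulr_sumr -big_split; apply: eq_bigr => n _ /=.
  by rewrite comp_homD comp_homZ (good_sesqui (bs_good n)).1//; exact: Tcomp.
- move=> u Su h; apply/eqP/contraT => un0.
  by have := form_pos Su un0; rewrite h// ltxx.
- move=> w u v wW; rewrite !(coxeter_geom_act Phi_root _ wW).
  elim: wW u v => [|{}w al wW IH alP] u v Su Sv; first by rewrite trmx1 !lsub1.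
  rewrite trmx_mul trmx_reflection -!lsub_mul refl_inv ?IH//.
    by rewrite -(coxeter_geom_act Phi_root _ wW); exact: (sub_geom S_sub).
  by rewrite -(coxeter_geom_act Phi_root _ wW); exact: (sub_geom S_sub).
- move=> i u v Su Sv.
  have yE : dunkl Phi Delta c (delta_mx 0 i) v = y_ i v by rewrite dk.unlock.
  rewrite yE.
  pose K := (mmeasure mdeg u + mmeasure mdeg (x_ i * u))%N.
  have Sxu := sub_x S_sub i Su; have Syv := sub_y S_sub i Sv.
  rewrite (@formE K.+1 _ _ Sxu Sv); last exact: leqW (leq_addl _ _).
  rewrite (@formE K _ _ Su Syv) ?leq_addr// big_ord_recl.
  (* The extra first term involves the component of x_i u in degree m0, which comes from u in degree
     m0 - 1, where S is zero. *)
  rewrite [X in X + _](_ : _ = 0) ?add0r; last first.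
    have -> : cmp 0 (x_ i * u) = 0; last by apply: bs0l; exact: Tcomp.
    rewrite addn0; case: m0 m0_ge2 T_low => // m _ low.
    have -> : comp_hom m.+1 (x_ i * u) = x_ i * comp_hom m u by exact: comp_hom_x.
    have -> : comp_hom m u = 0 by apply: (low m) => //; exact: Tcomp.
    by rewrite mulr0.
  apply: eq_bigr => n _; rewrite lift0.
  have -> : cmp n.+1 (x_ i * u) = x_ i * cmp n u by rewrite addnS comp_hom_x.
  by rewrite bs_x ?comp_hom_dk -?addnS//; exact: Tcomp.
Qed.

End Lowest.

Theorem unitary_of_bound : unitary Phi Delta c S.
Proof.
have [m0 [m2 [u0 Tu0 u00] low]] := lowest_degree.
exists (form m0); first exact: (form_ok m2 Tu0).
by exists 1 => u Su u1; rewrite rmorph1 mul1r; exact: (form_pos m2 Tu0).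
Qed.

End Unitarity.

(** * Singular integrals *)

Section OneDim.
Variables (R : realType) (th : R).
Hypothesis th0 : 0 < th.
Hypothesis th1 : th < 1.
Local Notation mu := (@lebesgue_measure R).
Implicit Types (r x y z a : R).

(* |r|^(-theta), with its limit +oo (rather than the value 0 of powR) at 0. *)
Definition psi r : \bar R := if r == 0 then +oo%E else (`|r| `^ (- th))%:E.

Lemma psi_gt0 r : (0 < psi r)%E.
Proof. by rewrite /psi; case: ifP => // /negbT r0; rewrite lte_fin powR_gt0// normr_gt0. Qed.

Lemma psi_ge0 r : (0 <= psi r)%E.
Proof. exact/ltW/psi_gt0. Qed.

Lemma psi_lb r : ((`|r| `^ (- th))%:E <= psi r)%E.
Proof. by rewrite /psi; case: ifP => // _; rewrite leey. Qed.

Lemma psi_le a y z : 0 < a -> a * `|z| <= `|y| -> (psi y <= (a `^ (- th))%:E * psi z)%E.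
Proof.
move=> a0 h; rewrite /psi; have [_|z0] := eqVneq z 0.
  by rewrite mulry gtr0_sg ?powR_gt0// mul1e leey.
have z1 : 0 < `|z| by rewrite normr_gt0.
have y1 : 0 < `|y| by rewrite (lt_le_trans _ h)// mulr_gt0.
have y0 : y != 0 by rewrite -normr_gt0.
have az0 : 0 < a * `|z| by rewrite mulr_gt0.
rewrite (negbTE y0) -EFinM (_ : a `^ (- th) * `|z| `^ (- th) = ((a * `|z|) `^ th)^-1); last by rewrite -powRN powRM// ltW.
rewrite lee_fin powRN lef_pV2 ?posrE ?powR_gt0//.
by apply: ge0_ler_powR; rewrite ?nnegrE// ltW.
Qed.

Lemma measurable_psi : measurable_fun setT psi.
Proof.
apply: measurable_fun_ifT => //.
  exact: measurable_fun_eqr.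
apply/measurable_EFinP; apply: (@measurableT_comp _ _ _ _ _ _ (@powR R ^~ (- th))).
  exact: measurable_powR.
exact: normr_measurable.
Qed.

(** One factor of exp(- |x|^2 / 4), half the exponent of the Gaussian weight; the other half is
    spent on polynomial growth in [chamber_gauss]. *)
Definition gau x : R := expR (- x ^+ 2 / 4).

Lemma gau_gt0 x : 0 < gau x. Proof. exact: expR_gt0. Qed.

Lemma gau_le1 x : gau x <= 1.
Proof. by rewrite /gau -[leRHS]expR0 ler_expR mulNr oppr_le0 mulr_ge0// sqr_ge0. Qed.

Lemma measurable_gau : measurable_fun setT gau.
Proof.
apply: measurableT_comp => //=; apply: measurable_funM => //=.
by apply: measurableT_comp => //=; exact: measurable_funX.
Qed.

Lemma integral_gau : (\int[mu]_x (gau x)%:E < +oo)%E.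
Proof.
pose s : R := Num.sqrt 2.
have s0 : s != 0 by rewrite gt_eqF// sqrtr_gt0.
have E x : gau x = normal_fun 0 s x.
  rewrite /gau /normal_fun subr0 sqr_sqrtr// (_ : 2 *+ 2 = 4 :> R)//.
  by rewrite -mulr_natr; ring.
have /integrableP[_] := integrable_normal_pdf (0 : R) s.
have E' x : (gau x)%:E = ((normal_peak s)^-1%:E * `|(normal_pdf 0 s x)%:E|)%E.
  rewrite normal_pdfE// -EFinM /= ger0_norm ?mulr_ge0 ?normal_peak_ge0 ?expR_ge0//.
  by rewrite mulrA mulVf ?mul1r ?E// gt_eqF// normal_peak_gt0.
under [X in (_ -> X < _)%E]eq_integral do rewrite E'.
move=> h; rewrite ge0_integralZl//=.
- by rewrite lte_mul_pinfty// lee_fin invr_ge0 normal_peak_ge0.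
- by apply/measurable_EFinP/measurableT_comp => //; exact: measurable_normal_pdf.
- by rewrite lee_fin invr_ge0 normal_peak_ge0.
Qed.

Let b : R := 2 `^ th.

Let bE : b = expR (th * ln 2). Proof. by rewrite /b /powR gt_eqF. Qed.

Let b_gt1 : 1 < b.
Proof. by rewrite bE expR_gt1 mulr_gt0// ln_gt0// ltr1n. Qed.

Let b_lt2 : b < 2.
Proof.
have l2 : 0 < ln 2 :> R by rewrite ln_gt0// ltr1n.
by rewrite bE -[ltRHS](@lnK _ 2) ?posrE// ltr_expR gtr_pMl.
Qed.

Let half_powR n : ((2^-1) ^+ n) `^ (- th) = b ^+ n.
Proof.
elim: n => [|n IH]; first by rewrite !expr0 powR1.
rewrite !exprS powRM ?invr_ge0 ?exprn_ge0 ?invr_ge0// IH; congr (_ * _).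
by rewrite -powR_inv1// -powRrM mulN1r opprK.
Qed.

(** If 2^-(n+1) < |y| <= 2^-n, then |y|^(-th) is below b^(n+1) with b = 2^th, which is the n-th
    term. At y = 0 all terms are at least 1 and the series diverges. *)
Lemma psi_series y : (psi y <= 1 + \sum_(0 <= n <oo) (b ^+ n.+1 * \1_(`[- 2^-1 ^+ n, 2^-1 ^+ n]) y)%:E)%E.
Proof.
set F := (fun n => (b ^+ n.+1 * \1_(`[- 2^-1 ^+ n, 2^-1 ^+ n]) y)%:E).
have F0 n : (0 <= F n)%E by rewrite lee_fin mulr_ge0// exprn_ge0// ltW// (lt_trans _ b_gt1).
have inI n : `|y| <= 2^-1 ^+ n -> \1_(`[- 2^-1 ^+ n, 2^-1 ^+ n]) y = 1 :> R.
  by rewrite ler_norml => h; rewrite indicE mem_set//= in_itv.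
have [y1|y1] := leP `|y| 1; last first.
  have y0 : y != 0 by rewrite -normr_gt0 (lt_trans _ y1).
  rewrite /psi (negbTE y0); apply: (@le_trans _ _ 1%E); last first.
    by rewrite leeDl//; apply: nneseries_ge0 => n _ _; exact: F0.
  rewrite lee_fin powRN invf_le1 ?powR_gt0 ?normr_gt0//.
  by rewrite -(powRr0 `|y|) ler_powR// ltW.
have [yE|y0] := eqVneq y 0.
  have -> : (\sum_(0 <= n <oo) F n)%E = +oo%E; last by rewrite addey ?leey.
  apply/eqyP => A A0.
  have [k Ak] : exists k : nat, A <= k%:R by exists (Num.truncn A).+1; exact/ltW/truncnS_gt.
  apply: (@le_trans _ _ (\sum_(0 <= n < k) F n)%E); last by apply: nneseries_lim_ge => n _ _; exact: F0.
  apply: (@le_trans _ _ (\sum_(0 <= n < k) 1%:E)%E).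
    by rewrite sumEFin sumr_const_nat subn0 lee_fin.
  apply: lee_sum => n _; rewrite /F lee_fin inI ?mulr1.
    by rewrite exprn_ege1// ltW.
  by rewrite yE normr0 exprn_ge0// invr_ge0.
have yp : 0 < `|y| by rewrite normr_gt0.
have ex : exists k, 2^-1 ^+ k < `|y|.
  exists (Num.truncn (`|y|^-1)).+1.
  rewrite exprVn -[ltRHS]invrK ltf_pV2 ?posrE ?invr_gt0 ?exprn_gt0//.
  apply: (lt_le_trans (truncnS_gt _)); rewrite -natrX ler_nat ltnW//.
  exact: ltn_expl.
case: (ex_minnP ex) => -[|n]; first by rewrite expr0 ltNge y1.
move=> hn hmin.
have yn : `|y| <= 2^-1 ^+ n by rewrite leNgt; apply/negP => /hmin; rewrite ltnn.
apply: (@le_trans _ _ (F n)).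
  rewrite /psi (negbTE y0) /F lee_fin inI// mulr1 -half_powR !powRN.
  rewrite lef_pV2 ?posrE ?powR_gt0// ?exprn_gt0 ?invr_gt0//.
  by apply: ge0_ler_powR; rewrite ?nnegrE ?ltW// exprn_gt0// invr_gt0.
apply: (@le_trans _ _ (\sum_(0 <= i < n.+1) F i)%E).
  by rewrite big_nat_recr//= leeDr// sume_ge0.
apply: (@le_trans _ _ (\sum_(0 <= i <oo) F i)%E); first by apply: nneseries_lim_ge => i _ _; exact: F0.
by rewrite leeDr.
Qed.

(** A shift by r keeps the lengths of the dyadic intervals, so the n-th term of [psi_series]
    contributes 2 b (b / 2)^n for every r, a convergent geometric series since th < 1. Uniformity in
    r allows integrating one variable at a time. *)
Lemma integral_psi_gau : exists2 M : R, 0 <= M &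
  forall r, (\int[mu]_x (psi (x + r) * (gau x)%:E) <= M%:E)%E.
Proof.
pose I n y : R := \1_(`[- 2^-1 ^+ n, 2^-1 ^+ n]) y.
pose F n y : R := b ^+ n.+1 * I n y.
have b0 : 0 < b by exact: lt_trans b_gt1.
have F0 n y : 0 <= F n y by rewrite mulr_ge0// exprn_ge0// ltW.
have mshift r : measurable_fun setT (fun x : R => x + r).
  exact: measurable_funD.
have mI n : measurable_fun setT (I n).
  exact: measurable_indic.
have mF r n : measurable_fun setT (fun x : R => (F n (x + r))%:E).
  apply/measurable_EFinP; apply: measurable_funM => //.
  exact: (measurableT_comp (mI n) (mshift r)).
have mg : measurable_fun setT (fun x : R => (gau x)%:E).
  by apply/measurable_EFinP; exact: measurable_gau.
have IF r n : (\int[mu]_x (F n (x + r))%:E = (b * 2 * (b / 2) ^+ n)%:E)%E.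
  have mII : measurable_fun setT (fun x : R => (I n (x + r))%:E).
    by apply/measurable_EFinP; exact: (measurableT_comp (mI n) (mshift r)).
  have bn : 0 <= b ^+ n.+1 by rewrite exprn_ge0// ltW.
  have I0 x : setT x -> (0 <= (I n (x + r))%:E)%E by rewrite lee_fin.
  transitivity ((b ^+ n.+1)%:E * \int[mu]_x (I n (x + r))%:E)%E.
    by rewrite -(ge0_integralZl_EFin mu measurableT I0 mII bn); apply: eq_integral.
  have -> : (\int[mu]_x (I n (x + r))%:E =
    \int[mu]_x (\1_(`[- 2^-1 ^+ n - r, 2^-1 ^+ n - r]) x)%:E)%E.
    apply: eq_integral => x _; rewrite /I !indicE; congr ((nat_of_bool _)%:R%:E).
    by apply/idP/idP; rewrite !inE/= !in_itv/= => /andP[h1 h2]; apply/andP; split; lra.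
  rewrite integral_indic//= setIT lebesgue_measure_itv/= lte_fin.
  have q0 : 0 < (2^-1 : R) ^+ n by rewrite exprn_gt0// invr_gt0.
  rewrite ifT; last by lra.
  rewrite -EFinD -EFinM; congr EFin.
  rewrite exprS exprMn; ring.
have [G G0 GE] : exists2 G : R, 0 <= G & (\int[mu]_x (gau x)%:E = G%:E)%E.
  have h := integral_gau.
  have h0 : (0 <= \int[mu]_x (gau x)%:E)%E.
    by apply: integral_ge0 => x _; rewrite lee_fin ltW// gau_gt0.
  exists (fine (\int[mu]_x (gau x)%:E)%E); first exact: fine_ge0.
  by rewrite fineK// ge0_fin_numE.
have b2 : `|b / 2| < 1.
  by rewrite ger0_norm ?divr_ge0 ?ltW// ltr_pdivrMr// mul1r.
exists (G + b * 2 / (1 - b / 2)).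
  rewrite addr_ge0// divr_ge0 ?mulr_ge0 ?ltW// subr_gt0.
  by rewrite ltr_pdivrMr// mul1r.
move=> r.
apply: (@le_trans _ _ (\int[mu]_x ((gau x)%:E + \sum_(0 <= n <oo) (F n (x + r))%:E))%E).
  apply: ge0_le_integral => //.
  - by move=> x _; rewrite mule_ge0 ?psi_ge0// lee_fin ltW// gau_gt0.
  - apply: emeasurable_funM => //.
    exact: (measurableT_comp measurable_psi (mshift r)).
  - apply: emeasurable_funD => //.
    by apply: ge0_emeasurable_sum => [n x _ _|n _]; [rewrite lee_fin|exact: mF].
  - move=> x _; have S0 : (0 <= \sum_(0 <= n <oo) (F n (x + r))%:E)%E.
      by apply: nneseries_ge0 => n _ _; rewrite lee_fin.
    apply: (@le_trans _ _ ((1 + \sum_(0 <= n <oo) (F n (x + r))%:E) * (gau x)%:E)%E).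
      by rewrite lee_wpmul2r ?psi_series// lee_fin ltW// gau_gt0.
    rewrite ge0_muleDl// mul1e leeD2l//.
    by rewrite -[leRHS]mule1 lee_wpmul2l// lee_fin gau_le1.
have g0 x : setT x -> (0 <= (gau x)%:E)%E by rewrite lee_fin ltW// gau_gt0.
have S0 x : setT x -> (0 <= \sum_(0 <= n <oo) (F n (x + r))%:E)%E.
  by move=> _; apply: nneseries_ge0 => n _ _; rewrite lee_fin.
have mS : measurable_fun setT (fun x : R => \sum_(0 <= n <oo) (F n (x + r))%:E)%E.
  by apply: ge0_emeasurable_sum => [n x _ _|n _]; [rewrite lee_fin|exact: mF].
have -> : (\int[mu]_x ((gau x)%:E + \sum_(0 <= n <oo) (F n (x + r))%:E) =
    \int[mu]_x (gau x)%:E + \int[mu]_x \sum_(0 <= n <oo) (F n (x + r))%:E)%E.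
  by rewrite -(ge0_integralD mu measurableT g0 mg S0 mS).
have Fn0 n x : setT x -> (0 <= (F n (x + r))%:E)%E by rewrite lee_fin.
rewrite GE EFinD leeD2l//.
have -> : (\int[mu]_x \sum_(0 <= n <oo) (F n (x + r))%:E =
    \sum_(0 <= n <oo) \int[mu]_x (F n (x + r))%:E)%E.
  by rewrite -(integral_nneseries mu measurableT (mF r) Fn0).
under eq_eseriesr do rewrite IF.
have h := @cvg_geometric_series _ (b * 2) _ b2.
rewrite (_ : (\sum_(0 <= n <oo) _)%E = (b * 2 / (1 - b / 2))%:E)//.
apply/cvg_lim => //.
rewrite (_ : (fun n => _) = EFin \o series (geometric (b * 2) (b / 2))); last first.
  by apply/funext => n; rewrite /= /series/= sumEFin.
by apply: cvg_EFin; [exact: nearW|exact: h].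
Qed.

End OneDim.

Section EProd.
Variables (R : realType).
Implicit Types (I : Type).
Local Open Scope ereal_scope.

Lemma prode_ge0 I (s : seq I) (f : I -> \bar R) :
  (forall i, 0 <= f i) -> 0 <= \prod_(i <- s) f i.
Proof. by move=> f0; elim/big_ind: _ => // *; rewrite mule_ge0. Qed.

Lemma lee_prode I (s : seq I) (f g : I -> \bar R) : (forall i, 0 <= f i) ->
  (forall i, f i <= g i) -> \prod_(i <- s) f i <= \prod_(i <- s) g i.
Proof.
move=> f0 fg; elim: s => [|i s IH]; first by rewrite !big_nil.
by rewrite !big_cons lee_pmul// prode_ge0.
Qed.

Lemma emeasurable_prod d (T : measurableType d) I (s : seq I) (f : I -> T -> \bar R) :
  (forall i, measurable_fun setT (f i)) ->
  measurable_fun setT (fun x => \prod_(i <- s) f i x).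
Proof.
move=> mf; elim: s => [|i s IH].
  by rewrite (_ : (fun _ => _) = cst 1)//; apply/funext => x; rewrite big_nil.
rewrite (_ : (fun _ => _) = (fun x => f i x * \prod_(j <- s) f j x)).
  exact: emeasurable_funM.
by apply/funext => x; rewrite big_cons.
Qed.

End EProd.

(** * Integrability of products of singular linear forms *)

Section TupleIntegral.
Variables (R : realType) (th : R).
Hypothesis th0 : 0 < th.
Hypothesis th1 : th < 1.
Local Notation T := (measurableTypeR R).
Local Notation leb := (@lebesgue_measure R).
Local Notation psi := (psi th).

Lemma integral_lebesgueNS n (f : n.+1.-tuple T -> \bar R) :
  measurable_fun setT f -> (forall t, 0 <= f t)%E ->
  (\int[lebesgueN R n.+1]_t f t =
   \int[lebesgueN R n]_t \int[leb]_x f [tuple of x :: t])%E.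
Proof.
move=> mf f0.
pose tc (p : T * n.-tuple T) : n.+1.-tuple T := [tuple of p.1 :: p.2].
have mtc : measurable_fun setT tc by exact: measurable_cons.
have f0' : {in [set: n.+1.-tuple T], forall y, (0 <= f y)%E} by [].
transitivity (\int[pushforward (leb \x lebesgueN R n)%E tc]_y f y)%E; first by [].
have -> := ge0_integral_pushforward mtc (leb \x lebesgueN R n)%E measurableT mf f0'.
rewrite preimage_setT (fubini_tonelli2 _ (measurableT_comp mf mtc)) => [|p].
  by apply: eq_integral => t _; rewrite /fubini_G.
exact: f0.
Qed.

Definition tform n (b : 'I_n -> R) (t : n.-tuple R) : R := \sum_k b k * tnth t k.

Lemma measurable_tform n (b : 'I_n -> R) :
  measurable_fun setT (tform b : n.-tuple T -> T).
Proof.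
rewrite /tform; apply: measurable_sum => k.
apply: measurable_funM; first exact: measurable_cst.
exact: measurable_tnth.
Qed.

Definition separating n (b : 'I_n -> 'I_n -> R) : Prop :=
  forall x : 'I_n -> R, (forall i, \sum_k b i k * x k = 0) -> forall k, x k = 0.

Definition psi_gau n (b : 'I_n -> 'I_n -> R) (t : n.-tuple R) : \bar R :=
  ((\prod_(i < n) psi (tform (b i) t)) * \prod_(k < n) (gau (tnth t k))%:E)%E.

Lemma gauE_ge0 (x : R) : (0 <= (gau x)%:E)%E.
Proof. by rewrite lee_fin ltW// gau_gt0. Qed.

Lemma psi_gau_ge0 n (b : 'I_n -> 'I_n -> R) t : (0 <= psi_gau b t)%E.
Proof.
apply: mule_ge0; apply: prode_ge0 => i; first exact: psi_ge0.
exact: gauE_ge0.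
Qed.

Lemma measurable_psi_gau n (b : 'I_n -> 'I_n -> R) :
  measurable_fun setT (psi_gau b : n.-tuple T -> \bar R).
Proof.
apply: emeasurable_funM; apply: emeasurable_prod => i.
  exact: (measurableT_comp (measurable_psi th) (measurable_tform (b i))).
apply/measurable_EFinP.
exact: (measurableT_comp (@measurable_gau R) (measurable_tnth i)).
Qed.

Section Step.
Variables (n : nat) (b : 'I_n.+1 -> 'I_n.+1 -> R).
Hypothesis b_sep : separating b.
Local Notation c := (fun i => b i ord0).
Let d i : 'I_n -> R := fun k => b i (lift ord0 k).
Let r i : 'I_n -> R := fun k => d i k / c i.
(** As a function of the first variable x, form j vanishes at - r j; the difference of two such
    zeros is a form in the remaining variables. A form not involving x is kept as it is. *)
Let e i j : 'I_n -> R := if c j == 0 then d j else fun k => r j k - r i k.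
Let kap j : R := if c j == 0 then 1 else (`|c j| / 2) `^ (- th).

Let tform_cons i x (t : n.-tuple R) : tform (b i) [tuple of x :: t] = c i * x + tform (d i) t.
Proof.
rewrite /tform big_ord_recl/= (tnth_nth 0)/=; congr (_ + _).
by apply: eq_bigr => k _; rewrite (tnth_nth 0) /= -tnth_nth.
Qed.

Let tform_r i (t : n.-tuple R) : tform (r i) t = tform (d i) t / c i.
Proof. by rewrite /tform mulr_suml; apply: eq_bigr => k _; rewrite /r mulrAC. Qed.

Let kap_ge0 j : 0 <= kap j.
Proof. by rewrite /kap; case: ifP => // _; exact: powR_ge0. Qed.

(** Given a common zero of the reduced forms, choose the first coordinate so that form i vanishes;
    then all the forms b vanish at the extended point. *)
Let e_sep i : c i != 0 -> separating (fun k => e i (lift i k)).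
Proof.
move=> ci x hx.
pose y (k : 'I_n.+1) : R := if unlift ord0 k is Some k' then x k' else - \sum_k' r i k' * x k'.
have y0 : y ord0 = - \sum_k' r i k' * x k' by rewrite /y unlift_none.
have yl k : y (lift ord0 k) = x k by rewrite /y liftK.
suff hy j : \sum_k b j k * y k = 0.
  by move=> k; rewrite -yl; apply: b_sep.
rewrite big_ord_recl (eq_bigr (fun k => d j k * x k)); last by move=> k _; rewrite yl.
rewrite y0.
have [k ->|->] := unliftP i j; last first.
  rewrite mulrN mulr_sumr addrC; apply/eqP; rewrite subr_eq0; apply/eqP.
  by apply: eq_bigr => k _; rewrite /r [RHS]mulrA [c i * _]mulrC divfK.
have := hx k; rewrite /e; case: ifP => [/eqP -> |/negbT cj]; first by rewrite mul0r add0r.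
move=> h; have : c (lift i k) * \sum_k0 (r (lift i k) k0 - r i k0) * x k0 = 0 by rewrite h mulr0.
rewrite (eq_bigr (fun k0 => r (lift i k) k0 * x k0 - r i k0 * x k0)); last by move=> k0 _; rewrite mulrBl.
rewrite sumrB mulrBr => {}h; rewrite mulrN addrC -[RHS]h; congr (_ - _).
rewrite mulr_sumr; apply: eq_bigr => k0 _; rewrite /r mulrA; congr (_ * _).
by rewrite mulrC divfK.
Qed.

Let c_neq0 : exists i, c i != 0.
Proof.
apply/existsP; apply: contraT; rewrite negb_exists => /forallP h.
have := b_sep (x := fun k => (k == ord0)%:R); move/(_ _ ord0); rewrite eqxx => /(_ _)/eqP.
rewrite oner_eq0; apply => i; rewrite (bigD1 ord0)//= mulr1 big1 ?addr0.
  by move: (h i); rewrite negbK => /eqP.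
by move=> k /negbTE ->; rewrite mulr0.
Qed.

Let A := [seq i <- index_enum 'I_n.+1 | c i != 0].

(** Let i be the form whose zero is nearest to x. For any other j the triangle inequality gives |r j
    - r i| <= 2 |x + r j|, so every factor but the i-th is bounded by one without x. Summing over
    all i covers the dependence of i on x and t. *)
Let psi_gau_le x (t : n.-tuple R) : (psi_gau b [tuple of x :: t] <=
  \sum_(i <- A) (\prod_j (kap j)%:E) * (psi (x + tform (r i) t) * (gau x)%:E) *
     psi_gau (fun k => e i (lift i k)) t)%E.
Proof.
have [i0 ci0] := c_neq0; rewrite big_filter.
case: (@arg_minP _ _ _ i0 (fun i => c i != 0) (fun i => `|x + tform (r i) t|) ci0) => i ci imin.
rewrite (bigD1 i)//=; set rest := (\sum_(j < _ | _) _)%E.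
have rest0 : (0 <= rest)%E.
  apply: sume_ge0 => j _; rewrite mule_ge0 ?psi_gau_ge0// mule_ge0//.
    by apply: prode_ge0 => k; rewrite lee_fin.
  by apply: mule_ge0; [exact: psi_ge0|exact: gauE_ge0].
rewrite -[leLHS]adde0; apply: leeD => //.
have kE (j : 'I_n.+1) : c j != 0 -> c j * x + tform (d j) t = c j * (x + tform (r j) t).
  by move=> cj; rewrite mulrDr tform_r mulrCA divff// mulr1.
pose q j : \bar R := if j == i then psi (x + tform (r i) t) else psi (tform (e i j) t).
have hq j : (psi (tform (b j) [tuple of x :: t]) <= (kap j)%:E * q j)%E.
  rewrite tform_cons /q; have [->|ji] := eqVneq j i.
    rewrite kE// /kap (negbTE ci); apply: (psi_le th0); first by rewrite divr_gt0// normr_gt0.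
    by rewrite normrM ler_wpM2r// ler_pdivrMr// ler_peMr// ler1n.
  rewrite /e /kap; case: (eqVneq (c j) 0) => [->|cj].
    by rewrite mul0r add0r mul1e.
  rewrite kE//; apply: (psi_le th0); first by rewrite divr_gt0// normr_gt0.
  rewrite normrM mulrAC -mulrA ler_wpM2l// ler_pdivrMr//.
  have -> : tform (fun k => r j k - r i k) t = (x + tform (r j) t) - (x + tform (r i) t).
    rewrite /tform opprD addrACA subrr add0r -sumrB.
    by apply: eq_bigr => k _; rewrite mulrBl.
  apply: (le_trans (ler_normB _ _)).
  by rewrite mulr_natr mulr2n lerD2l imin.
rewrite {1}/psi_gau.
apply: (@le_trans _ _ ((\prod_j ((kap j)%:E * q j)) *
    \prod_(k < n.+1) (gau (tnth [tuple of x :: t] k))%:E)%E).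
  apply: lee_wpmul2r; first by apply: prode_ge0 => k; exact: gauE_ge0.
  by apply: lee_prode => // j; exact: psi_ge0.
rewrite big_split/= -!muleA; apply: lee_wpmul2l.
  by apply: prode_ge0 => j; rewrite lee_fin.
have -> : (\prod_j q j = psi (x + tform (r i) t) * \prod_k psi (tform (e i (lift i k)) t))%E.
  rewrite (bigD1_ord i)//= {1}/q eqxx; congr (_ * _)%E.
  by apply: eq_bigr => k _; rewrite /q eq_sym (negbTE (neq_lift _ _)).
have -> : (\prod_(k < n.+1) (gau (tnth [tuple of x :: t] k))%:E =
    (gau x)%:E * \prod_(k < n) (gau (tnth t k))%:E)%E.
  rewrite big_ord_recl (tnth_nth 0)/=; congr (_ * _)%E.
  by apply: eq_bigr => k _; rewrite (tnth_nth 0) /= -tnth_nth.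
by rewrite /psi_gau -!muleA [X in (_ * X)%E]muleCA.
Qed.

Lemma psi_gau_step :
  (forall b' : 'I_n -> 'I_n -> R, separating b' ->
     (\int[lebesgueN R n]_t psi_gau b' t < +oo)%E) ->
  (\int[lebesgueN R n.+1]_t psi_gau b t < +oo)%E.
Proof.
move=> IH; have [M M0 hM] := integral_psi_gau th0 th1.
rewrite integral_lebesgueNS; [|exact: measurable_psi_gau|exact: psi_gau_ge0].
pose K := (\prod_j (kap j)%:E)%E.
have K0 : (0 <= K)%E by apply: prode_ge0 => j; rewrite lee_fin.
have Kfin : K \is a fin_num.
  by rewrite /K; elim/big_ind: _ => // *; exact: fin_numM.
pose P i := psi_gau (fun k => e i (lift i k)).
have mP i : measurable_fun setT (P i : n.-tuple T -> \bar R) by exact: measurable_psi_gau.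
have P0 i t : (0 <= P i t)%E by exact: psi_gau_ge0.
have KM0 : (0 <= K * M%:E)%E by rewrite mule_ge0.
have mpair : measurable_fun setT (fun p : T * n.-tuple T => psi_gau b [tuple of p.1 :: p.2]).
  by apply: (measurableT_comp (measurable_psi_gau b)); exact: measurable_cons.
have mx i t : measurable_fun setT (fun x : T => (psi (x + tform (r i) t) * (gau x)%:E))%E.
  apply: emeasurable_funM; last by apply/measurable_EFinP; exact: measurable_gau.
  apply: (measurableT_comp (measurable_psi th)).
  exact: measurable_funD.
have px0 i t x : (0 <= psi (x + tform (r i) t) * (gau x)%:E)%E.
  by apply: mule_ge0; [exact: psi_ge0|exact: gauE_ge0].
apply: (@le_lt_trans _ _ (\int[lebesgueN R n]_t (\sum_(i <- A) (K * M%:E) * P i t))%E).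
  apply: ge0_le_integral => //.
  - by move=> t _; apply: integral_ge0 => x _; exact: psi_gau_ge0.
  - by apply: (measurable_fun_fubini_tonelli_G _ mpair) => p; exact: psi_gau_ge0.
  - apply: emeasurable_sum => i; apply: emeasurable_funM => //.
  move=> t _; apply: (@le_trans _ _ (\int[leb]_x (\sum_(i <- A)
      (K * P i t) * (psi (x + tform (r i) t) * (gau x)%:E)))%E).
    apply: ge0_le_integral => //.
    - by move=> x _; exact: psi_gau_ge0.
    - exact: (measurable_fun_pair1 t mpair).
    - apply: emeasurable_sum => i; apply: emeasurable_funM => //.
    move=> x _; apply: (le_trans (psi_gau_le x t)); apply: lee_sum => i _.
    by rewrite muleAC.
  rewrite (_ : (\int[leb]_x _)%E = (\sum_(i <- A) \int[leb]_x ((K * P i t) *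
     (psi (x + tform (r i) t) * (gau x)%:E)))%E); last first.
    rewrite -ge0_integral_sum//.
    - by move=> i; apply: emeasurable_funM.
    - by move=> i x _; apply: mule_ge0 (px0 _ _ _); exact: mule_ge0.
  apply: lee_sum => i _; rewrite ge0_integralZl//; last exact: mule_ge0 (P0 _ _).
  rewrite muleAC; apply: lee_wpmul2r => //.
  by apply: lee_wpmul2l.
rewrite (_ : (\int[_]_t _)%E = (\sum_(i <- A) \int[lebesgueN R n]_t (K * M%:E * P i t))%E); last first.
  rewrite -ge0_integral_sum//.
  - by move=> i; apply: emeasurable_funM.
  - by move=> i x _; apply: mule_ge0 (P0 _ _); exact: mule_ge0.
rewrite big_seq; apply: lte_sum_pinfty => i; rewrite mem_filter => /andP[ci _]; rewrite ge0_integralZl// ?mule_ge0//.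
  by apply: lte_mul_pinfty; rewrite ?mule_ge0 ?fin_numM// IH//; exact: e_sep.
Qed.

End Step.

Lemma integral_psi_gau_tuple n (b : 'I_n -> 'I_n -> R) : separating b ->
  (\int[lebesgueN R n]_t psi_gau b t < +oo)%E.
Proof.
elim: n b => [b _|n IH b b_sep]; last exact: psi_gau_step.
rewrite (_ : (\int[_]_t _)%E = (\int[\d_([tuple] : 0.-tuple T)]_t psi_gau b t)%E)//.
rewrite integral_dirac//; last exact: measurable_psi_gau.
rewrite diracT mul1e /psi_gau !big_ord0 mul1e; exact: ltry.
Qed.

End TupleIntegral.

(** * The vanishing ideal *)

Section RealPoints.
Variables (R : realType) (N : nat).
Local Notation C := R[i].
Local Notation P := (cpoly R N).
Local Notation V := 'rV[R]_N.
Implicit Types (f g : P) (u v w alpha : V) (s : R).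
Local Notation x_ := (@xvar R N).

Definition pev f v : C := evl f (fun i => (v 0 i)%:C).

Lemma pevD f g v : pev (f + g) v = pev f v + pev g v.
Proof. exact: mevalD. Qed.

Lemma pevB f g v : pev (f - g) v = pev f v - pev g v.
Proof. exact: mevalB. Qed.

Lemma pevM f g v : pev (f * g) v = pev f v * pev g v.
Proof. exact: mevalM. Qed.

Lemma pevZ a f v : pev (a *: f) v = a * pev f v.
Proof. exact: mevalZ. Qed.

Lemma pev0 v : pev 0 v = 0.
Proof. exact: meval0. Qed.

Lemma pev_one v : pev 1 v = 1.
Proof. exact: meval1. Qed.

Lemma pev_cst a v : pev (a *: 1) v = a.
Proof. by rewrite pevZ pev_one mulr1. Qed.

Lemma pevX i v : pev (x_ i) v = (v 0 i)%:C.
Proof. by rewrite /pev /evl /xvar mevalXU. Qed.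

Lemma pev_sum v (I : Type) (r : seq I) (p : pred I) (F : I -> P) :
  pev (\sum_(i <- r | p i) F i) v = \sum_(i <- r | p i) pev (F i) v.
Proof.
apply: (big_morph (fun f => pev f v)); last exact: pev0.
by move=> f g; exact: pevD.
Qed.

Lemma pev_lsub M f v : pev (lsub M f) v = pev f (v *m M).
Proof.
rewrite /pev evl_lsub; congr evl; apply/funext => i.
by rewrite mxE rmorph_sum; apply: eq_bigr => j _; rewrite rmorphM.
Qed.

Lemma pev_lf u v : pev (lform u) v = (dot u v)%:C.
Proof.
rewrite /pev evl_linear_form /dot rmorph_sum; apply: eq_bigr => i _.
by rewrite rmorphM.
Qed.

Lemma line_restriction f v : exists q : {poly C}, forall s,
  pev f (s *: v) = q.[s%:C] /\ pev (dird v f) (s *: v) = q^`().[s%:C].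
Proof.
elim/mpoly_alg_ind: f => [a|f g [p hp] [q hq]|i f [q hq]].
- by exists a%:P => s; rewrite pev_cst hornerC dirdZ dird_one scaler0 pev0 derivC horner0.
- exists (p + q) => s; have [h1 h2] := hp s; have [h3 h4] := hq s.
  by rewrite pevD h1 h3 hornerD dirdD pevD h2 h4 derivD hornerD.
- exists ((v 0 i)%:C *: 'X * q) => s; have [h1 h2] := hq s; split.
    by rewrite pevM pevX h1 mxE hornerM hornerZ hornerX rmorphM mulrC [X in _ * X]mulrC mulrC.
  rewrite dirdM pevD !pevM h1 h2 dirdX pev_cst pevX mxE derivM derivZ derivX.
  by rewrite hornerD !hornerM !hornerZ hornerX hornerE !rmorphM /= mulr1 [s%:C * _]mulrC.
Qed.

(** On a line f is a polynomial in one variable; having infinitely many zeros it is 0, and so is its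
    derivative, at the origin too. *)
Lemma line_derivative f v : (forall s, s != 0 -> pev f (s *: v) = 0) ->
  forall s, pev (dird v f) (s *: v) = 0.
Proof.
have [q hq] := line_restriction f v => h s.
suff q0 : q = 0 by rewrite (hq s).2 q0 derivC horner0.
apply/eqP; apply: contraT => q0.
pose rs := [seq (n.+1%:R : R)%:C | n <- iota 0 (size q)].
have := max_poly_roots (rs := rs) q0; rewrite size_map size_iota ltnn; apply.
  by apply/allP => _ /mapP[n _ ->]; rewrite /root -(hq _).1 h// pnatr_eq0.
rewrite map_inj_uniq ?iota_uniq// => m n [/eqP]; rewrite eqr_nat => /eqP[].
by [].
Qed.

Lemma pev_refl_fix alpha f v : dot alpha v = 0 -> pev (refl alpha f) v = pev f v.
Proof. by move=> h; rewrite /refl pev_lsub reflectE /cox h mulr0 mul0r scale0r subr0. Qed.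

(** On the mirror the divided difference degenerates to a normal derivative. *)
Lemma pev_rquo_orth alpha f v : alpha != 0 -> dot alpha v = 0 ->
  pev (rquo alpha f) v = (2 / dot alpha alpha)%:C * pev (dird alpha f) v.
Proof.
move=> a0 av; elim/mpoly_alg_ind: f => [a|f g hf hg|i f hf].
- by rewrite root_quotientZ// root_quotient_one// dirdZ dird_one !scaler0 pev0 mulr0.
- by rewrite root_quotientD// dirdD !pevD hf hg mulrDr.
- rewrite -linear_form_delta root_quotient_lf// linear_form_delta dirdM dirdX.
  rewrite !pevD !pevM !pevZ hf pev_one mulr1 pev_refl_fix// pevX.
  rewrite /cox dot_delta (mulrAC 2) [in LHS]rmorphM; move: (pev f v) (pev (dird alpha f) v) => F D.
  by ring.
Qed.

End RealPoints.

(** * Polynomials vanishing on the special lines *)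

Section Ideal.
Variables (R : realType) (N : nat).
Local Notation C := R[i].
Local Notation P := (cpoly R N).
Local Notation V := 'rV[R]_N.
Implicit Types (f g u : P) (v xi alpha : V) (s : R).
Variables (Phi : seq V) (Delta : N.-tuple V) (c : R).
Hypothesis Phi_root : root_system Phi.
Hypothesis Delta_simple : simple_system Phi Delta.
Local Notation Pos := (positive_roots Phi Delta).
Local Notation simple i := (tnth Delta i).
Local Notation x_ := (@xvar R N).
Local Notation dk := (@dk R N Phi Delta c).
Local Notation KK := (@KK R N Phi Delta).
Local Notation y_ i := (dk (delta_mx 0 i)).

Lemma dual_basis : exists om : 'I_N -> V,
  forall i j, dot (om i) (simple j) = (i == j)%:R.
Proof.
pose M : 'M[R]_N := \matrix_(i, k) simple i 0 k.
have /choice[K hK] : forall l : 'I_N, exists k : 'I_N -> R, delta_mx 0 l = \sum_i k i *: simple i.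
  by move=> l; exact: (simple_span Delta_simple).
pose K' : 'M[R]_N := \matrix_(l, i) K l i.
have KM : K' *m M = 1%:M.
  apply/matrixP => l k; transitivity ((delta_mx 0 l : V) 0 k); last first.
    by rewrite !mxE eqxx eq_sym.
  rewrite hK summxE mxE.
  by apply: eq_bigr => i _; rewrite !mxE.
have MK := mulmx1C KM.
exists (fun i => \row_l K' l i) => i j.
have /matrixP/(_ j i) := MK; rewrite !mxE [j == i]eq_sym => <-.
by apply: eq_bigr => l _; rewrite !mxE mulrC.
Qed.

Variable special : pred 'I_N.
Variable om : 'I_N -> V.
Hypothesis om_dual : forall i j, dot (om i) (simple j) = (i == j)%:R.
Hypothesis c_neq0 : c != 0.
(* The parabolic subsystem orthogonal to om j satisfies the identity           *)
(* sum 2 a a^T / (a, a) = h' proj with c h' = 1.                               *)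
Hypothesis special_sum : forall j i, special j -> i != j ->
  \sum_(alpha <- Pos | dot alpha (om j) == 0) cox alpha (simple i) *: alpha
  = c^-1 *: simple i.

Let osum v xi : V := \sum_(alpha <- Pos | dot alpha v == 0) cox alpha xi *: alpha.

Let osum_sym v xi eta : dot (osum v xi) eta = dot xi (osum v eta).
Proof.
rewrite /osum dot_suml dot_sumr; apply: eq_bigr => alpha _.
by rewrite dotZl dotZr /cox [dot xi alpha]dotC; ring.
Qed.

(** The operator 1 - c [osum] is symmetric and kills the simple roots other than j, so its image is
    orthogonal to them, which leaves the line of om j. *)
Let osum_om j xi : special j ->
  xi - c *: osum (om j) xi = dot (xi - c *: osum (om j) xi) (simple j) *: om j.
Proof.
move=> sj; apply: (simple_dot_inj Delta_simple) => i; rewrite dotZl om_dual.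
have [<-|ij] := eqVneq j i; first by rewrite mulr1.
have oE : osum (om j) (simple i) = c^-1 *: simple i by apply: special_sum; rewrite // eq_sym.
rewrite mulr0 dotBl dotZl osum_sym oE dotZr mulrA divff//.
by rewrite mul1r subrr.
Qed.

Let osum_orth w v xi : coxeter_group Phi w -> osum (v *m w) xi = osum v (xi *m w^T) *m w.
Proof.
move=> Ww; have wT := coxeter_orth Phi_root Ww.
rewrite /osum big_mkcond -(big_pos_perm Phi_root Delta_simple _ wT).
- rewrite mulmx_suml [RHS]big_mkcond; apply: eq_bigr => alpha _.
  rewrite orth_dot//; case: ifP => // _; rewrite -scalemxAl /cox.
  by rewrite orth_dot// dot_mul.
- by move=> alpha; exact: coxeter_root.
- by move=> alpha _; rewrite dotNl oppr_eq0 coxNl scaleNr scalerN opprK.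
Qed.

(** The origin is left out of the lines: every root is orthogonal to it, so the reduction to one
    parabolic in [vanishing_y] applies only away from it. *)
Definition vanishing : set P := [set f | forall w j s, coxeter_group Phi w ->
  special j -> s != 0 -> pev f (s *: (om j *m w)) = 0].

(** At a point of the line of v, the divided differences along roots not orthogonal to v vanish, and
    the others are normal derivatives. The Dunkl operator therefore acts as the derivative along xi
    - c [osum] v xi, a multiple of v by [osum_om], and f is 0 along that line. *)
Let vanishing_y xi f : vanishing f -> vanishing (dk xi f).
Proof.
move=> If w j s Ww sj s0; set v := om j *m w.
have rq alpha : alpha \in Pos -> pev (rquo alpha f) (s *: v) =
    if dot alpha v == 0 then (2 / dot alpha alpha)%:C * pev (dird alpha f) (s *: v) else 0.
  move=> aP; have a0 := pos_nonzero Phi_root aP; case: eqP => [av|/eqP av].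
    by rewrite pev_rquo_orth// dotZr av mulr0.
  have := congr1 (fun f => pev f (s *: v)) (root_quotientE a0 f) => /=.
  rewrite pevM pevB pev_lf /refl pev_lsub -scalemxAl /v -mulmxA !If//; last first.
    by apply: coxeter_mul => //; apply: coxeter_reflection => //; exact: pos_root aP.
  rewrite subrr dotZr => /eqP; rewrite mulf_eq0 => /orP[|/eqP//].
  by rewrite -(rmorph0 (real_complex R)) (inj_eq (@complexI R)) mulf_eq0 (negbTE s0) (negbTE av).
have -> : pev (dk xi f) (s *: v) = pev (dird (xi - c *: osum v xi) f) (s *: v).
  rewrite dkE pevB pev_sum dirdBl dirdZl pevB pevZ; congr (_ - _).
  rewrite /osum dird_suml pev_sum mulr_sumr [RHS]big_mkcond; apply: eq_big_seq => alpha aP.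
  rewrite pevZ rq//; case: ifP => _; last by rewrite mulr0.
  rewrite dirdZl pevZ !mulrA; congr (_ * _); rewrite -!rmorphM /cox; congr (_%:C).
  by ring.
have -> : xi - c *: osum v xi = (xi *m w^T - c *: osum (om j) (xi *m w^T)) *m w.
  rewrite mulmxBl -mulmxA (orth_trmx (coxeter_orth Phi_root Ww)) mulmx1 -scalemxAl.
  by rewrite -osum_orth.
rewrite osum_om// -scalemxAl dirdZl pevZ line_derivative ?mulr0//.
by move=> s'; exact: If.
Qed.

Lemma vanishing_submodule : submodule Phi Delta c vanishing.
Proof.
apply: (submodule_gen Phi_root).
- by move=> *; exact: pev0.
- by move=> f g If Ig w j s *; rewrite pevD If// Ig// addr0.
- by move=> a f If w j s *; rewrite pevZ If// mulr0.
- by move=> i f If w j s *; rewrite pevM If// mulr0.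
- move=> alpha f aP If w j s *; rewrite /refl pev_lsub -scalemxAl -mulmxA If//.
  by apply: coxeter_mul => //; exact: coxeter_reflection.
- by move=> i f; exact: vanishing_y.
Qed.

Lemma vanishing_nonzero : (1 < N)%N -> exists2 f, vanishing f & f != 0.
Proof.
move=> N1; exists (\prod_(alpha <- Phi) lform alpha).
  move=> w j s Ww _ _.
  have [i ij] : exists i, i != j.
    pose i0 := Ordinal (ltnW N1); pose i1 := Ordinal N1.
    have [j0|] := eqVneq i0 j; last by exists i0.
    by exists i1; rewrite -j0.
  have aP : simple i *m w \in Phi by apply: coxeter_root => //; exact: simpleP.
  rewrite (perm_big _ (perm_to_rem aP)) big_cons pevM pev_lf dotZr.
  by rewrite orth_dot ?(coxeter_orth Phi_root Ww)// dotC om_dual eq_sym (negbTE ij) mulr0 mul0r.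
rewrite prodf_seq_neq0; apply/allP => alpha aP; rewrite linear_form_eq0.
by rewrite (root_nonzero Phi_root aP).
Qed.

Variable S : set P.
Hypothesis S_min : minimal_submodule Phi Delta c S.
Hypothesis N_gt1 : (1 < N)%N.

Let S_sub : submodule Phi Delta c S. Proof. by case: S_min => -[[]]. Qed.

(** S and [vanishing] are both ideals, so their intersection contains the product of a nonzero
    element of each; being a nonzero submodule of S it is S. *)
Lemma minimal_vanishing f : S f -> vanishing f.
Proof.
have [[[_ [u Su u0]] smin] _] := S_min; have [g Ig g0] := vanishing_nonzero N_gt1.
have Is := vanishing_submodule.
suff <- : S `&` vanishing = S by case.
apply: smin; last by move=> h [].
split; last first.
  exists (g * u); last by rewrite mulf_neq0.
  split; first exact: (sub_mul S_sub).
  by rewrite mulrC; exact: (sub_mul Is).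
split; first by split; [exact: sub0 S_sub|exact: sub0 Is].
  by move=> f1 f2 [h1 h2] [h3 h4]; split; [exact: subD S_sub _ _ _ _|exact: subD Is _ _ _ _].
move=> h f1 hh [h1 h2]; split; [exact: (submoduleH S_sub)|exact: (submoduleH Is)].
Qed.

Hypothesis special_ex : exists j, special j.
Variable h : R.
Hypothesis total_sum : forall i,
  \sum_(alpha <- Pos) cox alpha (simple i) *: alpha = h *: simple i.
Hypothesis ch_neq1 : c * h != 1.

Lemma total_sumE v : \sum_(alpha <- Pos) cox alpha v *: alpha = h *: v.
Proof.
have [k ->] := simple_span Delta_simple v.
rewrite scaler_sumr; transitivity (\sum_i k i *: \sum_(alpha <- Pos) cox alpha (simple i) *: alpha).
  rewrite [RHS](eq_bigr (fun i => \sum_(alpha <- Pos) k i *: (cox alpha (simple i) *: alpha))); last first.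
    by move=> i _; rewrite scaler_sumr.
  rewrite [RHS]exchange_big; apply: eq_bigr => alpha _.
  rewrite {1}/cox dot_sumr mulr_sumr mulr_suml scaler_suml; apply: eq_bigr => i _.
  by rewrite scalerA dotZr /cox; congr (_ *: _); ring.
by apply: eq_bigr => i _; rewrite total_sum !scalerA mulrC.
Qed.

Lemma KK_lf v : KK (lform v) = h%:C *: lform v.
Proof.
rewrite KKE -linear_formZ -total_sumE.
rewrite (big_morph (@lform R N) (@linear_formD R N) (@linear_form0 R N)).
apply: eq_big_seq => alpha aP.
by rewrite refl_lf ?(pos_nonzero Phi_root aP)// opprB addrCA subrr addr0 linear_formZ.
Qed.

Lemma KK_hom1 u : hom 1 u -> KK u = h%:C *: u.
Proof.
move=> hu; have uE : u = \sum_i x_ i * mderiv i u by rewrite (euler hu) scale1r.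
rewrite [in LHS]uE [in RHS]uE KK_sum scaler_sumr; apply: eq_bigr => i _.
have [a ->] := hom0E (hom_mderiv i hu).
by rewrite -scalerAr mulr1 KKZ -linear_form_delta KK_lf !scalerA mulrC.
Qed.

(** A constant vanishing at a point is 0. A linear form in S then has zero Dunkl derivatives, so sum
    x_i y_i, which is the scalar 1 - c h in degree 1, kills it. *)
Lemma minimal_low m u : (m < 2)%N -> S u -> hom m u -> u = 0.
Proof.
have S0 f : S f -> hom 0 f -> f = 0.
  move=> Sf /hom0E[a fE]; have [j sj] := special_ex.
  have := minimal_vanishing Sf (coxeter_group1 Phi) sj (oner_neq0 _).
  by rewrite fE pev_cst => ->; rewrite scale0r.
case: m => [_|[_|//]]; first exact: S0.
move=> Su hu.
have y0 i : y_ i u = 0.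
  by apply: S0; [exact: sub_y|exact: (hom_dk Delta c Phi_root _ hu)].
have := sum_xy_hom Delta c Phi_root hu.
rewrite big1 => [|i _]; last by rewrite y0 mulr0.
rewrite KK_hom1// scalerA -scalerBl => /esym/eqP; rewrite scaler_eq0 => /orP[|/eqP//].
rewrite -rmorphM subr_eq0 -(rmorph1 (real_complex R)) eq_sym (inj_eq (@complexI R)).
by rewrite (negbTE ch_neq1).
Qed.

End Ideal.

(** * Gaussian convergence *)

Section Modulus.
Variable R : realType.
Implicit Types (y z : R[i]).

Definition cabs z : R := complex.Re `|z|.

Lemma cabsE z : `|z| = (cabs z)%:C.
Proof. by rewrite /cabs normc_def. Qed.

Lemma cabs_sqr z : complex.Re (`|z| ^+ 2) = cabs z ^+ 2.
Proof. by rewrite cabsE -rmorphXn. Qed.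

Lemma cabs_ge0 z : 0 <= cabs z.
Proof. by rewrite -lecR -cabsE rmorph0. Qed.

Lemma cabsD y z : cabs (y + z) <= cabs y + cabs z.
Proof. by rewrite -lecR rmorphD -!cabsE; exact: ler_normD. Qed.

Lemma cabsM y z : cabs (y * z) = cabs y * cabs z.
Proof. by apply: (@complexI R); rewrite rmorphM -!cabsE normrM. Qed.

Lemma cabs0 : cabs 0 = 0.
Proof. by apply: (@complexI R); rewrite -cabsE normr0. Qed.

Lemma cabs_real (x : R) : cabs x%:C = `|x|.
Proof. by rewrite /cabs normc_def /= expr0n addr0 sqrtr_sqr. Qed.

End Modulus.

Section PolynomialGrowth.
Variables (R : realType) (N : nat).
Local Notation P := (cpoly R N).
Local Notation V := 'rV[R]_N.
Local Notation x_ := (@xvar R N).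
Implicit Types (f : P) (y z : V) (T : R).

(* The factor T in the second bound makes it meaningful in degree 0 too. *)
Lemma homogeneous_growth m f : hom m f -> exists2 A : R, 0 <= A &
  (forall y T, (forall k, `|y 0 k| <= T) -> cabs (pev f y) <= A * T ^+ m) /\
  (forall y z T T', (forall k, `|y 0 k| <= T) -> (forall k, `|z 0 k| <= T) ->
     (forall k, `|y 0 k - z 0 k| <= T') -> 0 <= T -> 0 <= T' ->
     T * cabs (pev f y - pev f z) <= A * T ^+ m * T').
Proof.
move: m f; apply: hom_ind => [a|d|d f g [A A0 [hA1 hA2]] [B B0 [hB1 hB2]]|d a f [A A0 [hA1 hA2]]|d i f _ [A A0 [hA1 hA2]]].
- exists (cabs a); first exact: cabs_ge0.
  split=> [y T _|y z T T' _ _ _ T0 T'0]; rewrite !pev_cst expr0 mulr1//.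
  by rewrite subrr cabs0 mulr0 mulr_ge0// cabs_ge0.
- exists 0 => //; split=> [y T _|y z T T' _ _ _ _ _]; rewrite !pev0 ?cabs0 ?mul0r//.
  by rewrite subrr cabs0 mulr0.
- exists (A + B); first exact: addr_ge0.
  split=> [y T hy|y z T T' hy hz hyz T0 T'0].
    by rewrite pevD mulrDl (le_trans (cabsD _ _))// lerD// ?hA1 ?hB1.
  rewrite !pevD opprD addrACA !mulrDl.
  apply: (le_trans (ler_wpM2l T0 (cabsD _ _))).
  by rewrite mulrDr lerD// ?hA2 ?hB2.
- exists (cabs a * A); first by rewrite mulr_ge0// cabs_ge0.
  split=> [y T hy|y z T T' hy hz hyz T0 T'0].
    by rewrite pevZ cabsM -mulrA ler_wpM2l ?cabs_ge0// hA1.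
  by rewrite !pevZ -mulrBr cabsM mulrCA -!mulrA ler_wpM2l ?cabs_ge0// mulrA hA2.
- exists (2 * A); first by rewrite mulr_ge0.
  split=> [y T hy|y z T T' hy hz hyz T0 T'0].
    have T0 : 0 <= T by apply: le_trans (hy i).
    rewrite pevM pevX cabsM cabs_real exprS mulrCA; apply: ler_pM => //; first exact: cabs_ge0.
    rewrite (le_trans (hA1 _ _ hy))// -mulrA ler_peMl ?mulr_ge0 ?exprn_ge0//.
    by rewrite ler1n.
  have -> : pev (x_ i * f) y - pev (x_ i * f) z =
      (y 0 i)%:C * (pev f y - pev f z) + ((y 0 i - z 0 i)%:C) * pev f z.
    rewrite (pevM _ f y) (pevM _ f z) !pevX rmorphB /=.
    by rewrite mulrBl mulrBr addrA subrK.
  apply: (le_trans (ler_wpM2l T0 (cabsD _ _))); rewrite !cabsM !cabs_real mulrDr.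
  have -> : 2 * A * T ^+ d.+1 * T' = T * (A * T ^+ d * T') + T * (T' * (A * T ^+ d)).
    by rewrite exprS; ring.
  apply: lerD; last by rewrite ler_wpM2l// ler_pM ?cabs_ge0// hA1.
  rewrite mulrCA; apply: ler_pM => //; first by rewrite mulr_ge0// cabs_ge0.
  exact: hA2.
Qed.

End PolynomialGrowth.

(** * Scaling exponents of the weight on a chamber *)

Section ChamberBound.
Variables (R : realType) (N : nat) (I : eqType) (pos : seq I) (k : I -> 'I_N -> R).
Variables (th c : R).
Hypothesis th_ge0 : 0 <= th.
Hypothesis c_ge0 : 0 <= c.
Hypothesis k_ge1 : forall a i, a \in pos -> k a i = 0 \/ 1 <= k a i.
Hypothesis k_neq0 : forall a, a \in pos -> exists i, k a i != 0.
Implicit Types (J : {set 'I_N}) (t : 'I_N -> R).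

Definition supp a : {set 'I_N} := finset (fun i => k a i != 0).
(** The exponent by which prod t_i^th times the weight, over coordinates and roots supported in J,
    scales when the coordinates in J shrink together. If it is nonnegative, the product stays
    bounded there. *)
Definition excess J : R := th * #|J|%:R - 2 * c * (count (fun a => supp a \subset J) pos)%:R.
(** The logarithm of that product; for the full set, of the quotient of the weight by prod
    t_i^(-th). *)
Definition lsum J t := th * \sum_(i in J) ln (t i)
  - 2 * c * \sum_(a <- pos | supp a \subset J) ln (\sum_i k a i * t i).

(** A root involving i has coefficient at least 1 there, so its value on the chamber is at least t
    i; its logarithm enters with a negative sign. *)
Lemma lsum_step J t i : i \in J -> (forall l, 0 < t l) ->
  lsum J t <= lsum (J :\ i) t + (excess J - excess (J :\ i)) * ln (t i).
Proof.
move=> iJ t0; rewrite /lsum /excess (cardsD1 i J) iJ (big_setD1 i)//=.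
have sub a : (supp a \subset J) && (i \notin supp a) = (supp a \subset J :\ i).
  by rewrite subsetD1.
rewrite (bigID (fun a => i \in supp a)) /=.
rewrite [X in 2 * c * (_ + X)](eq_bigl _ _ sub).
have cntE : (count (fun a => supp a \subset J) pos =
    count (fun a => (supp a \subset J) && (i \in supp a)) pos +
    count (fun a => supp a \subset J :\ i) pos)%N.
  rewrite -!sum1_count (bigID (fun a => i \in supp a)) /=; congr (_ + _)%N.
  by apply: eq_bigl => a; rewrite sub.
rewrite cntE !natrD.
set n1 := count _ _; set n2 := count _ _; set S1 := \sum_(_ in _) _; set S2 := \sum_(_ <- _ | _ \subset _ :\ _) _.
set S3 := \sum_(_ <- _ | _) _.
suff h : n1%:R * ln (t i) <= S3.
  have := ler_wpM2l (mulr_ge0 (ler0n R 2) c_ge0) h.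
  rewrite -subr_ge0 => h2; rewrite -subr_ge0.
  by rewrite (_ : _ - _ = 2 * c * S3 - 2 * c * (n1%:R * ln (t i)))//; ring.
rewrite /n1 -sum1_count natr_sum mulr_suml /S3 big_seq_cond [leRHS]big_seq_cond.
apply: ler_sum => a /andP[aP /andP[_ ia]]; rewrite mul1r.
have kge0 l : 0 <= k a l * t l.
  apply: mulr_ge0; last exact: ltW.
  by case: (k_ge1 l aP) => [->//|h]; exact: le_trans ler01 h.
have ki : 1 <= k a i by case: (k_ge1 i aP) => // h; move: ia; rewrite inE h eqxx.
rewrite ler_ln ?posrE//; last first.
  rewrite (bigD1 i)//= ltr_pwDl ?sumr_ge0// mulr_gt0//; exact: lt_le_trans ki.
rewrite (bigD1 i)//= -[leLHS]addr0 lerD ?sumr_ge0//.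
by rewrite ler_peMl// ltW.
Qed.

Lemma lsum0 t : lsum finset.set0 t = 0.
Proof.
rewrite /lsum big_set0 mulr0 big1_seq ?mulr0 ?subrr// => a /andP[h aP].
have [i ki] := k_neq0 aP; move/fintype.subsetP: h => /(_ i); rewrite inE ki => /(_ isT).
by rewrite inE.
Qed.

Lemma excess0 : excess finset.set0 = 0.
Proof.
rewrite /excess cards0 mulr0 (_ : count _ _ = 0%N) ?mulr0 ?subrr//.
apply/eqP; rewrite eqn0Ngt -has_count; apply/hasPn => a aP.
have [i ki] := k_neq0 aP; apply/negP => /fintype.subsetP/(_ i); rewrite inE ki => /(_ isT).
by rewrite inE.
Qed.

(** Remove the coordinates of J in decreasing order. Each step yields a difference of excesses times
    the logarithm of the current maximum, and summation by parts bounds the total because the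
    excesses are nonnegative. *)
Lemma lsum_le J t T : (forall l, 0 < t l) -> (forall J', J' \subset J -> 0 <= excess J') ->
  (forall l, l \in J -> t l <= T) -> lsum J t <= excess J * ln T.
Proof.
move=> t0; elim: {J}_.+1 {-2}J T (ltnSn #|J|) => // n IH J T Jn eJ JT.
have [->|[i0 iJ0]] := set_0Vmem J; first by rewrite lsum0 excess0 mul0r.
case: (@arg_maxP _ _ _ i0 (fun l => l \in J) t iJ0) => i iJ imax.
have T0 : 0 < T by exact: lt_le_trans (JT _ iJ).
have sJ : J :\ i \subset J by exact: subsetDl.
apply: (le_trans (lsum_step iJ t0)).
apply: (@le_trans _ _ (excess (J :\ i) * ln (t i) + (excess J - excess (J :\ i)) * ln (t i))).
  rewrite lerD2r; apply: IH => //.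
  - by move: Jn; rewrite (cardsD1 i) iJ.
  - by move=> J' h; apply: eJ; exact: fintype.subset_trans h sJ.
  - by move=> l; rewrite in_setD1 => /andP[_ /imax].
rewrite -mulrDl addrC subrK ler_wpM2l ?eJ// ler_ln ?posrE//.
exact: JT.
Qed.

(** Taking the largest coordinate itself as bound allows the excess of J to be negative. *)
Lemma lsum_le_top J t i : (forall l, 0 < t l) -> i \in J -> (forall l, l \in J -> t l <= t i) ->
  (forall J', J' \subset J :\ i -> 0 <= excess J') -> lsum J t <= excess J * ln (t i).
Proof.
move=> t0 iJ imax eJ; apply: (le_trans (lsum_step iJ t0)).
have h : lsum (J :\ i) t <= excess (J :\ i) * ln (t i).
  by apply: lsum_le => // l; rewrite in_setD1 => /andP[_ /imax].
by rewrite mulrBl addrCA gerDl subr_le0.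
Qed.

End ChamberBound.

(** * Domination of the Gaussian integrand *)

Section Gaussian.
Variables (R : realType) (N : nat).
Local Notation C := R[i].
Local Notation P := (cpoly R N).
Local Notation V := 'rV[R]_N.
Implicit Types (f g : P) (v y alpha : V).
Variables (Phi : seq V) (Delta : N.-tuple V) (c th : R).
Hypothesis Phi_root : root_system Phi.
Hypothesis Delta_simple : simple_system Phi Delta.
Local Notation Pos := (positive_roots Phi Delta).
Local Notation simple i := (tnth Delta i).
Hypothesis c_gt0 : 0 < c.
Hypothesis th0 : 0 < th.
Hypothesis th1 : th < 1.
Hypothesis N_gt1 : (1 < N)%N.

Variable crd : V -> 'I_N -> R.
Hypothesis crdP : forall alpha, alpha \in Pos -> alpha = \sum_i crd alpha i *: simple i.
Hypothesis crd_ge1 : forall alpha i, alpha \in Pos -> crd alpha i = 0 \/ 1 <= crd alpha i.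
Variable special : pred 'I_N.
Variable om : 'I_N -> V.
Hypothesis om_dual : forall i j, dot (om i) (simple j) = (i == j)%:R.
Local Notation excess := (excess Pos crd th c).
Local Notation lsum := (lsum Pos crd th c).
Hypothesis excess_ge0 : forall J : {set 'I_N}, J != finset.setT ->
  (forall j, special j -> J != finset.setT :\ j) -> 0 <= excess J.
Hypothesis excess_special : forall j, special j -> 0 <= 2 + excess (finset.setT :\ j).
Hypothesis excess_total : 0 <= 4 + excess finset.setT.

Definition gauss f v : R := cabs (pev f v) ^+ 2 * expR (- (dot v v / 2))
  * \prod_(alpha <- Pos) `|dot alpha v| `^ (- (2 * c)).

Lemma gaussian_integrandE f (x : N.-tuple R) :
  gaussian_integrand Phi Delta c f x = gauss f (\row_i tnth x i).
Proof.
rewrite /gaussian_integrand /gauss; congr (_ * _ * _).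
rewrite cabs_sqr /pev /evl (_ : (fun i => (tnth x i)%:C) = fun i => ((\row_i tnth x i) 0 i)%:C)//.
by apply/funext => i; rewrite mxE.
Qed.

Let weight_ge0 v : 0 <= \prod_(alpha <- Pos) `|dot alpha v| `^ (- (2 * c)).
Proof. by apply: prodr_ge0 => alpha _; exact: powR_ge0. Qed.

Lemma gauss_ge0 f v : 0 <= gauss f v.
Proof. by apply: mulr_ge0 (weight_ge0 v); rewrite mulr_ge0 ?sqr_ge0 ?expR_ge0. Qed.

Lemma gaussD f g v : gauss (f + g) v <= 2 * gauss f v + 2 * gauss g v.
Proof.
rewrite /gauss -!(mulrA (_ ^+ 2)); set W := expR _ * _.
have W0 : 0 <= W by rewrite mulr_ge0 ?expR_ge0.
rewrite !(mulrA 2) -mulrDl ler_wpM2r// pevD.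
have := cabsD (pev f v) (pev g v); have := cabs_ge0 (pev f v + pev g v).
have := sqr_ge0 (cabs (pev f v) - cabs (pev g v)).
move: (cabs _) (cabs _) (cabs _) => x y z; nra.
Qed.

Let crd_nz alpha : alpha \in Pos -> exists i, crd alpha i != 0.
Proof.
move=> aP; apply/existsP; apply: contraT; rewrite negb_exists => /forallP h.
have := pos_nonzero Phi_root aP; rewrite (crdP aP) big1 ?eqxx// => i _.
by have := h i; rewrite negbK => /eqP ->; rewrite scale0r.
Qed.

Let dotE alpha y : alpha \in Pos -> dot alpha y = \sum_i crd alpha i * dot y (simple i).
Proof.
move=> aP; rewrite {1}(crdP aP) dot_suml; apply: eq_bigr => i _.
by rewrite dotZl dotC.
Qed.

Let om_coord y : y = \sum_j dot y (simple j) *: om j.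
Proof.
apply: (simple_dot_inj Delta_simple) => i; rewrite dot_suml (bigD1 i)//= dotZl om_dual eqxx mulr1.
by rewrite big1 ?addr0// => j ji; rewrite dotZl om_dual (negbTE ji) mulr0.
Qed.

Let B1 : R := 1 + \sum_j \sum_k `|om j 0 k|.

Let B1_gt0 : 0 < B1.
Proof. by rewrite ltr_wpDr// sumr_ge0// => j _; rewrite sumr_ge0. Qed.

Let coord_bound (p : pred 'I_N) (t : 'I_N -> R) T k : (forall j, p j -> `|t j| <= T) -> 0 <= T ->
  `|(\sum_(j | p j) t j *: om j) 0 k| <= B1 * T.
Proof.
move=> ht T0; rewrite summxE (le_trans (ler_norm_sum _ _ _))//.
apply: (@le_trans _ _ (\sum_j \sum_k `|om j 0 k| * T)).
  rewrite big_mkcond; apply: ler_sum => j _.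
  have h0 : 0 <= \sum_k0 `|om j 0 k0| * T by rewrite sumr_ge0// => l _; rewrite mulr_ge0.
  case: ifP => // pj; rewrite (bigD1 k)//= mxE normrM mulrC -[leLHS]addr0 lerD//.
    by rewrite ler_wpM2l// ht.
  by rewrite sumr_ge0// => l _; rewrite mulr_ge0.
under eq_bigr do rewrite -mulr_suml.
by rewrite -mulr_suml ler_wpM2r// /B1 lerDr.
Qed.

Let sq_exp (x Q a L E : R) : 0 <= x -> x <= Q * expR a -> 2 * a + L <= E ->
  x ^+ 2 * expR L <= Q ^+ 2 * expR E.
Proof.
move=> x0 xQ aE; apply: (@le_trans _ _ ((Q * expR a) ^+ 2 * expR L)).
  by rewrite ler_wpM2r ?expR_ge0// lerXn2r// nnegrE// (le_trans x0).
rewrite exprMn -mulrA ler_wpM2l ?sqr_ge0// -expRM_natl -expRD ler_expR.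
by rewrite mulr_natl -mulr_natl.
Qed.

(** Let t i be the largest coordinate. If i is not special, all sets avoiding i have nonnegative
    excess, and f = O(t_i^m) suffices. If i is special, the complement of i may have excess down to
    -2; f vanishes at t_i om_i, so f = O(t_i^(m-1) t_i') with t_i' the second largest coordinate,
    and the square of t_i' pays for that excess. *)
Lemma chamber_bound m f : vanishing Phi special om f -> hom m f -> (2 <= m)%N ->
  exists2 A : R, 0 <= A & forall y, (forall i, 0 < dot y (simple i)) ->
    exists i, cabs (pev f y) ^+ 2 * expR (lsum finset.setT (fun i => dot y (simple i))) <=
      A * expR ((2 * m%:R + excess finset.setT) * ln (dot y (simple i))).
Proof.
move=> If hf m2; have [A0 A00 [g1 g2]] := homogeneous_growth hf.
pose Q := A0 * B1 ^+ m; exists (Q ^+ 2); first exact: sqr_ge0.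
move=> y t0; set t := fun i => dot y (simple i).
have i0 : 'I_N by exact: Ordinal (ltnW N_gt1).
case: (@arg_maxP _ _ _ i0 xpredT t isT) => i _ imax; exists i.
have imax' l : l \in [set: 'I_N]%SET -> t l <= t i by move=> _; exact: imax.
have Ti : 0 < t i by exact: t0.
have c0 := ltW c_gt0; have kk alpha l : alpha \in Pos -> crd alpha l = 0 \/ 1 <= crd alpha l.
  by move=> aP; exact: crd_ge1.
have hy k : `|y 0 k| <= B1 * t i.
  rewrite {1}[y]om_coord; apply: coord_bound; last exact: ltW.
  by move=> j _; rewrite ger0_norm; [exact: imax|exact: ltW (t0 j)].
have TE n : t i ^+ n = expR (n%:R * ln (t i)) by rewrite expRM_natl lnK// posrE.
have [si|nsi] := boolP (special i); last first.
  apply: (@sq_exp _ _ (m%:R * ln (t i))); first exact: cabs_ge0.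
    by rewrite -TE /Q -mulrA -exprMn; exact: g1.
  rewrite [leRHS]mulrDl -(mulrA 2) lerD2l.
  apply: (lsum_le_top c0 kk crd_nz t0 (finset.in_setT i) imax') => J' sJ; apply: excess_ge0.
    by apply: contraTneq sJ => ->; apply/negP => /fintype.subsetP/(_ i); rewrite !inE eqxx => /(_ isT).
  move=> j sj; apply: contraTneq sJ => ->.
  apply/negP => /fintype.subsetP/(_ i); rewrite !inE eqxx /= => h.
  have ij : i != j by apply: contraNneq nsi => ->.
  by move: h; rewrite ij => /(_ isT).
have [l0 l0i] : exists l, l != i.
  pose j0 := Ordinal (ltnW N_gt1); pose j1 := Ordinal N_gt1.
  have [h|] := eqVneq j0 i; last by exists j0.
  by exists j1; rewrite -h.
case: (@arg_maxP _ _ _ l0 (fun l => l != i) t l0i) => i' ii' imax2.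
have Ti' : 0 < t i' by exact: t0.
have T'T : ln (t i') <= ln (t i) by rewrite ler_ln ?posrE//; exact: imax.
pose z := t i *: om i.
have fz : pev f z = 0.
  have := If 1%:M i (t i) (coxeter_group1 Phi) si; rewrite mulmx1; apply.
  by rewrite gt_eqF.
have hz k : `|z 0 k| <= B1 * t i.
  rewrite /z -[t i *: om i](big_pred1_eq +%R i (fun j => t j *: om j)).
  apply: coord_bound; last exact: ltW.
  by move=> j /eqP ->; rewrite ger0_norm// ltW.
have hyz k : `|y 0 k - z 0 k| <= B1 * t i'.
  have -> : y 0 k - z 0 k = (\sum_(j | j != i) t j *: om j) 0 k.
    have yE : y = z + \sum_(j | j != i) t j *: om j by rewrite {1}[y]om_coord (bigD1 i).
    by rewrite [in LHS]yE [(z + _) 0 k]mxE; move: (z 0 k) => zk; rewrite addrAC subrr add0r.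
  apply: coord_bound; last exact: ltW.
  by move=> j ji; rewrite ger0_norm; [exact: imax2|exact: ltW (t0 j)].
have BT : 0 < B1 * t i by rewrite mulr_gt0.
have BT' : 0 <= B1 * t i' by rewrite mulr_ge0// ltW.
have := g2 y z _ _ hy hz hyz (ltW BT) BT'; rewrite fz subr0 => hg.
have mE : m = m.-1.+1 by rewrite prednK// ltnW.
have m1 : m%:R = m.-1%:R + 1 :> R by rewrite {1}mE -natr1.
have Lb : lsum finset.setT t <= excess (finset.setT :\ i) * ln (t i') +
    (excess finset.setT - excess (finset.setT :\ i)) * ln (t i).
  apply: (le_trans (lsum_step th c0 kk (finset.in_setT i) t0)); rewrite lerD2r.
  apply: (lsum_le_top c0 kk crd_nz t0) => [|l|J' sJ].
  - by rewrite !inE ii'.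
  - by rewrite !inE andbT => /imax2.
  - apply: excess_ge0 => [|j _]; apply: contraTneq sJ => ->.
      by apply/negP => /fintype.subsetP/(_ i'); rewrite !inE eqxx => /(_ isT).
    apply/negP => /fintype.subsetP h; have [ij|ij] := eqVneq i j.
      by have := h i'; rewrite -ij !inE ii' eqxx => /(_ isT).
    by have := h i; rewrite !inE ij eqxx andbF => /(_ isT).
apply: (@sq_exp _ _ (m.-1%:R * ln (t i) + ln (t i'))); first exact: cabs_ge0.
  rewrite expRD -TE lnK ?posrE// -(ler_pM2l BT); apply: (le_trans hg).
  rewrite le_eqVlt; apply/orP; left; apply/eqP; rewrite /Q exprMn [in t i ^+ m]mE exprS.
  by ring.
(* The exponent collected by t i' is 2 plus the excess of the complement of i, which is nonnegative,
   so t i' may be replaced by t i. *)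
have := ler_wpM2l (excess_special si) T'T.
rewrite m1; move: Lb; set D := excess _; set D' := excess _; set L := lsum _ _.
move: (ln _) (ln _) => a b; lra.
Qed.

(** The logarithm is below the linear form (y, alpha), which is at most a small multiple of (y, y)
    plus a constant, by expanding a square. *)
Let ln_dominated E alpha : 0 <= E -> exists B : R, forall y, 0 < dot y alpha ->
  E * ln (dot y alpha) <= dot y y / 4 + B.
Proof.
move=> E0; exists (E * (E + 1) * dot alpha alpha) => y t0.
have E1 : 0 < E + 1 by rewrite ltr_wpDl.
apply: (@le_trans _ _ (E * dot y alpha)); first by rewrite ler_wpM2l// ltW// ln_sublinear.
(* Chosen so that the coefficient E e / 2 of (y, y) is at most 1 / 4. *)
pose e := (2 * (E + 1))^-1.
have e0 : 0 < e by rewrite invr_gt0 mulr_gt0.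
have := dot_ge0 (e *: y - alpha).
rewrite !(dotBl, dotBr, dotZl, dotZr) [dot alpha y]dotC => h.
have {}h : dot y alpha <= e / 2 * dot y y + (2 * e)^-1 * dot alpha alpha.
  rewrite -(ler_pM2l (mulr_gt0 (ltr0n R 2) e0)).
  have -> : 2 * e * (e / 2 * dot y y + (2 * e)^-1 * dot alpha alpha) = e * (e * dot y y) + dot alpha alpha.
    by rewrite mulrDr [X in _ + X]mulrA divff ?gt_eqF ?mulr_gt0// mul1r; congr (_ + _); field.
  by lra.
apply: (le_trans (ler_wpM2l E0 h)); rewrite mulrDr lerD//.
  rewrite mulrA mulrC ler_wpM2l ?dot_ge0//.
  have : E * e <= 2^-1.
    by rewrite /e ler_pdivrMr ?mulr_gt0// mulrA mulVf// mul1r lerDl.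
  by lra.
rewrite mulrA ler_wpM2r ?dot_ge0// ler_wpM2l//.
by rewrite /e le_eqVlt; apply/orP; left; apply/eqP; field; rewrite gt_eqF.
Qed.

(** Half of the Gaussian absorbs the power of the largest coordinate left by [chamber_bound], whose
    exponent is nonnegative because m is at least 2. *)
Lemma chamber_gauss m f : vanishing Phi special om f -> hom m f -> (2 <= m)%N ->
  exists2 A : R, 0 <= A & forall y, (forall i, 0 < dot y (simple i)) ->
    gauss f y <= A * ((\prod_i `|dot y (simple i)| `^ (- th)) * expR (- (dot y y / 4))).
Proof.
move=> If hf m2; have [A A0 hA] := chamber_bound If hf m2.
pose E := 2 * m%:R + excess finset.setT.
have E0 : 0 <= E.
  apply: (le_trans excess_total); rewrite /E lerD2r -natrM ler_nat.
  by rewrite (@leq_mul 2 2 2).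
have /choice[B hB] : forall i, exists B : R, forall y, 0 < dot y (simple i) ->
  E * ln (dot y (simple i)) <= dot y y / 4 + B by move=> i; exact: ln_dominated.
pose B' := \sum_i `|B i|.
exists (A * expR B'); first by rewrite mulr_ge0 ?expR_ge0.
move=> y t0; have [i hi] := hA y t0.
pose t i := dot y (simple i).
have wE : \prod_(alpha <- Pos) `|dot alpha y| `^ (- (2 * c)) =
    expR (- (2 * c * \sum_(alpha <- Pos) ln (\sum_i crd alpha i * t i))).
  rewrite -[in RHS]mulNr mulr_sumr expR_sum; apply: eq_big_seq => alpha aP.
  rewrite dotE// ger0_norm; last first.
    apply: sumr_ge0 => l _; apply: mulr_ge0; last exact: ltW (t0 l).
    by case: (crd_ge1 l aP) => [->//|h]; exact: le_trans ler01 h.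
  rewrite /powR gt_eqF//.
  have [l kl] := crd_nz aP; rewrite (bigD1 l)//= ltr_pwDl//.
    case: (crd_ge1 l aP) => [h|h]; first by rewrite h eqxx in kl.
    by rewrite mulr_gt0 ?t0// (lt_le_trans ltr01 h).
  apply: sumr_ge0 => l' _; apply: mulr_ge0; last exact: ltW (t0 l').
  by case: (crd_ge1 l' aP) => [->//|h]; exact: le_trans ler01 h.
have pE : \prod_i `|dot y (simple i)| `^ (- th) = expR (- (th * \sum_i ln (t i))).
  rewrite -[in RHS]mulNr mulr_sumr expR_sum; apply: eq_bigr => l _.
  by rewrite ger0_norm ?ltW ?t0// /powR gt_eqF ?t0.
have LE : lsum finset.setT t = th * \sum_i ln (t i)
    - 2 * c * \sum_(alpha <- Pos) ln (\sum_i crd alpha i * t i).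
  congr (_ * _ - _ * _); first by apply: eq_bigl => l; rewrite inE.
  by apply: eq_bigl => l; rewrite finset.subsetT.
rewrite /gauss wE pE.
have -> : cabs (pev f y) ^+ 2 * expR (- (dot y y / 2)) *
   expR (- (2 * c * \sum_(alpha <- Pos) ln (\sum_i crd alpha i * t i))) =
   cabs (pev f y) ^+ 2 * expR (lsum finset.setT t) * expR (- (dot y y / 2) - th * \sum_i ln (t i)).
  rewrite LE; move: (_ ^+ 2) (\sum_(alpha <- Pos) _) (\sum_i _) (dot y y / 2) => X S1 S2 d.
  rewrite -(mulrA X) -(mulrA X) -!expRD; congr (_ * _); congr expR.
  by lra.
apply: (le_trans (ler_wpM2r (expR_ge0 _) hi)).
rewrite -!mulrA ler_wpM2l// -!expRD ler_expR.
have := hB i y (t0 i); have : B i <= B'.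
  by rewrite /B' (bigD1 i)//= (le_trans (ler_norm _))// lerDl sumr_ge0.
rewrite -/E; lra.
Qed.

Lemma gauss_lsub w f v : coxeter_group Phi w ->
  gauss (lsub w^T f) (v *m w) = gauss f v.
Proof.
move=> Ww; have wT := coxeter_orth Phi_root Ww.
rewrite /gauss pev_lsub -mulmxA wT mulmx1 orth_dot//; congr (_ * _).
rewrite -(big_pos_perm Phi_root Delta_simple _ wT).
- by apply: eq_bigr => alpha _; rewrite orth_dot.
- by move=> alpha; exact: coxeter_root.
- by move=> alpha _; rewrite dotNl normrN.
Qed.

(** [powR] gives 0 to a nonzero power of 0, so the integrand is 0 on walls and only open chambers
    remain to be bounded. *)
Lemma gauss_wall f v i : dot v (simple i) = 0 -> gauss f v = 0.
Proof.
move=> h; rewrite /gauss (perm_big _ (perm_to_rem (simple_pos Delta_simple i))) big_cons.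
have c2 : - (2 * c) != 0 by rewrite oppr_eq0 gt_eqF// mulr_gt0.
by rewrite [dot (simple i) v]dotC h normr0 (powR0 c2) /= mul0r mulr0.
Qed.

Lemma vanishing_lsub w f : coxeter_group Phi w -> vanishing Phi special om f ->
  vanishing Phi special om (lsub w^T f).
Proof.
move=> Ww If w' j s Ww' sj s0; rewrite pev_lsub -scalemxAl -mulmxA If//.
by apply: coxeter_mul => //; exact: coxeter_tr.
Qed.

(** A chamber is recorded by the roots that its simple roots become. The N-tuples of roots that
    separate points include all chambers, without listing the group. *)
Let idx := {ffun 'I_N -> 'I_(size Phi)}.
Let root (s : idx) i : V := nth 0 Phi (s i).
Let base (s : idx) : 'I_N -> 'I_N -> R := fun i k => root s i 0 k.

Definition dominated f := exists2 A : R, 0 <= A & forall x : N.-tuple R,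
  ((gaussian_integrand Phi Delta c f x)%:E <=
   A%:E * \sum_(s : idx | `[< separating (base s) >]) psi_gau th (base s) x)%E.

Lemma dominated_hom m f : vanishing Phi special om f -> hom m f -> (2 <= m)%N -> dominated f.
Proof.
move=> If hf m2.
have bound (s : idx) : exists A : R, 0 <= A /\ forall w v, coxeter_group Phi w ->
    (forall i, root s i = simple i *m w^T) -> (forall i, 0 < dot (v *m w) (simple i)) ->
    gauss f v <= A * ((\prod_i `|dot v (root s i)| `^ (- th)) * expR (- (dot v v / 4))).
  have [[w [Ww ws]]|nw] := pselect (exists w, coxeter_group Phi w /\
      forall i, root s i = simple i *m w^T); last first.
    by exists 0; split=> // w v Ww ws; case: nw; exists w.
  have [A A0 hA] := chamber_gauss (vanishing_lsub Ww If) (hom_lsub w^T hf) m2.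
  exists A; split=> // w' v Ww' ws' t0.
  (* The tuple of roots determines the group element, so the bound found for w serves for w'. *)
  have ww (x : V) : x *m w' = x *m w.
    apply: (simple_dot_inj Delta_simple) => i.
    by rewrite !dot_mul -ws -ws'.
  have := hA (v *m w); rewrite gauss_lsub// orth_dot ?(coxeter_orth Phi_root Ww)// -ww => /(_ t0).
  rewrite (eq_bigr (fun i => `|dot v (root s i)| `^ (- th)))// => i _.
  by rewrite dot_mul -ws'.
have /choice[A hA] := bound.
have A0 s : 0 <= A s by case: (hA s).
exists (\sum_s A s); first by rewrite sumr_ge0.
move=> x; rewrite gaussian_integrandE; set v : V := \row_i tnth x i.
have S0 : (0 <= \sum_(s : idx | `[< separating (base s) >]) psi_gau th (base s) x)%E.
  by apply: sume_ge0 => s _; exact: psi_gau_ge0.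
have [w Ww dom] := dominant Phi_root Delta_simple v.
have [|nwall] := pselect (exists i, dot (v *m w) (simple i) = 0).
  move=> [i hi]; rewrite -(gauss_lsub f v Ww) (gauss_wall _ hi) mule_ge0//.
  by rewrite lee_fin sumr_ge0.
have t0 i : 0 < dot (v *m w) (simple i).
  by rewrite lt_neqAle dom andbT eq_sym; apply/eqP => h; apply: nwall; exists i.
have sP i : (index (simple i *m w^T) Phi < size Phi)%N.
  by rewrite index_mem coxeter_rootT//; exact: simpleP.
pose s : idx := [ffun i => Ordinal (sP i)].
have ws i : root s i = simple i *m w^T.
  by rewrite /root ffunE nth_index// -index_mem.
have tE i : dot v (root s i) = tform (base s i) x.
  by rewrite dotC /tform /dot /base; apply: eq_bigr => k _; rewrite mxE.
have sep : separating (base s).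
  move=> y hy k; pose yv : V := \row_k y k.
  have yw : yv *m w = 0.
    apply: (simple_dot_inj Delta_simple) => i; rewrite dot0l dot_mul -ws -[RHS](hy i).
    by rewrite dotC /dot; apply: eq_bigr => l _; rewrite mxE.
  have : yv = 0.
    by rewrite -[yv]mulmx1 -(coxeter_orth Phi_root Ww) mulmxA yw mul0mx.
  by move/rowP/(_ k); rewrite !mxE.
have [_ /(_ w v Ww ws t0) h] := hA s.
apply: (@le_trans _ _ ((A s)%:E * psi_gau th (base s) x)%E); last first.
  apply: lee_pmul => //.
  - by rewrite lee_fin.
  - exact: psi_gau_ge0.
  - by rewrite lee_fin (bigD1 s)//= lerDl sumr_ge0.
  rewrite (bigD1 s)/=; last exact/asboolP.
  by rewrite leeDl// sume_ge0// => s' _; exact: psi_gau_ge0.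
apply: (@le_trans _ _ ((A s * ((\prod_i `|dot v (root s i)| `^ (- th)) * expR (- (dot v v / 4))))%:E)).
  by rewrite lee_fin.
rewrite EFinM lee_wpmul2l ?lee_fin// /psi_gau EFinM; apply: lee_pmul.
- by rewrite lee_fin prodr_ge0// => i _; exact: powR_ge0.
- by rewrite lee_fin expR_ge0.
- rewrite -prodEFin; apply: lee_prode => i; first by rewrite lee_fin powR_ge0.
  by rewrite tE; exact: psi_lb.
- rewrite prodEFin lee_fin /gau -expR_sum ler_expR /dot mulr_suml -sumrN.
  by apply: ler_sum => k _; rewrite mxE -expr2 mulNr.
Qed.

Lemma dominatedD f g : dominated f -> dominated g -> dominated (f + g).
Proof.
move=> [A A0 hA] [B B0 hB]; exists (2 * A + 2 * B); first by rewrite addr_ge0// mulr_ge0.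
move=> x; have S0 : (0 <= \sum_(s : idx | `[< separating (base s) >]) psi_gau th (base s) x)%E.
  by apply: sume_ge0 => s _; exact: psi_gau_ge0.
apply: (@le_trans _ _ ((2 * gaussian_integrand Phi Delta c f x + 2 * gaussian_integrand Phi Delta c g x)%:E)).
  by rewrite lee_fin !gaussian_integrandE gaussD.
move: (hA x) (hB x); move: (gaussian_integrand _ _ _ f x) (gaussian_integrand _ _ _ g x) => F G hF hG.
rewrite !EFinD ge0_muleDl ?lee_fin ?mulr_ge0// !EFinM -!muleA.
by apply: leeD; apply: lee_wpmul2l; rewrite ?lee_fin.
Qed.

Lemma dominated0 : dominated 0.
Proof.
exists 0 => // x; rewrite mul0e gaussian_integrandE /gauss pev0 cabs0 expr0n /= !mul0r.
by [].
Qed.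

Lemma dominated_integral f : dominated f ->
  (\int[lebesgueN R N]_x (gaussian_integrand Phi Delta c f x)%:E < +oo)%E.
Proof.
move=> [A A0 hA].
pose Psi s := psi_gau th (base s) : N.-tuple (measurableTypeR R) -> \bar R.
have P0 s x : (0 <= Psi s x)%E by exact: psi_gau_ge0.
have mP s : measurable_fun setT (Psi s) by exact: measurable_psi_gau.
pose r := [seq s <- index_enum idx | `[< separating (base s) >]].
pose F := (fun x : N.-tuple (measurableTypeR R) => A%:E * \sum_(s <- r) Psi s x)%E.
have F0 x : (0 <= F x)%E by rewrite mule_ge0 ?lee_fin// sume_ge0.
have f0 x : (0 <= (gaussian_integrand Phi Delta c f x)%:E)%E.
  by rewrite lee_fin gaussian_integrandE gauss_ge0.
apply: (@le_lt_trans _ _ (\int[lebesgueN R N]_x F x)%E).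
  (* Monotonicity is read off the integral of a nonnegative function as a supremum over the simple
     functions below it. *)
  rewrite !ge0_integralTE//; apply: le_ereal_sup => _ [h hh <-]; exists h => // x.
  by apply: (le_trans (hh x)); apply: (le_trans (hA x)); rewrite /F big_filter.
rewrite /F ge0_integralZl//; last 2 first.
  by apply: emeasurable_sum.
  by move=> x _; rewrite sume_ge0.
rewrite ge0_integral_sum//; apply: lte_mul_pinfty => //.
rewrite big_seq; apply: lte_sum_pinfty => s; rewrite mem_filter => /andP[/asboolP h _].
exact: integral_psi_gau_tuple.
Qed.

Hypothesis special_sum : forall j i, special j -> i != j ->
  \sum_(alpha <- Pos | dot alpha (om j) == 0) cox alpha (simple i) *: alpha
  = c^-1 *: simple i.
Hypothesis special_ex : exists j, special j.
Variable h : R.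
Hypothesis total_sum : forall i,
  \sum_(alpha <- Pos) cox alpha (simple i) *: alpha = h *: simple i.
Hypothesis ch_neq1 : c * h != 1.
Variable S : set P.
Hypothesis S_min : minimal_submodule Phi Delta c S.

Theorem gaussian_converges_minimal : gaussian_converges Phi Delta c S.
Proof.
have S_sub : submodule Phi Delta c S by case: S_min => -[[]].
have c0 : c != 0 by rewrite gt_eqF.
move=> f Sf; apply: dominated_integral; rewrite [f]comp_hom_sum.
apply: big_ind; [exact: dominated0|exact: dominatedD|move=> d _].
have Sd : S (comp_hom d f) by exact: (sub_comp_hom Phi_root S_sub).
have hd := comp_homP d f.
case: (ltnP d 2) => d2.
  by rewrite (minimal_low Phi_root Delta_simple om_dual c0 special_sum S_min N_gt1 special_ex total_sum ch_neq1 d2 Sd hd); exact: dominated0.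
apply: dominated_hom hd d2.
exact: (minimal_vanishing Phi_root Delta_simple om_dual c0 special_sum S_min N_gt1 Sd).
Qed.

End Gaussian.

(** * Root lists *)

Section GoldenIntegers.

(* (a, b) stands for a + b phi, where phi = 2 cos (pi / 5). *)
Definition zp := (Z * Z)%type.
Definition z0 : zp := (Z0, Z0).
Definition z1 : zp := (Zpos 1, Z0).
Definition zadd (x y : zp) : zp := (Z.add x.1 y.1, Z.add x.2 y.2).
Definition zopp (x : zp) : zp := (Z.opp x.1, Z.opp x.2).
Definition zmul (x y : zp) : zp :=
  let bd := Z.mul x.2 y.2 in
  (Z.add (Z.mul x.1 y.1) bd, Z.add (Z.add (Z.mul x.1 y.2) (Z.mul x.2 y.1)) bd).
Definition zsum (s : seq zp) : zp := foldr zadd z0 s.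
Definition zpos (x : zp) : bool := Z.leb Z0 x.1 && Z.leb Z0 x.2.

Variable R : realType.
Local Notation toR a := ((int_of_Z a)%:~R : R).

Definition phi : R := 2 * cos (pi / 5).

Lemma phi_gt0 : 0 < phi.
Proof.
rewrite /phi mulr_gt0// cos_gt0_pihalf//; have := pi_gt0 R; lra.
Qed.

Let cos3 (x : R) : cos (x *+ 3) = 4 * cos x ^+ 3 - 3 * cos x.
Proof.
rewrite mulrS cosD cos_mulr2n sin_mulr2n !mulr2n.
have -> : sin x * (cos x * sin x + cos x * sin x) = 2 * cos x * sin x ^+ 2 by ring.
by rewrite sin2cos2; ring.
Qed.

(** At x = pi / 5 one has cos 3x = - cos 2x, a cubic equation in cos x whose spurious factor cos x +
    1 is positive. *)
Lemma phi_sqr : phi ^+ 2 = phi + 1.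
Proof.
have h : cos ((pi / 5 : R) *+ 3) = - cos ((pi / 5) *+ 2).
  have -> : (pi / 5 : R) *+ 3 = - ((pi / 5) *+ 2) + pi by rewrite mulrS mulr2n; field.
  by rewrite cosDpi cosN.
move: h phi_gt0; rewrite cos3 cos_mulr2n mulr2n /phi; set x := cos _ => h x0.
have : (x + 1) * (4 * x ^+ 2 - 2 * x - 1) = 0.
  have -> : (x + 1) * (4 * x ^+ 2 - 2 * x - 1) = (4 * x ^+ 3 - 3 * x) + (x ^+ 2 + x ^+ 2 - 1) by ring.
  by rewrite h addNr.
move/eqP; rewrite mulf_eq0 => /orP[/eqP|/eqP]; nra.
Qed.

Lemma cos_pi3 : cos (pi / 3) = 2^-1 :> R.
Proof.
have h : cos ((pi / 3 : R) *+ 3) = -1.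
  by rewrite (_ : _ *+ 3 = pi) ?cospi// mulrS mulr2n; field.
have x0 : 0 < cos (pi / 3 : R).
  by rewrite cos_gt0_pihalf//; have := pi_gt0 R; lra.
move: h x0; rewrite cos3; set x := cos _ => h x0.
have : (x + 1) * (2 * x - 1) ^+ 2 = 0.
  have -> : (x + 1) * (2 * x - 1) ^+ 2 = (4 * x ^+ 3 - 3 * x) + 1 by ring.
  by rewrite h addNr.
by move/eqP; rewrite mulf_eq0 sqrf_eq0 => /orP[/eqP|/eqP]; lra.
Qed.

Lemma phi_ge1 : 1 <= phi.
Proof. have := phi_gt0; have := phi_sqr; rewrite expr2; nra. Qed.

Definition zval (x : zp) : R := toR x.1 + toR x.2 * phi.

Let toRD a b : toR (Z.add a b) = toR a + toR b.
Proof. by rewrite -intrD -(rmorphD int_of_Z). Qed.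

Let toRM a b : toR (Z.mul a b) = toR a * toR b.
Proof. by rewrite -intrM -(rmorphM int_of_Z). Qed.

Let toRN a : toR (Z.opp a) = - toR a.
Proof. by rewrite -mulrNz -(rmorphN int_of_Z). Qed.

Lemma zval0 : zval z0 = 0.
Proof. by rewrite /zval mul0r addr0. Qed.

Lemma zval1 : zval z1 = 1.
Proof. by rewrite /zval mul0r addr0. Qed.

Lemma zvalD x y : zval (zadd x y) = zval x + zval y.
Proof. by rewrite /zval /zadd /= !toRD; ring. Qed.

Lemma zvalN x : zval (zopp x) = - zval x.
Proof. by rewrite /zval /zopp /= !toRN; ring. Qed.

Lemma zvalM x y : zval (zmul x y) = zval x * zval y.
Proof.
rewrite /zval /zmul /= !(toRD, toRM).
have := phi_sqr; move: (toR x.1) (toR x.2) (toR y.1) (toR y.2) => a b c d h.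
have -> : (a + b * phi) * (c + d * phi) = a * c + (a * d + b * c) * phi + b * d * phi ^+ 2 by ring.
by rewrite h; ring.
Qed.

Lemma zval_sum s : zval (zsum s) = \sum_(x <- s) zval x.
Proof.
by elim: s => [|x s IH]; rewrite ?big_nil ?zval0// big_cons /= zvalD IH.
Qed.

Lemma zval_iota n (f : nat -> zp) :
  zval (zsum [seq f i | i <- iota 0 n]) = \sum_(i < n) zval (f i).
Proof. by rewrite zval_sum big_map -(big_mkord xpredT (fun i => zval (f i))) /index_iota subn0. Qed.

Let toR_ge0 a : Z.leb Z0 a -> 0 <= toR a.
Proof. by move=> h; rewrite ler0z; lia. Qed.

Let toR_inj : injective (fun a => toR a).
Proof. by move=> a b /intr_inj/(can_inj int_of_ZK). Qed.

Lemma zpos_ge1 x : zpos x -> x = z0 \/ 1 <= zval x.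
Proof.
case: x => a b /andP[/= ha hb]; have [->|a0] := Z.eq_dec a Z0.
  have [->|b0] := Z.eq_dec b Z0; first by left.
  right; rewrite /zval/= add0r.
  have h : 1 <= toR b by rewrite ler1z; lia.
  by apply: (le_trans phi_ge1); rewrite ler_peMl// ltW// phi_gt0.
right; rewrite /zval/=.
have h : 1 <= toR a by rewrite ler1z; lia.
by rewrite -[leLHS]addr0 lerD// mulr_ge0 ?toR_ge0// ltW// phi_gt0.
Qed.

(* a^2 + a b - b^2 is the norm of a + b phi; it is anisotropic by descent at 2. *)
Let norm_eq0 (a b : Z) : Z.sub (Z.add (Z.mul a a) (Z.mul a b)) (Z.mul b b) = Z0 -> a = Z0 /\ b = Z0.
Proof.
move: {2}(Z.to_nat _) (leqnn (Z.to_nat (Z.add (Z.abs a) (Z.abs b)))) => n.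
elim: n a b => [|n IH] a b hn hab; first by split; lia.
have [a0|a0] := Z.eq_dec a Z0; first by subst a; nia.
have [b0|b0] := Z.eq_dec b Z0; first by subst b; nia.
case: (Z.Even_or_Odd a) (Z.Even_or_Odd b) => -[a' aE] [] [b' bE]; subst a b; try lia.
have [||] := IH a' b'; try lia.
Qed.

(** If a + b phi = 0 then the norm a^2 + a b - b^2 vanishes, hence a = b = 0. Equality of real
    coordinates is thus decided on integers. *)
Lemma zval_inj : injective zval.
Proof.
suff h x : zval x = 0 -> x = z0.
  move=> x y xy; have := h (zadd x (zopp y)); rewrite zvalD zvalN xy subrr => /(_ erefl).
  case: x y {xy} => a b [c d] [/= h1 h2]; congr pair; lia.
case: x => a b; rewrite /zval/= => h1.
have : toR a * toR a + toR a * toR b - toR b * toR b = 0.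
  have := phi_sqr; have -> : toR a = - (toR b * phi) by apply/eqP; rewrite -addr_eq0; apply/eqP.
  move: (toR b) => t h2; have -> : - (t * phi) * - (t * phi) = t * t * phi ^+ 2 by ring.
  by rewrite h2; ring.
rewrite -!toRM -toRD -toRN -toRD -[0]/(toR Z0) => /toR_inj h2.
by have [-> ->] := @norm_eq0 a b h2.
Qed.

End GoldenIntegers.

(* A root is the list of its coordinates in the simple roots, and             *)
(* C i j = 2 (a_i, a_j) / (a_i, a_i).                                         *)
Section RootLists.
Variables (n : nat) (C : seq (seq zp)).
Implicit Types (x y : seq zp).

Definition cm i j : zp := nth z0 (nth [::] C i) j.
Definition cxn x i : zp := zsum [seq zmul (nth z0 x k) (cm k i) | k <- iota 0 n].
Definition srefl j x : seq zp :=
  let c := zopp (cxn x j) in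
  [seq if i == j then zadd (nth z0 x i) c else nth z0 x i | i <- iota 0 n].
Definition evec j : seq zp := [seq if i == j then z1 else z0 | i <- iota 0 n].

(** Breadth-first closure under simple reflections. Whether the fuel sufficed is settled afterwards
    by [closed_check]. *)
Fixpoint grow fuel front acc : seq (seq zp) :=
  if fuel is fuel'.+1 then
    let new := undup [seq y <- [seq srefl j x | x <- front, j <- iota 0 n] |
                      all zpos y && (y \notin acc)] in
    grow fuel' new (acc ++ new)
  else acc.

Definition roots fuel := let s := [seq evec j | j <- iota 0 n] in grow fuel s s.

(** The only exception to closure is the sign change of a simple root under its own reflection; by
    [pos_vec] the list then contains every positive root. *)
Definition closed_check X := uniq X && all (fun x =>
  all (fun j => (x == evec j) || (srefl j x \in X)) (iota 0 n)) X &&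
  all (fun j => evec j \in X) (iota 0 n).

Definition sum_check X (sel : pred (seq zp)) h i := let Y := [seq x <- X | sel x] in
  all (fun k => zsum [seq zmul (cxn x i) (nth z0 x k) | x <- Y] == if k == i then h else z0)
    (iota 0 n).

(** The fourth-moment identity of a spherical 4-design on quadruples of simple roots; [W] and [W']
    share partial products between quadruples. *)
Definition design_check X q :=
  let T := [seq [seq cxn x i | i <- iota 0 n] | x <- X] in
  all (fun i => all (fun j => let W := [seq (zmul (nth z0 t i) (nth z0 t j), t) | t <- T] in
    all (fun k => let W' := [seq (zmul p.1 (nth z0 p.2 k), p.2) | p <- W] in all (fun l =>
      zsum [seq zmul p.1 (nth z0 p.2 l) | p <- W'] ==
      zmul q (zadd (zmul (cm i j) (cm k l)) (zadd (zmul (cm i k) (cm j l)) (zmul (cm i l) (cm j k)))))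
      (iota 0 n)) (iota 0 n)) (iota 0 n)) (iota 0 n).

Definition cox_check X := all (fun x => let cs := [seq cxn x i | i <- iota 0 n] in
  all (fun y => let c := zsum [seq zmul (nth z0 y i) (nth z0 cs i) | i <- iota 0 n] in
    [|| c == z0, c == z1, c == zopp z1 | (c == zadd z1 z1) && (x == y)]) X) X.

Definition supp_in x (m : seq bool) := all (fun i => nth false m i || (nth z0 x i == z0)) (iota 0 n).

Fixpoint masks k : seq (seq bool) :=
  if k is k'.+1 then [seq true :: m | m <- masks k'] ++ [seq false :: m | m <- masks k'] else [:: [::]].

(** [excess] is nonnegative when the number of roots per node is at most th / (2 c), and p / q
    stands for a value below this threshold. The full set and the complements of special nodes are
    the exceptions that vanishing of f compensates. *)
Definition count_check X (p q : nat) (special : seq nat) :=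
  all (fun m => [|| all id m,
    has (fun j => m == [seq i != j | i <- iota 0 n]) special |
    (q * count (supp_in^~ m) X <= p * count id m)%N]) (masks n).

End RootLists.

(** * The computed list is the positive system *)

Section RootListModel.
Variables (R : realType) (n : nat).
Local Notation V := 'rV[R]_n.
Variables (Phi : seq V) (Delta : n.-tuple V).
Hypothesis Phi_root : root_system Phi.
Hypothesis Delta_simple : simple_system Phi Delta.
Local Notation Pos := (positive_roots Phi Delta).
Local Notation simple i := (tnth Delta i).
Local Notation zval := (@zval R).
Variables (C : seq (seq zp)) (L : R).
Hypothesis L_gt0 : 0 < L.
Hypothesis dot_simple : forall i j : 'I_n, dot (simple i) (simple j) = L / 2 * zval (cm C i j).
Hypothesis dot_self : forall i : 'I_n, dot (simple i) (simple i) = L.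
Implicit Types (x y : seq zp) (alpha : V).

Definition root_vec x : V := \sum_(i < n) zval (nth z0 x i) *: simple i.

Let L_neq0 : L != 0. Proof. by rewrite gt_eqF. Qed.

Lemma dot_vec_simple x (i : 'I_n) : dot (root_vec x) (simple i) = L / 2 * zval (cxn n C x i).
Proof.
rewrite /root_vec dot_suml zval_iota mulr_sumr; apply: eq_bigr => k _.
by rewrite dotZl dot_simple zvalM mulrCA.
Qed.

Lemma vec_srefl x (j : 'I_n) : root_vec (srefl n C j x) = root_vec x *m reflection (simple j).
Proof.
rewrite reflectE /cox dotC dot_vec_simple dot_self.
have -> : 2 * (L / 2 * zval (cxn n C x j)) / L = zval (cxn n C x j) by field.
rewrite /root_vec (bigD1 j)//= [X in _ = X - _](bigD1 j)//= /srefl.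
rewrite (nth_map 0%N) ?size_iota// nth_iota// add0n eqxx zvalD zvalN scalerBl addrAC.
congr (_ + _ - _); apply: eq_bigr => i ij.
by rewrite (nth_map 0%N) ?size_iota// nth_iota// add0n ifN.
Qed.

Lemma vec_evec (j : 'I_n) : root_vec (evec n j) = simple j.
Proof.
rewrite /root_vec (bigD1 j)//= big1 ?addr0.
  by rewrite (nth_map 0%N) ?size_iota// nth_iota// add0n eqxx zval1 scale1r.
move=> i ij; rewrite (nth_map 0%N) ?size_iota// nth_iota// add0n ifN//.
by rewrite zval0 scale0r.
Qed.

Definition rootlike x := [/\ size x = n, all zpos x, root_vec x \in Phi & dot (root_vec x) (root_vec x) = L].

Lemma grow_rootlike fuel front acc : (forall x, x \in front -> rootlike x) ->
  (forall x, x \in acc -> rootlike x) -> forall x, x \in grow n C fuel front acc -> rootlike x.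
Proof.
elim: fuel front acc => [|fuel IH] front acc hf ha; first exact: ha.
rewrite /=; set new := undup _.
have hn x : x \in new -> rootlike x.
  rewrite mem_undup mem_filter => /andP[/andP[xpos _]] /allpairsP[[y j] [/= /hf[ys _ yP yL] jn xE]].
  move: jn; rewrite mem_iota add0n => /andP[_ jn]; pose j' := Ordinal jn.
  have xv : root_vec x = root_vec y *m reflection (simple j') by rewrite xE -vec_srefl.
  have sP := simpleP Delta_simple j'.
  split=> //; first by rewrite xE size_map size_iota.
    by rewrite xv; apply: root_stable.
  by rewrite xv dot_reflect ?(root_nonzero Phi_root sP).
apply: IH => // x; rewrite mem_cat => /orP[/ha//|/hn//].
Qed.

Lemma roots_rootlike fuel x : x \in roots n C fuel -> rootlike x.
Proof.
have he y : y \in [seq evec n j | j <- iota 0 n] -> rootlike y.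
  move=> /mapP[j]; rewrite mem_iota add0n => /andP[_ jn] ->; pose j' := Ordinal jn.
  have -> : evec n j = evec n j' by [].
  split; rewrite ?vec_evec ?dot_self ?simpleP//; first by rewrite size_map size_iota.
  by apply/allP => _ /mapP[i _ ->]; case: ifP.
exact: grow_rootlike.
Qed.

Let argmin (T : eqType) (B : seq T) (f : T -> R) b : b \in B ->
  exists2 b', b' \in B & forall a, a \in B -> f b' <= f a.
Proof.
elim: B b => // c B IH b; rewrite inE => _.
case: B IH => [|d B] IH.
  by exists c; rewrite ?inE// => a; rewrite inE => /eqP ->.
have [b' b'B hb'] := IH d (mem_head _ _).
case: (leP (f c) (f b')) => h.
  exists c; first exact: mem_head.
  move=> a; rewrite inE => /orP[/eqP ->//|/hb']; exact: le_trans.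
exists b'; first by rewrite inE b'B orbT.
by move=> a; rewrite inE => /orP[/eqP ->|/hb'//]; exact: ltW.
Qed.

Variable X : seq (seq zp).
Hypothesis X_rootlike : forall x, x \in X -> rootlike x.
Hypothesis X_closed : closed_check n C X.

Lemma vec_pos x : x \in X -> root_vec x \in Pos.
Proof.
move=> /X_rootlike[xs xp xP _]; rewrite mem_pos xP; apply/asboolP.
exists (fun i => zval (nth z0 x i)) => // i.
have /(all_nthP z0) := xp => /(_ i); rewrite xs => /(_ (ltn_ord i)) /(zpos_ge1 R)[->|].
  by rewrite zval0.
exact: le_trans.
Qed.

Let X_evec (j : 'I_n) : evec n j \in X.
Proof.
case/andP: X_closed => _ /allP/(_ j); rewrite mem_iota add0n ltn_ord; exact.
Qed.

Let X_refl x (j : 'I_n) : x \in X -> x != evec n j -> srefl n C j x \in X.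
Proof.
move=> xX xe; case/andP: X_closed => /andP[_ /allP/(_ x xX)/allP/(_ j)] + _.
by rewrite mem_iota add0n ltn_ord (negbTE xe) => /(_ isT).
Qed.

(** Take a positive root of least height outside the list. Some simple root pairs positively with
    it, so the reflection lowers its height and lands in the list; closure under that same
    reflection brings the root itself back. *)
Lemma pos_vec alpha : alpha \in Pos -> alpha \in map root_vec X.
Proof.
move=> aP; apply: contraT => aX.
have [om om_dual] := dual_basis Delta_simple.
(* Pairing with rho is the height. *)
pose rho := \sum_i om i.
have rho1 i : dot (simple i) rho = 1.
  rewrite dot_sumr (bigD1 i)//= dotC om_dual eqxx big1 ?addr0// => k ki.
  by rewrite dotC om_dual (negbTE ki).
pose B := [seq b <- Pos | b \notin map root_vec X].
have aB : alpha \in B by rewrite mem_filter aX.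
have [b + bmin] := argmin (fun v => dot v rho) aB.
rewrite mem_filter => /andP[bX bP].
have b0 := pos_nonzero Phi_root bP.
have [i bi] : exists i, 0 < dot b (simple i).
  apply/existsP; apply: contraT; rewrite negb_exists => /forallP h.
  have := dot_gt0 b0; rewrite ltNge => /negP[].
  have := bP; rewrite mem_pos => /andP[_ /asboolP[k k0 {2}->]].
  rewrite dot_sumr sumr_le0// => i _; rewrite dotZr mulr_ge0_le0//.
  by rewrite leNgt.
have bs : b != simple i.
  by apply: contraNneq bX => ->; rewrite -vec_evec map_f.
have sb := simple_reflect_pos Phi_root Delta_simple bP bs.
have : b *m reflection (simple i) \in map root_vec X.
  apply: contraT => sX; have /bmin : b *m reflection (simple i) \in B by rewrite mem_filter sX.
  rewrite reflectE dotBl dotZl rho1 mulr1 lerBrDr gerDl leNgt /cox dot_self.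
  by rewrite divr_gt0// mulr_gt0// dotC.
case/mapP => x xX sE.
have s0 := root_nonzero Phi_root (simpleP Delta_simple i).
have bE : b = root_vec x *m reflection (simple i).
  by rewrite -sE -mulmxA reflection_invol// mulmx1.
have [xe|xe] := eqVneq x (evec n i).
  have := posN Phi_root Delta_simple bP; rewrite bE xe vec_evec reflectE cox_self// scaler_nat mulr2n opprB addrK.
  by rewrite simple_pos.
by rewrite bE -vec_srefl map_f// X_refl in bX.
Qed.

Lemma vec_inj : {in X &, injective root_vec}.
Proof.
move=> x y /X_rootlike[xs _ _ _] /X_rootlike[ys _ _ _] /(simple_coord_inj Delta_simple) h.
apply: (@eq_from_nth _ z0); first by rewrite xs ys.
by move=> i; rewrite xs => iN; apply: (@zval_inj R); have := h (Ordinal iN).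
Qed.

Lemma pos_perm_vec : perm_eq Pos (map root_vec X).
Proof.
have uX : uniq X by case/andP: X_closed => /andP[].
apply: uniq_perm; first exact: (pos_uniq Delta Phi_root).
  by rewrite map_inj_in_uniq//; exact: vec_inj.
move=> alpha; apply/idP/idP => [/pos_vec//|/mapP[x xX ->]].
exact: vec_pos.
Qed.

Lemma big_pos (T : Type) (idx : T) (op : Monoid.com_law idx) (p : pred V) (F : V -> T) :
  \big[op/idx]_(alpha <- Pos | p alpha) F alpha = \big[op/idx]_(x <- X | p (root_vec x)) F (root_vec x).
Proof. by rewrite (perm_big _ pos_perm_vec) big_map. Qed.

Lemma cox_vec x (i : 'I_n) : x \in X -> cox (root_vec x) (simple i) = zval (cxn n C x i).
Proof.
move=> /X_rootlike[_ _ _ xL]; rewrite /cox dot_vec_simple xL; field.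
exact: L_neq0.
Qed.

Lemma sum_checkP (sel : pred (seq zp)) h (i : 'I_n) : sum_check n C X sel h i ->
  \sum_(x <- X | sel x) cox (root_vec x) (simple i) *: root_vec x = zval h *: simple i.
Proof.
move=> /allP hc.
transitivity (\sum_(x <- X | sel x) \sum_(k < n) (zval (zmul (cxn n C x i) (nth z0 x k))) *: simple k).
  rewrite big_seq_cond [RHS]big_seq_cond; apply: eq_bigr => x /andP[xX _].
  rewrite cox_vec// /root_vec scaler_sumr; apply: eq_bigr => k _.
  by rewrite zvalM scalerA.
rewrite exchange_big /=; transitivity (\sum_(k < n) (if k == i then zval h else 0) *: simple k).
  apply: eq_bigr => k _; rewrite -scaler_suml; congr (_ *: _).
  have := hc k; rewrite mem_iota add0n ltn_ord => /(_ isT)/eqP/(congr1 zval).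
  rewrite zval_sum big_map big_filter => ->.
  by rewrite (inj_eq val_inj); case: ifP => // _; rewrite zval0.
rewrite (bigD1 i)//= eqxx big1 ?addr0// => k ki.
by rewrite (negbTE ki) scale0r.
Qed.

Lemma cox_checkP : cox_check n C X -> forall alpha beta, alpha \in Pos -> beta \in Pos ->
  [\/ cox alpha beta = 0, cox alpha beta = 1, cox alpha beta = -1 |
      cox alpha beta = 2 /\ alpha = beta].
Proof.
move=> hc _ _ /pos_vec/mapP[x xX ->] /pos_vec/mapP[y yX ->].
move/allP: hc => /(_ x xX)/allP/(_ y yX).
set c := zsum _ => hc.
have cE : cox (root_vec x) (root_vec y) = zval c.
  rewrite /c zval_iota [root_vec y]/root_vec {1}/cox dot_sumr mulr_sumr mulr_suml.
  apply: eq_bigr => i _; rewrite (nth_map 0%N) ?size_iota// nth_iota// add0n zvalM -cox_vec//.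
  by rewrite dotZr /cox; ring.
rewrite cE; case/or4P: hc => [/eqP ->|/eqP ->|/eqP ->|/andP[/eqP -> /eqP ->]].
- by constructor 1; rewrite zval0.
- by constructor 2; rewrite zval1.
- by constructor 3; rewrite zvalN zval1.
- by constructor 4; rewrite zvalD zval1.
Qed.

Let rlin (F : V -> R) := forall (a : R) u v, F (a *: u + v) = a * F u + F v.

Let simple_ext (F G : V -> R) : rlin F -> rlin G ->
  (forall i : 'I_n, F (simple i) = G (simple i)) -> forall v, F v = G v.
Proof.
move=> lF lG h v; have [k ->] := simple_span Delta_simple v.
have S (H : V -> R) : rlin H -> H (\sum_i k i *: simple i) = \sum_i k i * H (simple i).
  move=> lH; have H0 : H 0 = 0 by have := lH (-1) 0 0; rewrite scaler0 addr0 mulN1r addNr.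
  have HD : {morph H : u v / u + v} by move=> u w; rewrite -[u in LHS]scale1r lH mul1r.
  rewrite (big_morph H HD H0); apply: eq_bigr => i _.
  by rewrite -[_ *: _]addr0 lH H0 addr0.
by rewrite !S//; apply: eq_bigr => i _; rewrite h.
Qed.

Lemma design_checkP q : design_check n C X q -> forall u v x y : V,
  \sum_(alpha <- Pos) cox alpha u * cox alpha v * (dot alpha x * dot alpha y) =
  zval q * (dot u v * dot x y + dot u x * dot v y + dot u y * dot v x).
Proof.
move=> hc u v x y.
have rl (F : V -> V -> R) : (forall a, rlin (F a)) -> rlin (fun u => \sum_(a <- Pos) F a u).
  by move=> h a b b'; rewrite mulr_sumr -big_split; apply: eq_bigr => c _; exact: h.
(* Both sides are linear in each of the four vectors, which are replaced in turn by simple roots. *)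
move: u; apply: simple_ext.
- by apply: rl => a r b b'; rewrite coxDr coxZr; ring.
- by move=> r b b'; rewrite !(dotDl, dotZl); ring.
move=> i; move: v; apply: simple_ext.
- by apply: rl => a r b b'; rewrite coxDr coxZr; ring.
- by move=> r b b'; rewrite !(dotDl, dotZl, dotDr, dotZr); ring.
move=> j; move: x; apply: simple_ext.
- by apply: rl => a r b b'; rewrite dotDr dotZr; ring.
- by move=> r b b'; rewrite !(dotDl, dotZl, dotDr, dotZr); ring.
move=> k; move: y; apply: simple_ext.
- by apply: rl => a r b b'; rewrite dotDr dotZr; ring.
- by move=> r b b'; rewrite !(dotDl, dotZl, dotDr, dotZr); ring.
move=> l; rewrite big_pos.
have io (a : 'I_n) : (a : nat) \in iota 0 n by rewrite mem_iota add0n ltn_ord.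
move/allP: hc => /(_ i (io i))/allP/(_ j (io j))/allP/(_ k (io k))/allP/(_ l (io l))/eqP/(congr1 zval).
rewrite zval_sum !big_map zvalM !zvalD !zvalM => e.
transitivity (L / 2 * (L / 2) * \sum_(x <- X) zval (cxn n C x i) * zval (cxn n C x j) * zval (cxn n C x k) * zval (cxn n C x l)).
  rewrite mulr_sumr; apply: eq_big_seq => x xX; rewrite !cox_vec// !dot_vec_simple; ring.
rewrite !dot_simple.
transitivity (L / 2 * (L / 2) * (zval q * (zval (cm C i j) * zval (cm C k l) +
   (zval (cm C i k) * zval (cm C j l) + zval (cm C i l) * zval (cm C j k))))); last by ring.
congr (_ * _); rewrite -e; apply: eq_bigr => x _ /=.
by rewrite !(nth_map 0%N) ?size_iota// !nth_iota// !add0n !zvalM.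
Qed.

Variable om : 'I_n -> V.
Hypothesis om_dual : forall i j, dot (om i) (simple j) = (i == j)%:R.

Lemma vec_coord x i : dot (root_vec x) (om i) = zval (nth z0 x i).
Proof.
rewrite /root_vec dot_suml (bigD1 i)//= dotZl dotC om_dual eqxx mulr1 big1 ?addr0//.
by move=> k ki; rewrite dotZl dotC om_dual eq_sym (negbTE ki) mulr0.
Qed.

Lemma vec_coord_eq0 x i : (dot (root_vec x) (om i) == 0) = (nth z0 x i == z0).
Proof. by rewrite vec_coord -(zval0 R) (inj_eq (@zval_inj R)). Qed.

Lemma root_coord alpha : alpha \in Pos -> alpha = \sum_i dot alpha (om i) *: simple i.
Proof.
move=> /pos_vec/mapP[x xX ->]; rewrite {1}/root_vec.
by apply: eq_bigr => i _; rewrite vec_coord.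
Qed.

Lemma root_coord_ge1 alpha i : alpha \in Pos -> dot alpha (om i) = 0 \/ 1 <= dot alpha (om i).
Proof.
move=> /pos_vec/mapP[x xX ->]; rewrite vec_coord.
have [xs /(all_nthP z0) /(_ i) + _ _] := X_rootlike xX.
rewrite xs ltn_ord => /(_ isT)/(zpos_ge1 R)[->|]; last by right.
by left; rewrite zval0.
Qed.

Lemma mem_masks k (m : seq bool) : size m = k -> m \in masks k.
Proof.
elim: k m => [|k IH] [|b m]//= [mk]; rewrite mem_cat.
by case: b; rewrite map_f ?orbT ?IH.
Qed.

Variables (p q : nat) (special : seq nat).
Hypothesis X_count : count_check n X p q special.
Variables (th c : R).
Hypothesis c_ge0 : 0 <= c.
Hypothesis q_gt0 : (0 < q)%N.
Hypothesis cth : 2 * c * p%:R <= th * q%:R.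

Lemma excessE (J : {set 'I_n}) (m := [seq i \in J | i <- enum 'I_n]) :
  excess Pos (fun alpha i => dot alpha (om i)) th c J =
  th * (count id m)%:R - 2 * c * (count (supp_in n ^~ m) X)%:R.
Proof.
rewrite /excess; congr (_ * _%:R - _ * _%:R).
  by rewrite /m count_map -size_filter cardE {1}/enum_mem -enumT; congr size; apply: eq_filter.
rewrite (permP pos_perm_vec) count_map; apply: eq_count => x /=.
apply/fintype.subsetP/allP => [h i|h i].
  rewrite mem_iota add0n => /andP[_ iN].
  have := h (Ordinal iN); rewrite inE vec_coord_eq0 /= => h'.
  rewrite (nth_map (Ordinal iN)) ?size_enum_ord// orbC -implyNb.
  by apply/implyP => /h'; rewrite (_ : nth _ _ i = Ordinal iN)//; apply: val_inj; rewrite /= nth_enum_ord.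
rewrite inE vec_coord_eq0 => xi.
have := h i; rewrite mem_iota add0n ltn_ord (negbTE xi) orbF => /(_ isT).
by rewrite (nth_map i) ?size_enum_ord// nth_ord_enum.
Qed.

Lemma excess_ge0 (J : {set 'I_n}) : J != finset.setT ->
  (forall j : 'I_n, (j : nat) \in special -> J != finset.setT :\ j) ->
  (forall j, j \in special -> (j < n)%N) ->
  0 <= excess Pos (fun alpha i => dot alpha (om i)) th c J.
Proof.
move=> JT Jsp spn; set m := [seq i \in J | i <- enum 'I_n].
have mE (i : 'I_n) : nth false m i = (i \in J).
  by rewrite /m (nth_map i) ?size_enum_ord// nth_ord_enum.
have ms : size m = n by rewrite size_map size_enum_ord.
have /allP/(_ m (mem_masks ms))/or3P[/allP h|/hasP[j jsp /eqP h]|h] := X_count.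
- case/eqP: JT; apply/setP => i; rewrite inE -mE; apply: h.
  by rewrite mem_nth// ms.
- have jn := spn j jsp; case/eqP: (Jsp (Ordinal jn) jsp); apply/setP => i.
  by rewrite !inE -mE h (nth_map 0%N) ?size_iota// nth_iota// andbT.
- rewrite excessE -/m subr_ge0 -(@ler_pM2r _ q%:R) ?ltr0n//.
  apply: (@le_trans _ _ (2 * c * (p%:R * (count id m)%:R))).
    rewrite -(mulrA (2 * c)); apply: ler_wpM2l; first by rewrite mulr_ge0.
    by rewrite -!natrM ler_nat mulnC.
  rewrite (mulrA (2 * c)) (mulrAC th); exact: ler_wpM2r.
Qed.

End RootListModel.

(** * Reflection spectrum in the simply laced case *)

Section Multilinear.
Variables (R : realType) (N : nat).
Local Notation C := R[i].
Local Notation P := (cpoly R N).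
Local Notation V := 'rV[R]_N.
Implicit Types (f g u : P) (v w x y alpha beta : V) (F : V -> C) (B : V -> V -> C).
Local Notation e_ i := (delta_mx 0 i : V).

Definition lin F := forall (a : R) x y, F (a *: x + y) = a%:C * F x + F y.

Section Lin.
Variable F : V -> C.
Hypothesis lF : lin F.

Lemma lin0 : F 0 = 0.
Proof. by have := lF (-1) 0 0; rewrite scaler0 addr0 rmorphN mulN1r addNr. Qed.

Lemma linD x y : F (x + y) = F x + F y.
Proof. by rewrite -[x]scale1r lF mul1r scale1r. Qed.

Lemma linZ a x : F (a *: x) = a%:C * F x.
Proof. by rewrite -[a *: x]addr0 lF lin0 addr0. Qed.

Lemma linB x y : F (x - y) = F x - F y.
Proof. by rewrite linD -scaleN1r linZ rmorphN mulN1r. Qed.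

Lemma lin_sum (I : Type) (r : seq I) (p : pred I) (G : I -> V) :
  F (\sum_(i <- r | p i) G i) = \sum_(i <- r | p i) F (G i).
Proof. by apply: (big_morph F) => [x y|]; rewrite ?linD ?lin0. Qed.

Lemma lin_coord x : F x = \sum_i (x 0 i)%:C * F (e_ i).
Proof.
by rewrite {1}(row_sum_delta x) lin_sum; apply: eq_bigr => i _; rewrite linZ.
Qed.

End Lin.

Definition lap f : P := \sum_i dird (e_ i) (dird (e_ i) f).

Lemma hom_lap d f : hom d f -> hom d.-2 (lap f).
Proof. by move=> hf; apply: hom_sum => i _; do 2 apply: hom_dird. Qed.

Lemma lap_dird v f : lap (dird v f) = dird v (lap f).
Proof.
by rewrite /lap dird_sum; apply: eq_bigr => i _; rewrite (dird_comm _ v f) (dird_comm _ v).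
Qed.

Lemma sum_orth_diag (M : 'M[R]_N) (X : 'I_N -> 'I_N -> P) : M^T *m M = 1%:M ->
  \sum_i \sum_k \sum_l (M i k * M i l)%:C *: X k l = \sum_k X k k.
Proof.
move=> MM; rewrite exchange_big; apply: eq_bigr => k _; rewrite exchange_big /=.
have S l : \sum_i (M i k * M i l)%:C = ((k == l)%:R : R)%:C.
  have /matrixP/(_ k l) := MM; rewrite !mxE -rmorph_sum => <-.
  by congr (_%:C); apply: eq_bigr => i _; rewrite mxE.
rewrite (bigD1 k)//= -scaler_suml S eqxx scale1r big1 ?addr0// => l lk.
by rewrite -scaler_suml S eq_sym (negbTE lk) scale0r.
Qed.

Lemma lap_lsub (M : 'M[R]_N) f : M^T *m M = 1%:M -> lap (lsub M f) = lsub M (lap f).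
Proof.
move=> MM; rewrite /lap (eq_bigr (fun i => lsub M (dird (e_ i *m M) (dird (e_ i *m M) f)))); last first.
  by move=> i _; rewrite !dird_lsub.
rewrite -lsub_sum; congr lsub.
rewrite [RHS](eq_bigr (fun i => mderiv i (mderiv i f))); last by move=> i _; rewrite !dird_delta.
rewrite -(sum_orth_diag (fun k l => mderiv k (mderiv l f)) MM); apply: eq_bigr => i _.
rewrite dird_dirdE; apply: eq_bigr => k _; apply: eq_bigr => l _.
by rewrite -!rowE !mxE rmorphM.
Qed.

Lemma pev_hom0 f : hom 0 f -> pev f 0 = 0 -> f = 0.
Proof. by move=> /hom0E[a ->]; rewrite pev_cst => ->; rewrite scale0r. Qed.

Lemma dird_eq0 d f : hom d.+1 f -> (forall v, dird v f = 0) -> f = 0.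
Proof. by move=> hf h; apply: (@hom_mderiv_eq0 R N d.+1) => // i; rewrite -dird_delta h. Qed.

Lemma pev_dird_lin (G : V -> P) : (forall (a : R) x y, G (a *: x + y) = a%:C *: G x + G y) ->
  lin (fun x => pev (G x) 0).
Proof. by move=> h a x y; rewrite h pevD pevZ. Qed.

Lemma dird_lin f a x y : dird (a *: x + y) f = a%:C *: dird x f + dird y f.
Proof. by rewrite dirdDl dirdZl. Qed.

Lemma pev0_refl alpha f : pev (refl alpha f) 0 = pev f 0.
Proof. by rewrite /refl pev_lsub mul0mx. Qed.

Lemma dird_refl v alpha f : dird v (refl alpha f) = refl alpha (dird (v *m reflection alpha) f).
Proof. exact: dird_lsub. Qed.

End Multilinear.

(** * Eigenvalues of [KK] on harmonic tensors of degree 2, 3 and 4 *)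

Section SimplyLaced.
Variables (R : realType) (N : nat).
Local Notation C := R[i].
Local Notation P := (cpoly R N).
Local Notation V := 'rV[R]_N.
Implicit Types (f : P) (u v w x y alpha beta gam : V) (F : V -> C) (B : V -> V -> C).
Variables (Phi : seq V) (Delta : N.-tuple V).
Hypothesis Phi_root : root_system Phi.
Hypothesis Delta_simple : simple_system Phi Delta.
Local Notation Pos := (positive_roots Phi Delta).
Local Notation KK := (@KK R N Phi Delta).
Local Notation e_ i := (delta_mx 0 i : V).
Variables (L h lam : R).
Hypothesis L_gt0 : 0 < L.
Hypothesis root_len : forall alpha, alpha \in Phi -> dot alpha alpha = L.
Hypothesis total : forall v, \sum_(alpha <- Pos) cox alpha v *: alpha = h *: v.
(* The roots form a spherical 4-design. *)
Hypothesis design : forall u v x y : V,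
  \sum_(alpha <- Pos) cox alpha u * cox alpha v * (dot alpha x * dot alpha y) =
  lam / 2 * (dot u v * dot x y + dot u x * dot v y + dot u y * dot v x).

Let L_neq0 : L != 0. Proof. by rewrite gt_eqF. Qed.

Lemma total_lin F v : lin F -> \sum_(alpha <- Pos) (cox alpha v)%:C * F alpha = h%:C * F v.
Proof.
move=> lF; rewrite -(linZ lF) -total (lin_sum lF).
by apply: eq_bigr => alpha _; rewrite (linZ lF).
Qed.

(** The design identity at coordinate vectors, contracted with the matrix of B; the three pairings
    give the trace of B and its two values at u and v. *)
Lemma design_bilin B u v : (forall x, lin (B x)) -> (forall y, lin (B^~ y)) ->
  \sum_(alpha <- Pos) (cox alpha u * cox alpha v)%:C * B alpha alpha =
  (lam / 2)%:C * ((dot u v)%:C * (\sum_i B (e_ i) (e_ i)) + B u v + B v u).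
Proof.
move=> lB lB'.
have BE x y : B x y = \sum_i \sum_j (x 0 i * y 0 j)%:C * B (e_ i) (e_ j).
  rewrite (lin_coord (lB' y)); apply: eq_bigr => i _; rewrite (lin_coord (lB _)) mulr_sumr.
  by apply: eq_bigr => j _; rewrite mulrA rmorphM.
have trE : \sum_i B (e_ i) (e_ i) = \sum_i \sum_j ((i == j)%:R : R)%:C * B (e_ i) (e_ j).
  apply: eq_bigr => i _; rewrite (bigD1 i)//= eqxx mul1r big1 ?addr0// => j ji.
  by rewrite eq_sym (negbTE ji) mul0r.
rewrite trE (BE u v) (BE v u) mulr_sumr -!big_split /= mulr_sumr.
under eq_bigr do rewrite BE mulr_sumr.
rewrite exchange_big /=; apply: eq_bigr => i _.
rewrite mulr_sumr -!big_split /= mulr_sumr.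
under eq_bigr do rewrite mulr_sumr.
rewrite exchange_big /=; apply: eq_bigr => j _.
under eq_bigr do rewrite mulrA -rmorphM.
rewrite -mulr_suml -rmorph_sum.
have -> : \sum_(alpha <- Pos) cox alpha u * cox alpha v * (alpha 0 i * alpha 0 j) =
    lam / 2 * (dot u v * (i == j)%:R + u 0 i * v 0 j + u 0 j * v 0 i).
  have := design u v (e_ i) (e_ j); rewrite !dot_delta !mxE eqxx [j == i]eq_sym => <-.
  by apply: eq_bigr => alpha _; rewrite !dot_delta.
rewrite !(rmorphM, rmorphD) /=; move: (B _ _) (lam / 2)%:C ((dot u v)%:C) => b l d.
by ring.
Qed.

(** Expanding the third slot in coordinates produces a second factor [cox], after which
    [design_bilin] leaves only traces of F. *)
Lemma design_trilin (F : V -> V -> V -> C) gam :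
  (forall y z, lin (fun x => F x y z)) -> (forall x z, lin (fun y => F x y z)) ->
  (forall x y, lin (fun z => F x y z)) ->
  (forall z, \sum_i F (e_ i) (e_ i) z = 0) -> (forall y, \sum_i F (e_ i) y (e_ i) = 0) ->
  (forall x, \sum_i F x (e_ i) (e_ i) = 0) ->
  \sum_(alpha <- Pos) (cox alpha gam)%:C * F alpha alpha alpha = 0.
Proof.
move=> l1 l2 l3 t12 t13 t23.
transitivity ((L / 2)%:C * \sum_k \sum_(alpha <- Pos) (cox alpha gam * cox alpha (e_ k))%:C * F alpha alpha (e_ k)).
  rewrite exchange_big /= mulr_sumr; apply: eq_big_seq => alpha aP.
  rewrite (lin_coord (l3 alpha alpha)) !mulr_sumr; apply: eq_bigr => k _.
  rewrite !mulrA -!rmorphM; congr (_%:C * _).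
  rewrite /cox dot_delta (root_len (pos_root aP)); move: (dot _ _) => d; field.
  exact: L_neq0.
rewrite (eq_bigr (fun k => (lam / 2)%:C * ((gam 0 k)%:C * \sum_i F (e_ i) (e_ i) (e_ k)
   + (F gam (e_ k) (e_ k) + F (e_ k) gam (e_ k))))); last first.
  move=> k _; rewrite (@design_bilin (fun x y => F x y (e_ k)))//.
  by rewrite dot_delta addrA.
rewrite -mulr_sumr; under eq_bigr do rewrite t12 mulr0 add0r.
by rewrite big_split /= t23 t13 addr0 !mulr0.
Qed.

Lemma lap_KK f : lap (KK f) = KK (lap f).
Proof.
rewrite !KKE /lap.
have lapB a b : lap (a - b) = lap a - lap b.
  by rewrite /lap -sumrB; apply: eq_bigr => i _; rewrite !dirdB.
rewrite -/(lap _) (big_morph (@lap R N) (id1 := 0) (op1 := +%R)); first last.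
- by rewrite /lap big1// => i _; rewrite !dird0.
- by move=> a b; rewrite /lap -big_split; apply: eq_bigr => i _; rewrite !dirdD.
rewrite -/(lap f); apply: eq_big_seq => alpha aP; rewrite lapB /refl lap_lsub//.
by rewrite trmx_reflection reflection_invol// (pos_nonzero Phi_root aP).
Qed.

Lemma eigen_eq (a b : R) (t : C) : t != 0 -> a%:C * t = b%:C * t -> a = b.
Proof. by move=> t0 /(mulIf t0)/complexI. Qed.

Hypothesis cox_int : forall alpha beta, alpha \in Pos -> beta \in Pos ->
  [\/ cox alpha beta = 0, cox alpha beta = 1, cox alpha beta = -1 |
      cox alpha beta = 2 /\ alpha = beta].

Let sum_pred1 gam (F : V -> C) (n : C) : gam \in Pos ->
  \sum_(alpha <- Pos) (if alpha == gam then n * F alpha else 0) = n * F gam.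
Proof.
move=> gP; rewrite (bigD1_seq gam)//= ?eqxx ?(pos_uniq Delta Phi_root)//.
by rewrite big1 ?addr0// => alpha /negbTE ->.
Qed.

(** n^3 = n + 6 [n = 2] for n in {0, 1, -1, 2}, and n = 2 only for alpha = gam. *)
Lemma sum_cox3 F gam : gam \in Pos -> \sum_(alpha <- Pos) (cox alpha gam ^+ 3)%:C * F alpha =
  \sum_(alpha <- Pos) (cox alpha gam)%:C * F alpha + 6 * F gam.
Proof.
move=> gP; rewrite -(sum_pred1 _ _ gP) -big_split; apply: eq_big_seq => alpha aP /=.
have [E|E|E|[E aE]] := cox_int aP gP; rewrite E.
- rewrite expr0n /= rmorph0 mul0r add0r; case: eqP => // aE; exfalso.
  by move: E; rewrite aE cox_self ?(pos_nonzero Phi_root gP)// => /eqP; rewrite pnatr_eq0.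
- rewrite expr1n; case: eqP => [aE|_]; last by rewrite addr0.
  by exfalso; move: E; rewrite aE cox_self ?(pos_nonzero Phi_root gP)//; lra.
- rewrite (_ : (-1) ^+ 3 = -1 :> R); last by ring.
  case: eqP => [aE|_]; last by rewrite addr0.
  by exfalso; move: E; rewrite aE cox_self ?(pos_nonzero Phi_root gP)//; lra.
- rewrite aE eqxx -mulrDl; congr (_ * _).
  by rewrite (_ : 2 ^+ 3 = 2 + 6 :> R); [rewrite rmorphD /= !rmorph_nat|ring].
Qed.

(** n^4 = n^2 + 12 [n = 2] on the same values. *)
Lemma sum_cox4 F gam : gam \in Pos -> \sum_(alpha <- Pos) (cox alpha gam ^+ 4)%:C * F alpha =
  \sum_(alpha <- Pos) (cox alpha gam ^+ 2)%:C * F alpha + 12 * F gam.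
Proof.
move=> gP; rewrite -(sum_pred1 _ _ gP) -big_split; apply: eq_big_seq => alpha aP /=.
have [E|E|E|[E aE]] := cox_int aP gP; rewrite E.
- rewrite !expr0n /= rmorph0 mul0r add0r; case: eqP => // aE; exfalso.
  by move: E; rewrite aE cox_self ?(pos_nonzero Phi_root gP)// => /eqP; rewrite pnatr_eq0.
- rewrite !expr1n; case: eqP => [aE|_]; last by rewrite addr0.
  by exfalso; move: E; rewrite aE cox_self ?(pos_nonzero Phi_root gP)//; lra.
- rewrite (_ : (-1) ^+ 4 = (-1) ^+ 2 :> R); last by ring.
  case: eqP => [aE|_]; last by rewrite addr0.
  by exfalso; move: E; rewrite aE cox_self ?(pos_nonzero Phi_root gP)//; lra.
- rewrite aE eqxx -mulrDl; congr (_ * _).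
  by rewrite (_ : 2 ^+ 4 = 2 ^+ 2 + 12 :> R); [rewrite rmorphD /= rmorph_nat|ring].
Qed.

Let lamE : lam%:C = (lam / 2)%:C + (lam / 2)%:C.
Proof. by rewrite -rmorphD /=; congr (_%:C); field. Qed.

Section Degree2.
Variables (T : V -> V -> C) (k : R).
Hypothesis l1 : forall b, lin (fun x => T x b).
Hypothesis l2 : forall a, lin (fun x => T a x).
Hypothesis p12 : forall a b, T a b = T b a.
Hypothesis tr : \sum_i T (e_ i) (e_ i) = 0.
Hypothesis eig : forall a b, k%:C * T a b =
  \sum_(alpha <- Pos) (T a b - T (a *m reflection alpha) (b *m reflection alpha)).

(** Expanding T(s a, s b), the two terms linear in [cox] sum to h each by [total], and the quadratic
    one to - lam by the design property. *)
Lemma degree2 a b : k%:C * T a b = (2 * h - lam)%:C * T a b.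
Proof.
have B1 x y d b' : T (x - d *: y) b' = T x b' - d%:C * T y b'.
  by rewrite (linB (l1 b')) (linZ (l1 b')).
have B2 x y d b' : T b' (x - d *: y) = T b' x - d%:C * T b' y.
  by rewrite (linB (l2 b')) (linZ (l2 b')).
rewrite eig (eq_bigr (fun alpha => (cox alpha a)%:C * T alpha b + (cox alpha b)%:C * T a alpha
    - (cox alpha a * cox alpha b)%:C * T alpha alpha)); last first.
  move=> alpha _; rewrite !reflectE B1 !B2; move: (cox alpha a) (cox alpha b) => ca cb.
  by rewrite rmorphM /=; ring.
rewrite sumrB big_split /= (total_lin a (l1 b)) (total_lin b (l2 a)).
rewrite (@design_bilin T)// tr mulr0 add0r (p12 b a).
have -> : (2 * h - lam)%:C = 2 * h%:C - ((lam / 2)%:C + (lam / 2)%:C) by rewrite -lamE; ring.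
by move: (lam / 2)%:C => l; ring.
Qed.

End Degree2.

Section Degree3.
Variables (T : V -> V -> V -> C) (k : R).
Hypothesis l1 : forall b c, lin (fun x => T x b c).
Hypothesis p12 : forall a b c, T a b c = T b a c.
Hypothesis p23 : forall a b c, T a b c = T a c b.
Hypothesis tr : forall c, \sum_i T (e_ i) (e_ i) c = 0.
Hypothesis eig : forall a b c, k%:C * T a b c = \sum_(alpha <- Pos) (T a b c
  - T (a *m reflection alpha) (b *m reflection alpha) (c *m reflection alpha)).

Let l2 a c : lin (fun x => T a x c).
Proof. by move=> d x y; rewrite !(p12 a) l1. Qed.

Let l3 a b : lin (fun x => T a b x).
Proof. by move=> d x y; rewrite !(p23 a b) l2. Qed.

Let H1 u b c : \sum_(alpha <- Pos) (cox alpha u)%:C * T alpha b c = h%:C * T u b c.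
Proof. exact: total_lin u (l1 b c). Qed.

Let D2 u v c : \sum_(alpha <- Pos) (cox alpha u * cox alpha v)%:C * T alpha alpha c = lam%:C * T u v c.
Proof.
rewrite (@design_bilin (fun x y => T x y c))// tr mulr0 add0r (p12 v u).
by rewrite lamE mulrDr mulrDl.
Qed.

Lemma degree3E a b c : k%:C * T a b c = (3 * h - 3 * lam)%:C * T a b c +
  \sum_(alpha <- Pos) (cox alpha a * cox alpha b * cox alpha c)%:C * T alpha alpha alpha.
Proof.
have B1 x y d b' c' : T (x - d *: y) b' c' = T x b' c' - d%:C * T y b' c'.
  by rewrite (linB (l1 b' c')) (linZ (l1 b' c')).
have B2 x y d a' c' : T a' (x - d *: y) c' = T a' x c' - d%:C * T a' y c'.
  by rewrite (linB (l2 a' c')) (linZ (l2 a' c')).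
have B3 x y d a' b' : T a' b' (x - d *: y) = T a' b' x - d%:C * T a' b' y.
  by rewrite (linB (l3 a' b')) (linZ (l3 a' b')).
rewrite eig (eq_bigr (fun alpha => (cox alpha a)%:C * T alpha b c + (cox alpha b)%:C * T alpha a c
    + (cox alpha c)%:C * T alpha a b
    - (cox alpha a * cox alpha b)%:C * T alpha alpha c
    - (cox alpha a * cox alpha c)%:C * T alpha alpha b
    - (cox alpha b * cox alpha c)%:C * T alpha alpha a
    + (cox alpha a * cox alpha b * cox alpha c)%:C * T alpha alpha alpha)); last first.
  move=> alpha _; rewrite !reflectE B1 !B2 !B3.
  rewrite !(p12 a alpha, p12 b alpha, p12 c alpha, p23 _ a alpha, p23 _ b alpha, p23 _ c alpha).
  move: (cox alpha a) (cox alpha b) (cox alpha c) => ca cb cc.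
  by rewrite !rmorphM /=; ring.
rewrite !big_split /= !sumrN !H1 !D2.
rewrite !(p12 b a, p12 c a, p12 c b, p23 _ b a, p23 _ c a, p23 _ c b).
by ring.
Qed.

(** On a = b = c = g the last sum of [degree3E] is 6 T(g, g, g), by [sum_cox3] and [design_trilin].
    If T vanishes on all cubes of roots, that sum drops out. *)
Lemma degree3 a b c : T a b c != 0 -> k = 3 * h - 3 * lam \/ k = 3 * h - 3 * lam + 6.
Proof.
move=> T0; have [hT|] := pselect (forall alpha, alpha \in Pos -> T alpha alpha alpha = 0).
  left; apply: (eigen_eq T0); rewrite degree3E big1_seq ?addr0// => alpha /andP[_ aP].
  by rewrite hT// mulr0.
move=> /existsNP[g /not_implyP[gP /eqP Tg]]; right; apply: (eigen_eq Tg).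
rewrite degree3E (eq_bigr (fun alpha => (cox alpha g ^+ 3)%:C * T alpha alpha alpha)); last first.
  by move=> alpha _; rewrite !exprS expr0 mulr1 mulrA.
rewrite sum_cox3// (@design_trilin T)//.
- by rewrite add0r -mulrDl [in RHS]rmorphD /= rmorph_nat.
- by move=> c'; under eq_bigr do rewrite p23; exact: tr.
- by move=> c'; under eq_bigr do rewrite p12 p23; exact: tr.
Qed.

End Degree3.

Section Degree4.
Variables (T : V -> V -> V -> V -> C) (k : R).
Hypothesis l1 : forall b c d, lin (fun x => T x b c d).
Hypothesis p12 : forall a b c d, T a b c d = T b a c d.
Hypothesis p23 : forall a b c d, T a b c d = T a c b d.
Hypothesis p34 : forall a b c d, T a b c d = T a b d c.
Hypothesis tr : forall c d, \sum_i T (e_ i) (e_ i) c d = 0.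
Hypothesis eig : forall a b c d, k%:C * T a b c d = \sum_(alpha <- Pos) (T a b c d
  - T (a *m reflection alpha) (b *m reflection alpha) (c *m reflection alpha) (d *m reflection alpha)).

Let l2 a c d : lin (fun x => T a x c d).
Proof. by move=> r x y; rewrite !(p12 a) l1. Qed.

Let l3 a b d : lin (fun x => T a b x d).
Proof. by move=> r x y; rewrite !(p23 a b) l2. Qed.

Let l4 a b c : lin (fun x => T a b c x).
Proof. by move=> r x y; rewrite !(p34 a b c) l3. Qed.

Let H1 u b c d : \sum_(alpha <- Pos) (cox alpha u)%:C * T alpha b c d = h%:C * T u b c d.
Proof. exact: total_lin u (l1 b c d). Qed.

Let D2 u v c d : \sum_(alpha <- Pos) (cox alpha u * cox alpha v)%:C * T alpha alpha c d =
  lam%:C * T u v c d.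
Proof.
rewrite (@design_bilin (fun x y => T x y c d))// tr mulr0 add0r (p12 v u).
by rewrite lamE mulrDr mulrDl.
Qed.

Let D3 gam v : \sum_(alpha <- Pos) (cox alpha gam)%:C * T alpha alpha alpha v = 0.
Proof.
apply: (@design_trilin (fun x y z => T x y z v)) => //.
- by move=> c'; under eq_bigr do rewrite p23; exact: tr.
- by move=> c'; under eq_bigr do rewrite p12 p23; exact: tr.
Qed.

Let B1 x y r b c d : T (x - r *: y) b c d = T x b c d - r%:C * T y b c d.
Proof. by rewrite (linB (l1 b c d)) (linZ (l1 b c d)). Qed.

Let B2 x y r a c d : T a (x - r *: y) c d = T a x c d - r%:C * T a y c d.
Proof. by rewrite (linB (l2 a c d)) (linZ (l2 a c d)). Qed.

Let B3 x y r a b d : T a b (x - r *: y) d = T a b x d - r%:C * T a b y d.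
Proof. by rewrite (linB (l3 a b d)) (linZ (l3 a b d)). Qed.

Let B4 x y r a b c : T a b c (x - r *: y) = T a b c x - r%:C * T a b c y.
Proof. by rewrite (linB (l4 a b c)) (linZ (l4 a b c)). Qed.

Let N1 x b c d : T (- x) b c d = - T x b c d.
Proof. by rewrite -scaleN1r (linZ (l1 b c d)) rmorphN mulN1r. Qed.

Let N2 x a c d : T a (- x) c d = - T a x c d.
Proof. by rewrite -scaleN1r (linZ (l2 a c d)) rmorphN mulN1r. Qed.

Let N3 x a b d : T a b (- x) d = - T a b x d.
Proof. by rewrite -scaleN1r (linZ (l3 a b d)) rmorphN mulN1r. Qed.

Let N4 x a b c : T a b c (- x) = - T a b c x.
Proof. by rewrite -scaleN1r (linZ (l4 a b c)) rmorphN mulN1r. Qed.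

Lemma degree4E a b c d : k%:C * T a b c d = (4 * h - 6 * lam)%:C * T a b c d +
  \sum_(alpha <- Pos) (
    (cox alpha a * cox alpha b * cox alpha c)%:C * T alpha alpha alpha d
    + (cox alpha a * cox alpha b * cox alpha d)%:C * T alpha alpha alpha c
    + (cox alpha a * cox alpha c * cox alpha d)%:C * T alpha alpha alpha b
    + (cox alpha b * cox alpha c * cox alpha d)%:C * T alpha alpha alpha a
    - (cox alpha a * cox alpha b * cox alpha c * cox alpha d)%:C * T alpha alpha alpha alpha).
Proof.
set G := (\sum_(alpha <- Pos) (_ - _ : C)).
rewrite eig (eq_bigr (fun alpha => (cox alpha a)%:C * T alpha b c d + (cox alpha b)%:C * T alpha a c d
    + (cox alpha c)%:C * T alpha a b d + (cox alpha d)%:C * T alpha a b c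
    - (cox alpha a * cox alpha b)%:C * T alpha alpha c d
    - (cox alpha a * cox alpha c)%:C * T alpha alpha b d
    - (cox alpha a * cox alpha d)%:C * T alpha alpha b c
    - (cox alpha b * cox alpha c)%:C * T alpha alpha a d
    - (cox alpha b * cox alpha d)%:C * T alpha alpha a c
    - (cox alpha c * cox alpha d)%:C * T alpha alpha a b
    + ((cox alpha a * cox alpha b * cox alpha c)%:C * T alpha alpha alpha d
    + (cox alpha a * cox alpha b * cox alpha d)%:C * T alpha alpha alpha c
    + (cox alpha a * cox alpha c * cox alpha d)%:C * T alpha alpha alpha b
    + (cox alpha b * cox alpha c * cox alpha d)%:C * T alpha alpha alpha a
    - (cox alpha a * cox alpha b * cox alpha c * cox alpha d)%:C * T alpha alpha alpha alpha))); last first.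
  move=> alpha _; rewrite !reflectE B1 !B2 !B3 !B4.
  rewrite !(p12 a alpha, p12 b alpha, p12 c alpha, p12 d alpha, p23 _ a alpha, p23 _ b alpha,
    p23 _ c alpha, p23 _ d alpha, p34 _ _ a alpha, p34 _ _ b alpha, p34 _ _ c alpha, p34 _ _ d alpha).
  move: (cox alpha a) (cox alpha b) (cox alpha c) (cox alpha d) => ca cb cc cd.
  by rewrite !rmorphM /=; ring.
rewrite big_split /= -/G; congr (_ + _).
rewrite !big_split /= !sumrN !H1 !D2.
rewrite !(p12 b a, p12 c a, p12 d a, p12 c b, p12 d b, p12 d c, p23 _ b a, p23 _ c a, p23 _ d a,
  p23 _ c b, p23 _ d b, p23 _ d c, p34 _ _ b a, p34 _ _ c a, p34 _ _ d a, p34 _ _ c b, p34 _ _ d b, p34 _ _ d c).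
by ring.
Qed.

Local Notation t g := (T g g g g).

(** On fourth powers of roots the eigenvalue equation reads (4 h - 6 lam + 12 - k) t = M t, with M
    the matrix of squares of [cox]. M is a Gram matrix, hence nonnegative, and pairing with t gives
    the inequality. *)
Let case_top g : g \in Pos -> t g != 0 -> k <= 4 * h - 6 * lam + 12.
Proof.
move=> gP tg.
have E b : b \in Pos -> k%:C * t b = (4 * h - 6 * lam + 12)%:C * t b -
    \sum_(alpha <- Pos) (cox alpha b ^+ 2)%:C * t alpha.
  move=> bP; rewrite degree4E (eq_bigr (fun alpha => 4 * ((cox alpha b ^+ 3)%:C * T alpha alpha alpha b)
     - (cox alpha b ^+ 4)%:C * t alpha)); last first.
    move=> alpha _; move: (cox alpha b) => c; rewrite !exprS expr0 mulr1 !rmorphM /=; ring.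
  rewrite sumrB -mulr_sumr (sum_cox3 (fun x => T x x x b))// (sum_cox4 (fun x => t x))// D3 add0r.
  move: (\sum_(_ <- _) _) => s; ring.
pose S := \sum_(b <- Pos) t b * (t b)^*%C.
pose Q := \sum_(b <- Pos) (\sum_(alpha <- Pos) (cox alpha b ^+ 2)%:C * t alpha) * (t b)^*%C.
have SE : (4 * h - 6 * lam + 12 - k)%:C * S = Q.
  rewrite /S /Q mulr_sumr; apply: eq_big_seq => b bP.
  rewrite mulrA; congr (_ * _); rewrite rmorphB mulrBl /= E//.
  by rewrite opprB addrCA subrr addr0.
have S0 : 0 < S.
  rewrite /S (bigD1_seq g)//= ?(pos_uniq Delta Phi_root)//.
  rewrite ltr_pwDl ?sumr_ge0// => [|b _]; last exact: mulcJ_ge0.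
  by rewrite lt_neqAle mulcJ_ge0 andbT eq_sym mulf_neq0 ?conjc_eq0.
have Q0 : 0 <= Q.
  pose Z i j := \sum_(alpha <- Pos) (alpha 0 i * alpha 0 j)%:C * t alpha.
  (* The square of [cox] is 4 / L^2 times the inner product of the tensor squares of the two roots,
     so Q is a sum of squared moduli. *)
  have -> : Q = (4 / (L * L))%:C * \sum_i \sum_j Z i j * (Z i j)^*%C.
    rewrite /Q; transitivity (\sum_(b <- Pos) \sum_(alpha <- Pos) \sum_i \sum_j
      (4 / (L * L))%:C * (((alpha 0 i * alpha 0 j)%:C * t alpha) * ((b 0 i * b 0 j)%:C * (t b)^*%C))).
      apply: eq_big_seq => b bP; rewrite mulr_suml; apply: eq_big_seq => alpha aP.
      have -> : cox alpha b ^+ 2 = 4 / (L * L) * (dot alpha b * dot alpha b).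
        rewrite /cox (root_len (pos_root aP)); move: (dot _ _) => x; field; exact: L_neq0.
      have -> : dot alpha b * dot alpha b = \sum_i \sum_j (alpha 0 i * alpha 0 j) * (b 0 i * b 0 j).
        rewrite {1}/dot mulr_suml; apply: eq_bigr => i _; rewrite /dot mulr_sumr.
        by apply: eq_bigr => j _; ring.
      move: (4 / (L * L)) => K; rewrite rmorphM -!mulrA; move: (t alpha) ((t b)^*%C) => x y.
      rewrite rmorph_sum mulr_suml mulr_sumr; apply: eq_bigr => i _.
      rewrite rmorph_sum mulr_suml mulr_sumr; apply: eq_bigr => j _.
      by rewrite !rmorphM /=; ring.
    transitivity (\sum_i \sum_j \sum_(b <- Pos) \sum_(alpha <- Pos)
      (4 / (L * L))%:C * (((alpha 0 i * alpha 0 j)%:C * t alpha) * ((b 0 i * b 0 j)%:C * (t b)^*%C))).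
      transitivity (\sum_(b <- Pos) \sum_i \sum_j \sum_(alpha <- Pos)
        (4 / (L * L))%:C * (((alpha 0 i * alpha 0 j)%:C * t alpha) * ((b 0 i * b 0 j)%:C * (t b)^*%C))).
        apply: eq_bigr => b _; rewrite exchange_big; apply: eq_bigr => i _; exact: exchange_big.
      rewrite exchange_big; apply: eq_bigr => i _; exact: exchange_big.
    rewrite mulr_sumr; apply: eq_bigr => i _; rewrite mulr_sumr; apply: eq_bigr => j _.
    rewrite /Z rmorph_sum mulr_sumr mulr_sumr; apply: eq_bigr => b _.
    rewrite mulr_suml mulr_sumr; apply: eq_bigr => alpha _.
    have cM (r : R) (z : C) : (r%:C * z)^*%C = r%:C * z^*%C.
      by case: z => x y; apply/eqP; rewrite eq_complex /=; apply/andP; split; apply/eqP; ring.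
    by rewrite /= cM.
  rewrite mulr_ge0//; last by apply: sumr_ge0 => i _; apply: sumr_ge0 => j _; exact: mulcJ_ge0.
  by rewrite -(rmorph0 (real_complex R)) lecR divr_ge0// mulr_ge0// ltW.
by move: Q0; rewrite -SE pmulr_lge0// -(rmorph0 (real_complex R)) lecR subr_ge0.
Qed.

(** At (g, g, g, v) the terms of [degree4E] give 6 T(g, g, g, v), by [sum_cox3], plus 3 times the
    sum of F. That sum is half of lam T(g, g, g, v): [S1] symmetrizes it under s_g, [S2] applies the
    design property. *)
Let case_mid g v : (forall a, a \in Pos -> t a = 0) -> g \in Pos -> dot g v = 0 ->
  T g g g v != 0 -> k = 4 * h - 6 * lam + 6 + 3 / 2 * lam.
Proof.
move=> t0 gP gv Tg; have g0 := pos_nonzero Phi_root gP.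
have t0' a : a \in Phi -> t a = 0.
  move=> aP; case/orP: (posVneg Phi_root Delta_simple aP) => [/t0//|/t0].
  by rewrite !(N1, N2, N3, N4) !opprK.
have vg : v *m reflection g = v by rewrite reflectE /cox gv mulr0 mul0r scale0r subr0.
have gg : g *m reflection g = - g by rewrite reflectE cox_self// scaler_nat mulr2n opprD addrA subrr add0r.
pose F alpha : C := (cox alpha g ^+ 2 * cox alpha v)%:C * T alpha alpha alpha g.
(* If cox alpha g = 1, then t vanishing at alpha, g and alpha - g gives 2 x - 3 y + 2 z = 0, which
   reduces F alpha + F (s_g alpha) to the term in T(alpha, g, g, g). The value -1 is treated
   likewise with alpha + g. *)
have S1 : \sum_(alpha <- Pos) F alpha = \sum_(alpha <- Pos) (1 / 2)%:C *
    ((cox alpha g ^+ 2 * cox alpha v)%:C * T alpha g g g).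
  have gT : reflection g *m (reflection g)^T = 1%:M by rewrite trmx_reflection reflection_invol.
  have gS alpha : alpha \in Phi -> alpha *m reflection g \in Phi.
    by move=> aP; apply: (root_stable Phi_root) => //; exact: pos_root gP.
  have FN alpha : alpha \in Phi -> F (- alpha) = F alpha.
    move=> _; rewrite /F !coxNl !(N1, N2, N3).
    by move: (cox alpha g) (cox alpha v) (T _ _ _ _) => x y z; ring.
  have SS : \sum_(alpha <- Pos) F alpha = \sum_(alpha <- Pos) (1 / 2)%:C * (F alpha + F (alpha *m reflection g)).
    rewrite -mulr_sumr big_split /= (big_pos_perm Phi_root Delta_simple _ gT gS FN).
    have e : (1 / 2)%:C + (1 / 2)%:C = 1 :> C.
      by rewrite -rmorphD /= -(rmorph1 (real_complex R)); congr (_%:C); field.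
    by rewrite mulrDr -mulrDl e mul1r.
  rewrite SS; apply: eq_big_seq => alpha aP; congr (_ * _).
  have a0 := pos_nonzero Phi_root aP.
  have c1 : cox (alpha *m reflection g) g = - cox alpha g.
    transitivity (cox (alpha *m reflection g) (- (g *m reflection g))); first by rewrite gg opprK.
    by rewrite coxNr /cox !dot_reflect.
  have c2 : cox (alpha *m reflection g) v = cox alpha v.
    transitivity (cox (alpha *m reflection g) (v *m reflection g)); first by rewrite vg.
    by rewrite /cox !dot_reflect.
  have ta := t0 _ aP; have tg := t0 _ gP; have tag := t0' _ (gS _ (pos_root aP)).
  have cgs : cox g alpha = cox alpha g.
    by rewrite /cox dotC (root_len (pos_root aP)) (root_len (pos_root gP)).
  rewrite /F c1 c2 sqrrN; move: tag; rewrite reflectE cgs !(B1, B2, B3, B4).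
  rewrite !(p12 g alpha, p23 _ g alpha, p34 _ _ g alpha) ta tg.
  move: (T alpha alpha alpha g) (T alpha alpha g g) (T alpha g g g) => x y z.
  have [E|E|E|[E aE]] := cox_int aP gP; rewrite E.
  - by rewrite expr0n mul0r rmorph0 !mul0r addr0.
  - rewrite expr1n mul1r rmorph1 => e.
    have : 2 * (2 * x - 3 * y + 2 * z) = 0 by rewrite -[RHS](mulr0 (-1)) -e; ring.
    move/eqP; rewrite mulf_eq0 pnatr_eq0 /= => /eqP e2; apply/eqP; rewrite -subr_eq0; apply/eqP.
    by move: (cox alpha v)%:C => D; transitivity (D * (2 * x - 3 * y + 2 * z)); [ring|rewrite e2 mulr0].
  - rewrite sqrrN expr1n mul1r rmorphN rmorph1 => e.
    have : 2 * (2 * x + 3 * y + 2 * z) = 0 by rewrite -[RHS]e; ring.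
    move/eqP; rewrite mulf_eq0 pnatr_eq0 /= => /eqP e2; apply/eqP; rewrite -subr_eq0; apply/eqP.
    by move: (cox alpha v)%:C => D; transitivity (D * (2 * x + 3 * y + 2 * z)); [ring|rewrite e2 mulr0].
  - have cv : cox alpha v = 0 by rewrite aE /cox gv mulr0 mul0r.
    by rewrite cv (mulr0 (_ ^+ 2)) rmorph0 !mul0r addr0.
have S2 : \sum_(alpha <- Pos) (cox alpha g ^+ 2 * cox alpha v)%:C * T alpha g g g = lam%:C * T g g g v.
  rewrite (eq_big_seq (fun alpha => (cox alpha g * cox alpha g)%:C * ((2 / L * dot alpha v)%:C * T alpha g g g))).
    rewrite (@design_bilin (fun x y => (2 / L * dot x v)%:C * T y g g g)); first last.
    - by move=> y r x x'; rewrite dotDl dotZl !(rmorphM, rmorphD) /=; ring.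
    - by move=> x r y y'; rewrite l1; ring.
    rewrite gv mulr0 rmorph0 mul0r !addr0 (root_len (pos_root gP)).
    have -> : \sum_i (2 / L * dot (e_ i) v)%:C * T (e_ i) g g g = (2 / L)%:C * T v g g g.
      rewrite (lin_coord (l1 g g g) v) mulr_sumr; apply: eq_bigr => i _.
      by rewrite dotC dot_delta rmorphM mulrA.
    rewrite (p12 v) (p23 _ v) (p34 _ _ v) !mulrA -!rmorphM /=; congr (_%:C * _).
    by field; exact: L_neq0.
  move=> alpha aP; rewrite mulrA -rmorphM /=; congr (_%:C * _).
  have -> : cox alpha v = 2 / L * dot alpha v by rewrite /cox (root_len (pos_root aP)) mulrAC.
  by rewrite expr2.
apply: (eigen_eq Tg); rewrite degree4E.
rewrite (eq_big_seq (fun alpha => (cox alpha g ^+ 3)%:C * T alpha alpha alpha v + 3 * F alpha)); last first.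
  move=> alpha aP; rewrite /F (t0 _ aP); move: (cox alpha g) (cox alpha v) => x y.
  by rewrite !exprS expr0 mulr1 !rmorphM /=; ring.
rewrite big_split -mulr_sumr S1 -mulr_sumr S2 /= (sum_cox3 (fun x => T x x x v))// D3.
have -> : (4 * h - 6 * lam + 6 + 3 / 2 * lam)%:C = (4 * h - 6 * lam)%:C + 6 + 3 * ((1 / 2)%:C * lam%:C).
  have -> : 4 * h - 6 * lam + 6 + 3 / 2 * lam = (4 * h - 6 * lam) + 6 + 3 * (1 / 2 * lam) by field.
  by move: (1 / 2) => w; ring.
by ring.
Qed.

(** Either T is nonzero on the fourth power of a root, or it is zero on those but nonzero at some
    (g, g, g, v), or no root sum survives in [degree4E]. *)
Lemma degree4 a b c d : T a b c d != 0 ->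
  [\/ k <= 4 * h - 6 * lam + 12, k = 4 * h - 6 * lam + 6 + 3 / 2 * lam | k = 4 * h - 6 * lam].
Proof.
move=> T0; have [h1|] := pselect (forall g, g \in Pos -> t g = 0); last first.
  by move=> /existsNP[g /not_implyP[gP /eqP tg]]; constructor 1; exact: case_top gP tg.
have [h2|] := pselect (forall g v, g \in Pos -> T g g g v = 0); last first.
  move=> /existsNP[g /existsNP[v /not_implyP[gP /eqP Tg]]]; constructor 2.
  have gL := root_len (pos_root gP).
  (* Removing the component along g makes v orthogonal to g and keeps T(g, g, g, v), since T(g, g,
     g, g) = 0. *)
  apply: (@case_mid g (v - (dot g v / L) *: g)) => //.
    by rewrite dotBr dotZr gL divfK// subrr.
  by rewrite B4 h1// mulr0 subr0.
constructor 3; apply: (eigen_eq T0); rewrite degree4E big1_seq ?addr0// => alpha /andP[_ aP].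
by rewrite !h2// !mulr0 !addr0 subrr.
Qed.

End Degree4.

End SimplyLaced.

(** * Polynomials as tensors, and bounds on [KK] *)

Section SimplyLacedBounds.
Variables (R : realType) (N : nat).
Local Notation C := R[i].
Local Notation P := (cpoly R N).
Local Notation V := 'rV[R]_N.
Implicit Types (f u : P) (v w x y alpha beta : V) (vs : seq V).
Variables (Phi : seq V) (Delta : N.-tuple V).
Hypothesis Phi_root : root_system Phi.
Hypothesis Delta_simple : simple_system Phi Delta.
Local Notation Pos := (positive_roots Phi Delta).
Local Notation KK := (@KK R N Phi Delta).
Local Notation e_ i := (delta_mx 0 i : V).
Local Notation ders := (foldr (@dird R N)).

Lemma ders0 vs : ders 0 vs = 0.
Proof. by elim: vs => //= v vs ->; rewrite dird0. Qed.

Lemma dersD vs f g : ders (f + g) vs = ders f vs + ders g vs.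
Proof. by elim: vs => //= v vs ->; rewrite dirdD. Qed.

Lemma dersZ vs a f : ders (a *: f) vs = a *: ders f vs.
Proof. by elim: vs => //= v vs ->; rewrite dirdZ. Qed.

Lemma dersB vs f g : ders (f - g) vs = ders f vs - ders g vs.
Proof. by elim: vs => //= v vs ->; rewrite dirdB. Qed.

Lemma ders_refl vs alpha f :
  ders (refl alpha f) vs = refl alpha (ders f [seq v *m reflection alpha | v <- vs]).
Proof. by elim: vs => //= v vs ->; rewrite dird_refl. Qed.

Lemma pev_ders_KK vs f : pev (ders (KK f) vs) 0 = \sum_(alpha <- Pos)
  (pev (ders f vs) 0 - pev (ders f [seq v *m reflection alpha | v <- vs]) 0).
Proof.
rewrite KKE (big_morph (fun g => ders g vs) (id1 := 0) (op1 := +%R)); first last.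
- exact: ders0.
- by move=> g g'; exact: dersD.
rewrite pev_sum; apply: eq_bigr => alpha _.
by rewrite dersB pevB ders_refl pev0_refl.
Qed.

Lemma lap_ders vs f : lap (ders f vs) = ders (lap f) vs.
Proof. by elim: vs => //= v vs <-; rewrite lap_dird. Qed.

Lemma hom_neq0 m f : hom m f -> f != 0 -> exists2 vs, size vs = m & pev (ders f vs) 0 != 0.
Proof.
elim: m f => [|m IH] f hf f0.
  by exists [::] => //=; apply: contraNneq f0 => /(pev_hom0 hf) ->.
have [v dv] : exists v, dird v f != 0.
  apply: contrapT => h; case/eqP: f0; apply: (dird_eq0 hf) => v.
  by apply/eqP; apply: contrapT => /negP dv; apply: h; exists v.
have [vs vm hvs] := IH _ (hom_dird v hf) dv.
by exists (rcons vs v); rewrite ?size_rcons ?vm// foldr_rcons.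
Qed.

Variables (L h lam : R).
Hypothesis L_gt0 : 0 < L.
Hypothesis root_len : forall alpha, alpha \in Phi -> dot alpha alpha = L.
Hypothesis total : forall v, \sum_(alpha <- Pos) cox alpha v *: alpha = h *: v.
Hypothesis design : forall u v x y : V,
  \sum_(alpha <- Pos) cox alpha u * cox alpha v * (dot alpha x * dot alpha y) =
  lam / 2 * (dot u v * dot x y + dot u x * dot v y + dot u y * dot v x).
Hypothesis cox_int : forall alpha beta, alpha \in Pos -> beta \in Pos ->
  [\/ cox alpha beta = 0, cox alpha beta = 1, cox alpha beta = -1 |
      cox alpha beta = 2 /\ alpha = beta].

Lemma bd1 : bd Phi Delta 1 h.
Proof.
apply: (eigen_bd Phi_root) => k u hu u0 ku.
have := KK_hom1 Delta_simple (fun i => total (tnth Delta i)) hu.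
by rewrite ku => /eqP; rewrite -subr_eq0 -scalerBl scaler_eq0 (negbTE u0) orbF subr_eq0 => /eqP/complexI ->.
Qed.

Lemma bd0 : bd Phi Delta 0 0.
Proof.
apply: (eigen_bd Phi_root) => k u hu u0 ku.
have [a aE] := hom0E hu; have K0 : KK u = 0.
  rewrite KKE big1// => alpha _; rewrite aE reflZ /refl lsub_one; exact: subrr.
move: ku; rewrite K0 => /esym/eqP; rewrite scaler_eq0 (negbTE u0) orbF.
by rewrite -(rmorph0 (real_complex R)) (inj_eq (@complexI R)) => /eqP ->.
Qed.

(** [KK] commutes with the Laplacian, so an eigenvector that is not harmonic passes its eigenvalue
    down two degrees. *)
Lemma bd_descend m (M M' : R) : bd Phi Delta m M' -> M' <= M ->
  (forall k u, hom m.+2 u -> u != 0 -> KK u = k%:C *: u -> lap u = 0 -> k <= M) ->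
  bd Phi Delta m.+2 M.
Proof.
move=> bm MM hk; apply: (eigen_bd Phi_root) => k u hu u0 ku.
have [l0|l0] := eqVneq (lap u) 0; first exact: hk ku l0.
have hl : hom m (lap u) by exact: (hom_lap hu).
apply: le_trans MM; apply: (bd_eigen bm hl l0).
rewrite -(lap_KK Delta Phi_root) ku /lap scaler_sumr; apply: eq_bigr => i _.
by rewrite !dirdZ.
Qed.

Section Eigen.
Variables (k : R) (u : P).
Hypothesis ku : KK u = k%:C *: u.
Hypothesis lap0 : lap u = 0.

Let D vs := pev (ders u vs) 0.

Let D_eig vs : k%:C * D vs = \sum_(alpha <- Pos) (D vs - D [seq v *m reflection alpha | v <- vs]).
Proof. by rewrite -pev_ders_KK ku dersZ pevZ. Qed.

Let D_lin vs : lin (fun x => D (x :: vs)).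
Proof. by apply: pev_dird_lin => a x y /=; exact: dird_lin. Qed.

Let D_tr vs : \sum_i D [:: e_ i, e_ i & vs] = 0.
Proof. by rewrite -pev_sum /= -/(lap (ders u vs)) lap_ders lap0 ders0 pev0. Qed.

Let D12 a b vs : D [:: a, b & vs] = D [:: b, a & vs].
Proof. by rewrite /D /= dird_comm. Qed.

Let D23 a b c vs : D [:: a, b, c & vs] = D [:: a, c, b & vs].
Proof. by rewrite /D /= (dird_comm b). Qed.

Let D34 a b c d vs : D [:: a, b, c, d & vs] = D [:: a, b, d, c & vs].
Proof. by rewrite /D /= (dird_comm c). Qed.

Lemma eigen2 : hom 2 u -> u != 0 -> k = 2 * h - lam.
Proof.
move=> hu u0; have [[|a [|b []]]// _ D0] := hom_neq0 hu u0.
apply: (eigen_eq D0); apply: (@degree2 _ _ _ _ _ _ total design (fun a b => D [:: a; b])).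
- by move=> b'; exact: D_lin.
- by move=> a' r x y; rewrite !(D12 a') D_lin.
- by move=> a' b'; exact: D12.
- exact: D_tr.
- by move=> a' b'; exact: D_eig.
Qed.

Lemma eigen3 : hom 3 u -> u != 0 -> k = 3 * h - 3 * lam \/ k = 3 * h - 3 * lam + 6.
Proof.
move=> hu u0; have [[|a [|b [|c []]]]// _ D0] := hom_neq0 hu u0.
apply: (@degree3 _ _ _ _ Phi_root _ _ _ L_gt0 root_len total design cox_int (fun a b c => D [:: a; b; c]) _ _ _ _ _ _ a b c D0).
- by move=> b' c'; exact: D_lin.
- by move=> *; exact: D12.
- by move=> *; exact: D23.
- by move=> c'; exact: D_tr.
- by move=> a' b' c'; exact: D_eig.
Qed.

Lemma eigen4 : hom 4 u -> u != 0 ->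
  [\/ k <= 4 * h - 6 * lam + 12, k = 4 * h - 6 * lam + 6 + 3 / 2 * lam | k = 4 * h - 6 * lam].
Proof.
move=> hu u0; have [[|a [|b [|c [|d []]]]]// _ D0] := hom_neq0 hu u0.
apply: (@degree4 _ _ _ _ Phi_root Delta_simple _ _ _ L_gt0 root_len total design cox_int (fun a b c d => D [:: a; b; c; d]) _ _ _ _ _ _ _ a b c d D0).
- by move=> b' c' d'; exact: D_lin.
- by move=> *; exact: D12.
- by move=> *; exact: D23.
- by move=> *; exact: D34.
- by move=> c' d'; exact: D_tr.
- by move=> a' b' c' d'; exact: D_eig.
Qed.

End Eigen.

Lemma bd2 : 0 <= 2 * h - lam -> bd Phi Delta 2 (2 * h - lam).
Proof.
move=> h0; apply: (bd_descend bd0 h0) => k u hu u0 ku l0.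
by rewrite (eigen2 ku l0 hu u0).
Qed.

Lemma bd3 M : h <= M -> 3 * h - 3 * lam + 6 <= M -> bd Phi Delta 3 M.
Proof.
move=> h1 h2; apply: (bd_descend bd1 h1) => k u hu u0 ku l0.
by have [->|->] := eigen3 ku l0 hu u0; lra.
Qed.

Lemma bd4 M : 0 <= 2 * h - lam -> 2 * h - lam <= M -> 4 * h - 6 * lam + 12 <= M ->
  4 * h - 6 * lam + 6 + 3 / 2 * lam <= M -> bd Phi Delta 4 M.
Proof.
move=> h0 h1 h2 h3; apply: (bd_descend (bd2 h0) h1) => k u hu u0 ku l0.
by have [k1|->|->] := eigen4 ku l0 hu u0; lra.
Qed.

End SimplyLacedBounds.

(** * Reflection spectrum by computation *)

(* The matrix of KK on the monomials of given degree in the simple roots.     *)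
Section WordSpectrum.
Variables (n : nat) (C : seq (seq zp)) (X : seq (seq zp)).

Definition term := (zp * seq nat)%type.

Definition image_row x i : seq zp :=
  [seq zadd (if k == i then z1 else z0) (zopp (zmul (cxn n C x i) (nth z0 x k))) | k <- iota 0 n].

Fixpoint expand x (w : seq nat) : seq term :=
  if w is i :: w' then let r := image_row x i in let ts := expand x w' in
    [seq (zmul (nth z0 r k) t.1, k :: t.2) | k <- iota 0 n, t <- ts]
  else [:: (z1, [::])].

Definition kterms w : seq term :=
  flatten [seq (z1, w) :: [seq (zopp t.1, t.2) | t <- expand x w] | x <- X].

Fixpoint words m : seq (seq nat) :=
  if m is m'.+1 then [seq i :: w | i <- iota 0 n, w <- words m'] else [:: [::]].

(** A sorted word is the representative of its monomial. *)
Definition basis m := undup [seq sort leq w | w <- words m].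

Definition krow (B : seq (seq nat)) w : seq zp :=
  let ts := [seq (t.1, sort leq t.2) | t <- kterms w] in
  [seq zsum [seq t.1 | t <- ts & t.2 == b] | b <- B].

Definition kapply (T : seq (seq zp)) (s : nat) (v : seq zp) : seq zp :=
  [seq zsum [seq zmul (nth z0 v a) (nth z0 (nth [::] T a) b) | a <- iota 0 s] | b <- iota 0 s].

Definition kshift T s (kap : zp) (v : seq zp) : seq zp :=
  let v' := kapply T s v in
  [seq zadd (nth z0 v' b) (zopp (zmul kap (nth z0 v b))) | b <- iota 0 s].

(** The first condition makes the matrix [T] represent [KK], no term falling outside the basis; the
    second says that the product of the [KK] - kap kills each basis monomial. *)
Definition spectrum_check m (kaps : seq zp) :=
  let B := basis m in
  let s := size B in
  let T := [seq krow B w | w <- B] in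
  all (fun w => all (fun t => sort leq t.2 \in B) (kterms w)) B &&
  all (fun a => all (fun z => z == z0) (foldr (kshift T s) (evec s a) kaps)) (iota 0 s).

End WordSpectrum.

(** * Correctness of the computed spectrum *)

Section WordModel.
Variables (R : realType) (n : nat).
Local Notation V := 'rV[R]_n.
Local Notation P := (cpoly R n).
Variables (Phi : seq V) (Delta : n.-tuple V).
Hypothesis Phi_root : root_system Phi.
Hypothesis Delta_simple : simple_system Phi Delta.
Local Notation Pos := (positive_roots Phi Delta).
Local Notation simple i := (tnth Delta i).
Local Notation zval := (@zval R).
Local Notation KK := (@KK R n Phi Delta).
Variables (C : seq (seq zp)) (L : R).
Hypothesis L_gt0 : 0 < L.
Hypothesis dot_simple : forall i j : 'I_n, dot (simple i) (simple j) = L / 2 * zval (cm C i j).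
Hypothesis dot_self : forall i : 'I_n, dot (simple i) (simple i) = L.
Variable X : seq (seq zp).
Hypothesis X_rootlike : forall x, x \in X -> rootlike Phi Delta L x.
Hypothesis X_closed : closed_check n C X.
Implicit Types (w : seq nat) (f g u : P) (ts : seq term).
Local Notation vec := (@root_vec R n Delta).

Definition wmon w : P := \prod_(i <- w) lform (nth 0 Delta i).
Definition tval ts : P := \sum_(t <- ts) (zval t.1)%:C *: wmon t.2.

Let wmon_cons i w : wmon (i :: w) = lform (nth 0 Delta i) * wmon w.
Proof. by rewrite /wmon big_cons. Qed.

Let wmon_sort w : wmon (sort leq w) = wmon w.
Proof. by apply: perm_big; rewrite perm_sort. Qed.

Let lform_row (r : 'I_n -> R) : lform (\sum_k r k *: simple k) =
  \sum_k (r k)%:C *: lform (nth 0 Delta k).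
Proof.
rewrite (big_morph (@lform R n) (@linear_formD R n) (@linear_form0 R n)).
by apply: eq_bigr => k _; rewrite linear_formZ (tnth_nth 0).
Qed.

Let refl_simple x i : x \in X -> (i < n)%N -> refl (vec x) (lform (nth 0 Delta i)) =
  \sum_(k <- iota 0 n) (zval (nth z0 (image_row n C x i) k))%:C *: lform (nth 0 Delta k).
Proof.
move=> xX iN; pose i' := Ordinal iN.
have x0 : vec x != 0 by have [_ _ xP _] := X_rootlike xX; exact: (root_nonzero Phi_root xP).
have -> : nth 0 Delta i = simple i' by rewrite (tnth_nth 0).
rewrite refl_lf// -linear_formZ -linear_formB (cox_vec L_gt0 dot_simple X_rootlike i' xX).
have -> : simple i' - zval (cxn n C x i') *: vec x =
    \sum_(k < n) zval (nth z0 (image_row n C x i) k) *: simple k.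
  rewrite -(vec_evec Delta i') /root_vec scaler_sumr -sumrB; apply: eq_bigr => k _.
  rewrite /image_row !(nth_map 0%N) ?size_iota// !nth_iota// !add0n zvalD zvalN zvalM.
  by rewrite scalerBl scalerA.
by rewrite lform_row -(big_mkord xpredT (fun k => (zval (nth z0 (image_row n C x i) k))%:C *: lform (nth 0 Delta k))) /index_iota subn0.
Qed.

Let refl_wmon x w : x \in X -> all (fun i => (i < n)%N) w ->
  refl (vec x) (wmon w) = tval (expand n C x w).
Proof.
move=> xX; elim: w => [_|i w IH] /=.
  by rewrite /tval big_seq1 zval1 scale1r /wmon big_nil /refl lsub_one.
case/andP=> iN /IH {}IH; rewrite wmon_cons reflM IH refl_simple//.
rewrite /tval big_allpairs_dep mulr_suml; apply: eq_bigr => k _.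
rewrite mulr_sumr; apply: eq_bigr => t _ /=.
by rewrite wmon_cons zvalM rmorphM /= -scalerAl -scalerAr scalerA.
Qed.

Let KK_wmon w : all (fun i => (i < n)%N) w -> KK (wmon w) = tval (kterms n C X w).
Proof.
move=> wn; rewrite KKE (big_pos Phi_root Delta_simple L_gt0 dot_simple dot_self X_rootlike X_closed).
rewrite /tval /kterms big_flatten big_map; apply: eq_big_seq => x xX.
rewrite big_cons big_map zval1 scale1r refl_wmon// /tval -sumrN; congr (_ + _).
by apply: eq_bigr => t _; rewrite zvalN rmorphN scaleNr.
Qed.

Let words_lt m w : w \in words n m -> all (fun i => (i < n)%N) w.
Proof.
elim: m w => [|m IH] w /=; first by rewrite inE => /eqP ->.
by move=> /allpairsP[[i w'] [/= + /IH h ->]]; rewrite mem_iota add0n /= => ->.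
Qed.

Let words_mem m w : size w = m -> all (fun i => (i < n)%N) w -> w \in words n m.
Proof.
elim: m w => [|m IH] [|i w]//= [wm] /andP[iN wn].
by apply/allpairsP; exists (i, w); rewrite /= mem_iota add0n iN IH.
Qed.

Let basis_lt m w : w \in basis n m -> all (fun i => (i < n)%N) w.
Proof.
by rewrite mem_undup => /mapP[v /words_lt vn ->]; rewrite all_sort.
Qed.

Variables (m : nat) (kaps : seq zp).
Hypothesis check : spectrum_check n C X m kaps.
Local Notation W := (basis n m).
Local Notation s := (size W).
Local Notation T := [seq krow n C X W w | w <- W].

Definition cval (v : seq zp) : P := \sum_(a < s) (zval (nth z0 v a))%:C *: wmon (nth [::] W a).

Let KK_basis (a : 'I_s) : KK (wmon (nth [::] W a)) =
  \sum_(b < s) (zval (nth z0 (nth [::] T a) b))%:C *: wmon (nth [::] W b).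
Proof.
have aW : nth [::] W a \in W by exact: mem_nth.
have /andP[/allP/(_ _ aW)/allP hb _] := check.
rewrite KK_wmon ?(basis_lt aW)// (nth_map [::])//.
transitivity (\sum_(b <- W) \sum_(t <- kterms n C X (nth [::] W a) | sort leq t.2 == b)
    (zval t.1)%:C *: wmon b).
  rewrite /tval (exchange_big_dep xpredT)//=; apply: eq_big_seq => t tk.
  rewrite (big_rem (sort leq t.2)) ?hb//= eqxx wmon_sort big1_seq ?addr0// => b /andP[/eqP <-].
  by rewrite mem_rem_uniq ?undup_uniq// !inE eqxx.
rewrite (big_nth [::]) big_mkord; apply: eq_bigr => b _.
rewrite /krow (nth_map [::])// -scaler_suml -rmorph_sum zval_sum big_map big_filter big_map.
by congr (_%:C *: _); apply: eq_bigl.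
Qed.

Let KK_cval v : KK (cval v) = cval (kapply T s v).
Proof.
rewrite /cval KK_sum.
transitivity (\sum_(a < s) \sum_(b < s) ((zval (nth z0 v a) * zval (nth z0 (nth [::] T a) b))%:C) *: wmon (nth [::] W b)).
  apply: eq_bigr => a _; rewrite KKZ KK_basis scaler_sumr; apply: eq_bigr => b _.
  by rewrite scalerA rmorphM.
rewrite exchange_big; apply: eq_bigr => b _; rewrite -scaler_suml -rmorph_sum; congr (_%:C *: _).
rewrite (nth_map 0%N) ?size_iota// nth_iota// add0n zval_iota.
by apply: eq_bigr => a _; rewrite zvalM.
Qed.

Definition shift (kap : zp) f : P := KK f - (zval kap)%:C *: f.

Let shift_cval kap v : shift kap (cval v) = cval (kshift T s kap v).
Proof.
rewrite /shift KK_cval /cval scaler_sumr -sumrB; apply: eq_bigr => b _.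
rewrite {1}/kshift (nth_map 0%N) ?size_iota// nth_iota// add0n zvalD zvalN zvalM.
by rewrite rmorphB rmorphM scalerBl scalerA.
Qed.

Definition shifts f := foldr shift f kaps.

Let shifts_basis w : w \in W -> shifts (wmon w) = 0.
Proof.
move=> wW; have iW : (index w W < s)%N by rewrite index_mem.
have wE : wmon w = cval (evec s (index w W)).
  rewrite /cval (bigD1 (Ordinal iW))//= nth_index// (nth_map 0%N) ?size_iota// nth_iota// add0n eqxx.
  rewrite zval1 scale1r big1 ?addr0// => a ai.
  rewrite (nth_map 0%N) ?size_iota// nth_iota// add0n ifN ?zval0 ?scale0r//.
have /andP[_ /allP/(_ (index w W))] := check; rewrite mem_iota add0n iW => /(_ isT) h.
have -> : shifts (wmon w) = cval (foldr (kshift T s) (evec s (index w W)) kaps).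
  by rewrite /shifts wE; elim: (kaps) => //= kap ks ->; rewrite shift_cval.
rewrite /cval big1// => a _.
have -> : nth z0 (foldr (kshift T s) (evec s (index w W)) kaps) a = z0.
  case: (ltnP a (size (foldr (kshift T s) (evec s (index w W)) kaps))) => ha.
    by apply/eqP; move/allP: h; apply; exact: mem_nth.
  by rewrite nth_default.
by rewrite zval0 scale0r.
Qed.

Let shiftsD f g : shifts (f + g) = shifts f + shifts g.
Proof.
rewrite /shifts; elim: (kaps) => //= kap ks ->.
by rewrite /shift KKD scalerDr opprD addrACA.
Qed.

Let shiftsZ a f : shifts (a *: f) = a *: shifts f.
Proof.
rewrite /shifts; elim: (kaps) => //= kap ks ->.
by rewrite /shift KKZ scalerBr !scalerA mulrC.
Qed.

Let word_span d f : hom d f -> exists r : seq (R[i] * seq nat),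
  all (fun t => (size t.2 == d) && all (fun i => (i < n)%N) t.2) r /\
  f = \sum_(t <- r) t.1 *: wmon t.2.
Proof.
move: d f; apply: hom_ind => [a|d|d f g [r [hr ->]] [r' [hr' ->]]|d a f [r [hr ->]]|d i f _ [r [hr ->]]].
- by exists [:: (a, [::])]; rewrite big_seq1 /wmon big_nil.
- by exists [::]; rewrite big_nil.
- by exists (r ++ r'); rewrite all_cat hr hr' big_cat.
- exists [seq (a * t.1, t.2) | t <- r]; rewrite all_map big_map scaler_sumr; split=> //.
  by apply: eq_bigr => t _; rewrite scalerA.
- have [k kE] := simple_span Delta_simple (delta_mx 0 i).
  exists [seq ((k j)%:C * t.1, (j : nat) :: t.2) | j <- enum 'I_n, t <- r]; split.
    apply/allP => _ /allpairsP[[j t] [/= _ tr ->]] /=.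
    by move/allP: hr => /(_ t tr); rewrite eqSS ltn_ord.
  rewrite big_allpairs_dep -linear_form_delta kE lform_row big_enum /= mulr_suml; apply: eq_bigr => j _.
  rewrite mulr_sumr; apply: eq_bigr => t _ /=.
  by rewrite wmon_cons -scalerAl -scalerAr scalerA.
Qed.

(** Forms of degree m are combinations of words, so the product of the [KK] - kap kills u; on an
    eigenvector it acts by the scalar prod (k - kap). *)
Lemma spectrum k u : hom m u -> u != 0 -> KK u = k%:C *: u -> exists2 kap, kap \in kaps & k = zval kap.
Proof.
move=> hu u0 ku.
have s0 : shifts u = 0.
  have [r [hr ->]] := word_span hu.
  rewrite (big_morph shifts (id1 := 0) (op1 := +%R)); first last.
  - by have := shiftsZ 0 0; rewrite !scale0r.
  - exact: shiftsD.
  rewrite big1_seq// => t /andP[_ tr]; rewrite shiftsZ -wmon_sort.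
  move/allP: hr => /(_ t tr)/andP[/eqP tm tn].
  by rewrite shifts_basis ?scaler0// mem_undup map_f// words_mem.
have E : shifts u = (\prod_(kap <- kaps) (k - zval kap))%:C *: u.
  rewrite /shifts; elim: (kaps) => [|kap ks IH] /=; first by rewrite big_nil scale1r.
  rewrite IH big_cons /shift KKZ ku !scalerA -scalerBl; congr (_ *: _).
  by rewrite mulrC -mulrBl -rmorphB -rmorphM.
move/eqP: s0; rewrite E scaler_eq0 (negbTE u0) orbF -(rmorph0 (real_complex R)).
rewrite (inj_eq (@complexI R)) prodf_seq_eq0 => /hasP[kap kk /=].
by rewrite subr_eq0 => /eqP ->; exists kap.
Qed.

End WordModel.

(** * The three types *)

Definition zn (k : nat) : zp := iter k (zadd z1) z0.

Lemma zval_zn (R : realType) k : zval R (zn k) = k%:R.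
Proof. by elim: k => [|k IH]; rewrite ?zval0//= zvalD zval1 IH mulrS. Qed.

Section ConvergenceCheck.
Variables (n : nat) (C X : seq (seq zp)) (k h p q p1 q1 : nat) (special : seq nat).

Definition total_check := all (sum_check n C X predT (zn h)) (iota 0 n).

Definition special_check j := all (fun i => (i == j) ||
  sum_check n C X (fun x => nth z0 x j == z0) (zn k) i) (iota 0 n).

(* Here c = 1 / k, and the density is compared with t_i^(- 19 / 20) in each   *)
(* simple coordinate t_i.                                                     *)
Definition exponent_check := [&& (0 < q)%N, (0 < q1)%N, (40 * p <= 19 * q * k)%N,
  (2 * p1 <= q1 * k)%N, (40 * size X <= (80 + 19 * n) * k)%N & (n <= 40)%N].

(** Here p / q bounds the roots per node of the proper parabolics that are not special, for the
    exponent 19 / 20, and p1 / q1 those of all proper parabolics, for the exponent 1. *)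
Definition convergence_check := [&& exponent_check, total_check, all special_check special,
  count_check n X p q special, count_check n X p1 q1 [::],
  [&& (1 < n)%N, (0 < k)%N, h != k, (0 < size special)%N & all (fun j => (j < n)%N) special] &
  closed_check n C X].

End ConvergenceCheck.

(** * From the checks to convergence and unitarity *)

Section Certified.
Variables (R : realType) (n : nat).
Local Notation V := 'rV[R]_n.
Local Notation P := (cpoly R n).
Variables (Phi : seq V) (Delta : n.-tuple V).
Hypothesis Phi_root : root_system Phi.
Hypothesis Delta_simple : simple_system Phi Delta.
Local Notation Pos := (positive_roots Phi Delta).
Local Notation simple i := (tnth Delta i).
Local Notation zval := (@zval R).
Variables (C : seq (seq zp)) (L : R).
Hypothesis L_gt0 : 0 < L.
Hypothesis dot_simple : forall i j : 'I_n, dot (simple i) (simple j) = L / 2 * zval (cm C i j).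
Hypothesis dot_self : forall i : 'I_n, dot (simple i) (simple i) = L.
Variables (fuel k h p q p1 q1 : nat) (special : seq nat).
Let X := roots n C fuel.
Hypothesis check : convergence_check n C X k h p q p1 q1 special.
Let c : R := 1 / k%:R.

Let X_rootlike := roots_rootlike Phi_root Delta_simple L_gt0 dot_simple dot_self (fuel := fuel).

Let X_closed : closed_check n C X.
Proof. by case/and5P: check => _ _ _ _ /and3P[]. Qed.

Let k_gt0 : (0 < k)%N. Proof. by case/and5P: check => _ _ _ _ /and3P[_ /and5P[]]. Qed.

Let n_gt1 : (1 < n)%N. Proof. by case/and5P: check => _ _ _ _ /and3P[_ /and5P[]]. Qed.

Let kR : 0 < k%:R :> R. Proof. by rewrite ltr0n. Qed.

Let c_gt0 : 0 < c. Proof. by rewrite divr_gt0. Qed.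

Let ck : c * k%:R = 1. Proof. by rewrite /c div1r mulVf ?gt_eqF. Qed.

Let ch_neq1 : c * h%:R != 1.
Proof.
have hk : h != k by case/and5P: check => _ _ _ _ /and3P[_ /and5P[]].
apply: contraNneq hk => e; rewrite -(eqr_nat R); apply/eqP.
by apply: (mulfI (lt0r_neq0 c_gt0)); rewrite e ck.
Qed.

Let big_pos := big_pos Phi_root Delta_simple L_gt0 dot_simple dot_self X_rootlike X_closed.

Lemma total_sum_cert (i : 'I_n) : \sum_(alpha <- Pos) cox alpha (simple i) *: alpha = h%:R *: simple i.
Proof.
rewrite big_pos -(zval_zn R h).
apply: (sum_checkP L_gt0 dot_simple X_rootlike (sel := predT)).
case/and5P: check => _ /allP/(_ (i : nat)) + _ _ _; apply.
by rewrite mem_iota add0n ltn_ord.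
Qed.

Variable om : 'I_n -> V.
Hypothesis om_dual : forall i j, dot (om i) (simple j) = (i == j)%:R.

Let spec (j : 'I_n) := (j : nat) \in special.

Lemma special_sum_cert (j i : 'I_n) : spec j -> i != j ->
  \sum_(alpha <- Pos | dot alpha (om j) == 0) cox alpha (simple i) *: alpha = c^-1 *: simple i.
Proof.
move=> js ij; rewrite big_pos.
have -> : c^-1 = zval (zn k) by rewrite /c div1r invrK zval_zn.
transitivity (\sum_(x <- X | nth z0 x j == z0) cox (root_vec Delta x) (simple i) *: root_vec Delta x).
  by apply: eq_bigl => x; exact: vec_coord_eq0.
apply: (sum_checkP L_gt0 dot_simple X_rootlike (sel := fun x => nth z0 x j == z0)).
have /allP/(_ _ js)/allP/(_ (i : nat)) : all (special_check n C X k) special by case/and5P: check.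
by rewrite mem_iota add0n ltn_ord (inj_eq val_inj) (negbTE ij) => /(_ isT).
Qed.

Let special_ex : exists j, spec j.
Proof.
have [s0 sn] : (0 < size special)%N /\ all (fun j => (j < n)%N) special.
  by case/and5P: check => _ _ _ _ /and3P[_ /and5P[]].
have j0 := mem_nth 0%N s0; have jn := allP sn _ j0.
by exists (Ordinal jn).
Qed.

Let th : R := 19 / 20.
Let crd (alpha : V) i := dot alpha (om i).
Local Notation exc := (excess Pos crd).

Let excess_ge0' J : J != finset.setT -> (forall j, spec j -> J != finset.setT :\ j) -> 0 <= exc th c J.
Proof.
have [[q0 pq] cc sn] : [/\ (0 < q)%N /\ (40 * p <= 19 * q * k)%N, count_check n X p q special
    & all (fun j => (j < n)%N) special].
  case/and5P: check => /and5P[? ? ? ? _] _ _ ? /and3P[_ /and5P[_ _ _ _ ?] _].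
  by split.
move=> JT Jsp.
apply: (excess_ge0 Phi_root Delta_simple L_gt0 dot_simple dot_self X_rootlike X_closed om_dual cc) => //.
- exact: ltW.
- move: pq; rewrite -(ler_nat R) !natrM => pq.
  suff : 0 <= c * (19 * q%:R * k%:R - 40 * p%:R).
    have -> : c * (19 * q%:R * k%:R - 40 * p%:R) = 19 * q%:R * (c * k%:R) - 40 * c * p%:R by ring.
    rewrite ck /th; lra.
  by apply: mulr_ge0; [exact: ltW | rewrite subr_ge0].
- by move=> j; exact: (allP sn).
Qed.

(** The borderline: an irreducible parabolic of rank r and Coxeter number k has r k / 2 positive
    roots, so with exponent 1 its excess is exactly 0. *)
Let excess_1 J : J != finset.setT -> 0 <= exc 1 c J.
Proof.
have [[q0 pq] cc] : ((0 < q1)%N /\ (2 * p1 <= q1 * k)%N) /\ count_check n X p1 q1 [::].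
  by case/and5P: check => /and5P[? ? ? ? _] _ _ _ /and3P[? _ _].
move=> JT.
apply: (excess_ge0 Phi_root Delta_simple L_gt0 dot_simple dot_self X_rootlike X_closed om_dual cc) => //.
- exact: ltW.
- move: pq; rewrite -(ler_nat R) !natrM => pq.
  suff : 0 <= c * (q1%:R * k%:R - 2 * p1%:R).
    have -> : c * (q1%:R * k%:R - 2 * p1%:R) = q1%:R * (c * k%:R) - 2 * c * p1%:R by ring.
    rewrite ck; lra.
  by apply: mulr_ge0; [exact: ltW | rewrite subr_ge0].
Qed.

(** Lowering the exponent from 1 to 19 / 20 costs one twentieth per node, at most 2 in rank at most
    40. *)
Let excess_special j : spec j -> 0 <= 2 + exc th c (finset.setT :\ j).
Proof.
have n40 : (n <= 40)%N by case/and5P: check => /and5P[_ _ _ _ /andP[]].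
move=> js; have : 0 <= exc 1 c (finset.setT :\ j).
  by apply: excess_1; apply/eqP => /setP/(_ j); rewrite !inE eqxx.
rewrite /excess; set J := #|_|; set cnt := count _ _.
have : J%:R <= 40 :> R.
  by rewrite ler_nat (leq_trans _ n40)// -[X in (_ <= X)%N](card_ord n) max_card.
by rewrite /th mul1r; set x := 2 * c * _; lra.
Qed.

Let excess_total : 0 <= 4 + exc th c finset.setT.
Proof.
have sX : (40 * size X <= (80 + 19 * n) * k)%N by case/and5P: check => /and5P[_ _ _ _ /andP[]].
rewrite /excess cardsT card_ord; set cnt := count _ _.
have cX : (cnt <= size X)%N.
  rewrite -(size_map (root_vec Delta)) -(perm_size (pos_perm_vec Phi_root Delta_simple L_gt0 dot_simple dot_self X_rootlike X_closed)).
  exact: count_size.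
have : 40 * cnt%:R <= (80 + 19 * n%:R) * k%:R :> R.
  by rewrite -!natrM -natrD -natrM ler_nat (leq_trans _ sX)// leq_mul2l cX orbT.
rewrite -subr_ge0 -(pmulr_rge0 _ c_gt0).
have -> : c * ((80 + 19 * n%:R) * k%:R - 40 * cnt%:R) =
  (80 + 19 * n%:R) * (c * k%:R) - 20 * (2 * c * cnt%:R) by ring.
by rewrite ck /th; set x := 2 * c * _; lra.
Qed.

Variable S : set P.
Hypothesis S_min : minimal_submodule Phi Delta c S.

Lemma converges_cert : gaussian_converges Phi Delta c S.
Proof.
apply: (gaussian_converges_minimal Phi_root Delta_simple c_gt0 (th := th) _ _ n_gt1
  (crd := crd) _ _ om_dual excess_ge0' excess_special excess_total special_sum_cert
  special_ex total_sum_cert ch_neq1 S_min).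
- rewrite /th; lra.
- rewrite /th; lra.
- exact: (root_coord Phi_root Delta_simple L_gt0 dot_simple dot_self X_closed om_dual).
- move=> alpha i aP.
  exact: (root_coord_ge1 Phi_root Delta_simple L_gt0 dot_simple dot_self X_rootlike X_closed om_dual).
Qed.

(** Degree 5 follows by subadditivity from degree 4 and degree 1, where [KK] is the scalar h. *)
Lemma unitary_cert (M3 M4 : nat) : (M3 <= k * 3)%N -> (M4 <= k * 4)%N -> (h + M4 <= k * 5)%N ->
  bd Phi Delta 3 M3%:R -> bd Phi Delta 4 M4%:R -> unitary Phi Delta c S.
Proof.
move=> h3 h4 h5 b3 b4.
have b1 := bd1 Phi_root Delta_simple (total_sumE Delta_simple total_sum_cert).
have b5 : bd Phi Delta 5 (h + M4)%:R by rewrite natrD; exact: bd_add b1 b4.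
apply: (unitary_of_bound Phi_root Delta_simple S_min c_gt0).
  move=> m u; apply: (minimal_low Phi_root Delta_simple om_dual (lt0r_neq0 c_gt0) special_sum_cert
    S_min n_gt1 special_ex total_sum_cert ch_neq1).
move=> m m3; rewrite /c div1r invrK; apply: (bd3n Phi_root) m3.
- by apply: (bd_le _ b3); rewrite -natrM ler_nat.
- by apply: (bd_le _ b4); rewrite -natrM ler_nat.
- by apply: (bd_le _ b5); rewrite -natrM ler_nat.
Qed.

End Certified.

(** * Roots joined by an odd edge have equal lengths *)

Section EqualLengths.
Variables (R : realType) (N : nat) (Phi : seq 'rV[R]_N).
Hypothesis Phi_root : root_system Phi.
Variables (a b : 'rV[R]_N) (kap : R).
Hypotheses (aP : a \in Phi) (bP : b \in Phi).
Hypothesis dot_ab : dot a b = - (kap / 2) * (Num.sqrt (dot a a) * Num.sqrt (dot b b)).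
Let s := Num.sqrt (dot a a).
Let t := Num.sqrt (dot b b).
Let r := s / t.

Let a_gt0 : 0 < dot a a. Proof. by rewrite dot_gt0// (root_nonzero Phi_root aP). Qed.
Let b_gt0 : 0 < dot b b. Proof. by rewrite dot_gt0// (root_nonzero Phi_root bP). Qed.
Let s_gt0 : 0 < s. Proof. by rewrite sqrtr_gt0. Qed.
Let t_gt0 : 0 < t. Proof. by rewrite sqrtr_gt0. Qed.
Let r_gt0 : 0 < r. Proof. exact: divr_gt0. Qed.
Let s_neq0 : s != 0. Proof. by rewrite gt_eqF. Qed.
Let t_neq0 : t != 0. Proof. by rewrite gt_eqF. Qed.
Let aE : dot a a = s ^+ 2. Proof. by rewrite sqr_sqrtr// ltW. Qed.
Let bE : dot b b = t ^+ 2. Proof. by rewrite sqr_sqrtr// ltW. Qed.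

Let refl_a x y : (x *: a + y *: b) *m reflection a = (kap / r * y - x) *: a + y *: b.
Proof.
rewrite reflectE coxDr !coxZr cox_self ?(root_nonzero Phi_root aP)//.
have -> : cox a b = - (kap / r).
  rewrite /cox dot_ab -/s -/t aE /r; field; exact/andP.
rewrite addrAC -scalerBl; congr (_ *: _ + _); ring.
Qed.

Let refl_b x y : (x *: a + y *: b) *m reflection b = x *: a + (kap * r * x - y) *: b.
Proof.
rewrite reflectE coxDr !coxZr cox_self ?(root_nonzero Phi_root bP)//.
have -> : cox b a = - (kap * r).
  rewrite /cox dotC dot_ab -/s -/t bE /r; field; exact: t_neq0.
rewrite -addrA -scalerBl; congr (_ + _ *: _); ring.
Qed.

(** The vector r b is a positive multiple of b with the length of a; if it is a root, reducedness
    forces r = 1. *)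
Let length_eq : r *: b \in Phi -> dot a a = dot b b.
Proof.
move=> rb; have r1 : r = 1 by have [//|rN] := root_reduced Phi_root bP rb; move: r_gt0; rewrite rN; lra.
by rewrite aE bE -[s](divfK t_neq0) -/r r1 mul1r.
Qed.

Let a_lin : a = 1 *: a + 0 *: b. Proof. by rewrite scale1r scale0r addr0. Qed.

(** In the dihedral group of order 6, two reflections carry a to r b. *)
Lemma length_eq3 : kap = 1 -> dot a a = dot b b.
Proof.
move=> k1; apply: length_eq.
have -> : r *: b = a *m reflection b *m reflection a.
  rewrite [X in _ = X *m _ *m _]a_lin refl_b refl_a k1.
  have -> : 1 / r * (1 * r * 1 - 0) - 1 = 0 by field; rewrite gt_eqF.
  by rewrite scale0r add0r subr0 mul1r mulr1.
by apply: (root_stable Phi_root) => //; apply: (root_stable Phi_root).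
Qed.

(** In the dihedral group of order 10, four reflections carry a to r b; the golden relation on kap
    simplifies the coordinates. *)
Lemma length_eq5 : kap ^+ 2 = kap + 1 -> dot a a = dot b b.
Proof.
move=> k2; apply: length_eq.
have -> : r *: b = a *m reflection b *m reflection a *m reflection b *m reflection a.
  have r0 : r != 0 by rewrite gt_eqF.
  rewrite [X in _ = X *m _ *m _ *m _ *m _]a_lin refl_b refl_a refl_b.
  have -> : kap / r * (kap * r * 1 - 0) - 1 = kap.
    have -> : kap / r * (kap * r * 1 - 0) - 1 = kap ^+ 2 - 1 by field.
    by rewrite k2 addrK.
  have -> : kap * r * kap - (kap * r * 1 - 0) = r.
    have -> : kap * r * kap - (kap * r * 1 - 0) = (kap ^+ 2 - kap) * r by ring.
    by rewrite k2 addrC addKr mul1r.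
  rewrite refl_a (_ : _ - _ = 0) ?scale0r ?add0r//.
  by field.
by do 3 (apply: (root_stable Phi_root) => //); apply: (root_stable Phi_root).
Qed.

End EqualLengths.

(** * Cartan matrices from Coxeter graphs *)

Section GraphCheck.
Variables (n : nat) (edges : seq (nat * nat * nat)).

Definition cgraph (i j : nat) : nat := if i == j then 1%N else
  head 2%N [seq e.2 | e <- edges & (e.1 == (i, j)) || (e.1 == (j, i))].

(* - 2 cos(pi / m) *)
Definition cartan_entry (m : nat) : zp :=
  match m with 1 => zn 2 | 3 => zopp z1 | 5 => (Z0, Zneg 1) | _ => z0 end.

Definition cartan := [seq [seq cartan_entry (cgraph i j) | j <- iota 0 n] | i <- iota 0 n].

(** The earlier neighbour along an odd edge transports the length of the first simple root to all
    the others. *)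
Definition graph_check := all (fun i =>
  ((i == 0%N) || has (fun j => cgraph j i \in [:: 3; 5]) (iota 0 i)) &&
  all (fun j => cgraph i j \in [:: 1; 2; 3; 5]) (iota 0 n)) (iota 0 n).

Lemma cm_cartan (i j : 'I_n) : cm cartan i j = cartan_entry (cgraph i j).
Proof.
rewrite /cm /cartan (nth_map 0%N) ?size_iota// nth_iota// add0n.
by rewrite (nth_map 0%N) ?size_iota// nth_iota.
Qed.

Lemma cartan_entry3 (R : realType) : zval R (cartan_entry 3) = -1.
Proof. by rewrite -[cartan_entry 3]/(zopp z1) zvalN zval1. Qed.

Lemma cartan_entry5 (R : realType) : zval R (cartan_entry 5) = - phi R.
Proof.
rewrite -[cartan_entry 5]/(zopp (Z0, Zpos 1)) zvalN; congr (- _).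
by rewrite /zval /= mul1r add0r.
Qed.

Lemma cartan_entryE (R : realType) m : m \in [:: 1; 2; 3; 5]%N ->
  zval R (cartan_entry m) = - 2 * cos (pi / m%:R).
Proof.
rewrite !inE => /or4P[] /eqP ->.
- by rewrite -[cartan_entry 1]/(zn 2) zval_zn divr1 cospi; ring.
- by rewrite -[cartan_entry 2]/z0 zval0 cos_pihalf mulr0.
- by rewrite cartan_entry3 cos_pi3; field.
- by rewrite cartan_entry5 /phi; ring.
Qed.

Variables (R : realType) (Phi : seq 'rV[R]_n) (Delta : n.-tuple 'rV[R]_n).
Hypothesis n_gt0 : (0 < n)%N.
Hypothesis check : graph_check.
Hypothesis type : root_system_of_type (coxeter_graph edges) Phi Delta.
Local Notation simple i := (tnth Delta i).

Let i0 := Ordinal n_gt0.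

Let Phi_root : root_system Phi. Proof. by case: type. Qed.
Let Delta_simple : simple_system Phi Delta. Proof. by case: type. Qed.

Let dot_cos (i j : 'I_n) : dot (simple i) (simple j) = - (- zval R (cartan_entry (cgraph i j)) / 2) *
  (Num.sqrt (dot (simple i) (simple i)) * Num.sqrt (dot (simple j) (simple j))).
Proof.
have io (k : 'I_n) : (k : nat) \in iota 0 n by rewrite mem_iota add0n ltn_ord.
have mij : cgraph i j \in [:: 1; 2; 3; 5]%N.
  by move/allP: check => /(_ i (io i))/andP[_ /allP/(_ j (io j))].
case: type => _ _ /(_ i j) /= ->; rewrite (cartan_entryE R mij).
rewrite /coxeter_graph -(inj_eq val_inj) -/(cgraph i j).
by congr (_ * _); rewrite mulNr opprK mulrAC mulfV ?mul1r.
Qed.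

Let simple_norm (i : 'I_n) : dot (simple i) (simple i) = dot (simple i0) (simple i0).
Proof.
have [m] := ubnP (i : nat); elim: m i => // m IH i im.
have /andP[/orP[/eqP iE|/hasP[j jI c35]] _] : ((i == 0%N :> nat) || has (fun j => cgraph j i \in [:: 3; 5]%N) (iota 0 i)) &&
  all (fun j => cgraph i j \in [:: 1; 2; 3; 5]%N) (iota 0 n).
- by move/allP: check; apply; rewrite mem_iota add0n ltn_ord.
- by congr (dot (simple _) (simple _)); apply: val_inj.
move: jI; rewrite mem_iota add0n => /andP[_ ji].
pose j' : 'I_n := Ordinal (ltn_trans ji (ltn_ord i)).
rewrite -(IH j') ?(leq_trans ji)//.
have [sj si] := (simpleP Delta_simple j', simpleP Delta_simple i).
apply: esym; have := dot_cos j' i; move: c35; rewrite !inE => /orP[]/eqP; rewrite -[val j']/(j : nat) => -> d.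
- by apply: (length_eq3 Phi_root sj si d); rewrite cartan_entry3 opprK.
apply: (length_eq5 Phi_root sj si d).
by rewrite cartan_entry5 opprK; exact: phi_sqr.
Qed.

Lemma type_lengths : exists2 L : R, 0 < L &
  (forall i j, dot (simple i) (simple j) = L / 2 * zval R (cm cartan i j)) /\
  (forall i, dot (simple i) (simple i) = L).
Proof.
have L0 : 0 < dot (simple i0) (simple i0).
  by rewrite dot_gt0// (root_nonzero Phi_root (simpleP Delta_simple i0)).
exists (dot (simple i0) (simple i0)) => //; split=> [i j|i]; last exact: simple_norm.
rewrite dot_cos !simple_norm cm_cartan -expr2 (sqr_sqrtr (ltW L0)); ring.
Qed.

End GraphCheck.

(** * Bounds on [KK] from the checks *)

Section BoundsCertified.
Variables (R : realType) (n : nat).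
Local Notation V := 'rV[R]_n.
Local Notation P := (cpoly R n).
Variables (Phi : seq V) (Delta : n.-tuple V).
Hypothesis Phi_root : root_system Phi.
Hypothesis Delta_simple : simple_system Phi Delta.
Local Notation Pos := (positive_roots Phi Delta).
Local Notation simple i := (tnth Delta i).
Local Notation zval := (@zval R).
Variables (C : seq (seq zp)) (L : R).
Hypothesis L_gt0 : 0 < L.
Hypothesis dot_simple : forall i j : 'I_n, dot (simple i) (simple j) = L / 2 * zval (cm C i j).
Hypothesis dot_self : forall i : 'I_n, dot (simple i) (simple i) = L.
Variables (fuel h q : nat).
Let X := roots n C fuel.
Hypothesis X_closed : closed_check n C X.
Hypothesis X_total : total_check n C X h.

Let X_rootlike := roots_rootlike Phi_root Delta_simple L_gt0 dot_simple dot_self (fuel := fuel).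

Lemma total_cert v : \sum_(alpha <- Pos) cox alpha v *: alpha = h%:R *: v.
Proof.
apply: (total_sumE Delta_simple) => i.
rewrite (big_pos Phi_root Delta_simple L_gt0 dot_simple dot_self X_rootlike X_closed) -(zval_zn R h).
apply: (sum_checkP L_gt0 dot_simple X_rootlike (sel := predT)).
by move/allP: X_total => /(_ (i : nat)); rewrite mem_iota add0n ltn_ord; exact.
Qed.

Lemma bd_spectrum m (kaps : seq nat) (M : nat) : spectrum_check n C X m (map zn kaps) ->
  all (leq^~ M) kaps -> bd Phi Delta m M%:R.
Proof.
move=> chk kM; apply: (eigen_bd Phi_root) => k u hu u0 ku.
have [_ /mapP[kap kapP ->] ->] := spectrum Phi_root Delta_simple L_gt0 dot_simple dot_self X_rootlike X_closed chk hu u0 ku.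
by rewrite zval_zn ler_nat (allP kM).
Qed.

Hypothesis X_design : design_check n C X (zn q).
Hypothesis X_cox : cox_check n C X.

Let root_len alpha : alpha \in Phi -> dot alpha alpha = L.
Proof.
have pos_len beta : beta \in Pos -> dot beta beta = L.
  move=> bP.
  have /mapP[x /X_rootlike[_ _ _ xL] ->//] := pos_vec Phi_root Delta_simple L_gt0 dot_simple dot_self X_closed bP.
move=> aP; case/orP: (posVneg Phi_root Delta_simple aP) => /pos_len//.
by rewrite -scaleN1r dotZl dotZr mulrA mulrNN !mul1r.
Qed.

(** The inequalities are those of [bd3] and [bd4] with lam = 2 q, rearranged so that no natural
    numbers are subtracted. *)
Lemma simply_laced_bd (M3 M4 : nat) : (h <= M3)%N -> (3 * h + 6 <= M3 + 6 * q)%N ->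
  (q <= h)%N -> (2 * h <= M4 + 2 * q)%N -> (4 * h + 12 <= M4 + 12 * q)%N ->
  (4 * h + 6 <= M4 + 9 * q)%N -> bd Phi Delta 3 M3%:R /\ bd Phi Delta 4 M4%:R.
Proof.
have le (x y : nat) : (x <= y)%N -> x%:R <= y%:R :> R by rewrite ler_nat.
move=> /le hM /le qM /le qh /le h1 /le h2 /le h3; rewrite !(natrD, natrM) in qM h1 h2 h3.
have des u v x y : \sum_(alpha <- Pos) cox alpha u * cox alpha v * (dot alpha x * dot alpha y) =
  (2 * q%:R) / 2 * (dot u v * dot x y + dot u x * dot v y + dot u y * dot v x).
  rewrite (mulrC 2) mulfK ?pnatr_eq0// -zval_zn.
  exact: (design_checkP Phi_root Delta_simple L_gt0 dot_simple dot_self X_rootlike X_closed X_design).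
have coxi := cox_checkP Phi_root Delta_simple L_gt0 dot_simple dot_self X_rootlike X_closed X_cox.
split.
- by apply: (bd3 Phi_root Delta_simple L_gt0 root_len total_cert des coxi) => //; lra.
- by apply: (bd4 Phi_root Delta_simple L_gt0 root_len total_cert des coxi); lra.
Qed.

End BoundsCertified.

(** * Data and certificates for E6, E7 and H3 *)

Definition E6_edges := [:: (0, 1, 3); (1, 2, 3); (2, 3, 3); (3, 4, 3); (2, 5, 3)]%N.
Definition E7_edges := [:: (0, 1, 3); (1, 2, 3); (2, 3, 3); (3, 4, 3); (4, 5, 3); (2, 6, 3)]%N.
Definition H3_edges := [:: (0, 1, 5); (1, 2, 3)]%N.

Definition E6_cartan := Eval vm_compute in cartan 6 E6_edges.
Definition E7_cartan := Eval vm_compute in cartan 7 E7_edges.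
Definition H3_cartan := Eval vm_compute in cartan 3 H3_edges.

Lemma E6_check : graph_check 6 E6_edges.
Proof. by vm_compute. Qed.

Lemma E7_check : graph_check 7 E7_edges.
Proof. by vm_compute. Qed.

Lemma H3_check : graph_check 3 H3_edges.
Proof. by vm_compute. Qed.

(** Removing node 0 or 4 leaves D5, of Coxeter number 8, whose 4 roots per node exceed the allowed
    19 / 5 = 19 k / 40. *)
Lemma E6_convergence : convergence_check 6 E6_cartan (roots 6 E6_cartan 12) 8 12 19 5 4 1 [:: 0; 4]%N.
Proof. by vm_compute. Qed.

(** Removing node 5 leaves E6, of Coxeter number 12, with 6 roots per node against the allowed 57 /
    10. *)
Lemma E7_convergence : convergence_check 7 E7_cartan (roots 7 E7_cartan 18) 12 18 57 10 6 1 [:: 5]%N.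
Proof. by vm_compute. Qed.

(** Removing node 2 leaves I2(5), of Coxeter number 5, with 5 / 2 roots per node against the allowed
    19 / 8. *)
Lemma H3_convergence : convergence_check 3 H3_cartan (roots 3 H3_cartan 10) 5 10 19 8 5 2 [:: 2]%N.
Proof. by vm_compute. Qed.

Lemma E6_design : design_check 6 E6_cartan (roots 6 E6_cartan 12) (zn 3).
Proof. by vm_compute. Qed.

Lemma E7_design : design_check 7 E7_cartan (roots 7 E7_cartan 18) (zn 4).
Proof. by vm_compute. Qed.

Lemma E6_cox : cox_check 6 E6_cartan (roots 6 E6_cartan 12).
Proof. by vm_compute. Qed.

Lemma E7_cox : cox_check 7 E7_cartan (roots 7 E7_cartan 18).
Proof. by vm_compute. Qed.

Lemma H3_spectrum3 : spectrum_check 3 H3_cartan (roots 3 H3_cartan 10) 3 (map zn [:: 10; 15]%N).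
Proof. by vm_compute. Qed.

Lemma H3_spectrum4 : spectrum_check 3 H3_cartan (roots 3 H3_cartan 10) 4 (map zn [:: 0; 12; 15]%N).
Proof. by vm_compute. Qed.

Lemma convergence_total n C X k h p q p1 q1 special :
  convergence_check n C X k h p q p1 q1 special -> closed_check n C X /\ total_check n C X h.
Proof. by case/and5P => _ tot _ _ /and3P[_ _ clo]. Qed.

Lemma E6_main (R : realType) (Phi : seq 'rV[R]_6) (Delta : 6.-tuple 'rV[R]_6) (S : set (cpoly R 6)) :
  root_system_of_type E6 Phi Delta -> minimal_submodule Phi Delta (1 / 8) S ->
  gaussian_converges Phi Delta (1 / 8) S /\ unitary Phi Delta (1 / 8) S.
Proof.
move=> type S_min; have [Phi_root Delta_simple _] := type.
have [L L_gt0 [dot_simple dot_self]] := type_lengths (isT : (0 < 6)%N) E6_check type.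
have [om om_dual] := dual_basis Delta_simple.
have [clo tot] := convergence_total E6_convergence.
split; first exact: (converges_cert Phi_root Delta_simple L_gt0 dot_simple dot_self E6_convergence om_dual S_min).
(* 24 = 3 k is the bound required in degree 3, and 28 = 5 k - h the largest bound in degree 4 that
   still yields degree 5. *)
have [b3 b4] := simply_laced_bd Phi_root Delta_simple L_gt0 dot_simple dot_self clo tot E6_design E6_cox
  (M3 := 24) (M4 := 28) isT isT isT isT isT isT.
by apply: (unitary_cert Phi_root Delta_simple L_gt0 dot_simple dot_self E6_convergence om_dual S_min _ _ _ b3 b4).
Qed.

Lemma E7_main (R : realType) (Phi : seq 'rV[R]_7) (Delta : 7.-tuple 'rV[R]_7) (S : set (cpoly R 7)) :
  root_system_of_type E7 Phi Delta -> minimal_submodule Phi Delta (1 / 12) S ->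
  gaussian_converges Phi Delta (1 / 12) S /\ unitary Phi Delta (1 / 12) S.
Proof.
move=> type S_min; have [Phi_root Delta_simple _] := type.
have [L L_gt0 [dot_simple dot_self]] := type_lengths (isT : (0 < 7)%N) E7_check type.
have [om om_dual] := dual_basis Delta_simple.
have [clo tot] := convergence_total E7_convergence.
split; first exact: (converges_cert Phi_root Delta_simple L_gt0 dot_simple dot_self E7_convergence om_dual S_min).
(* 36 = 3 k and 42 = 5 k - h, which here equal the values 3 h - 3 lam + 6 and 4 h - 6 lam + 6 + 3
   lam / 2 with h = 18 and lam = 8. *)
have [b3 b4] := simply_laced_bd Phi_root Delta_simple L_gt0 dot_simple dot_self clo tot E7_design E7_cox
  (M3 := 36) (M4 := 42) isT isT isT isT isT isT.
by apply: (unitary_cert Phi_root Delta_simple L_gt0 dot_simple dot_self E7_convergence om_dual S_min _ _ _ b3 b4).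
Qed.

Lemma H3_main (R : realType) (Phi : seq 'rV[R]_3) (Delta : 3.-tuple 'rV[R]_3) (S : set (cpoly R 3)) :
  root_system_of_type H3 Phi Delta -> minimal_submodule Phi Delta (1 / 5) S ->
  gaussian_converges Phi Delta (1 / 5) S /\ unitary Phi Delta (1 / 5) S.
Proof.
move=> type S_min; have [Phi_root Delta_simple _] := type.
have [L L_gt0 [dot_simple dot_self]] := type_lengths (isT : (0 < 3)%N) H3_check type.
have [om om_dual] := dual_basis Delta_simple.
have [clo tot] := convergence_total H3_convergence.
split; first exact: (converges_cert Phi_root Delta_simple L_gt0 dot_simple dot_self H3_convergence om_dual S_min).
(* The largest eigenvalue 15 is 3 k in degree 3, and 10 + 15 = 5 k covers degree 5. *)
have b3 := bd_spectrum Phi_root Delta_simple L_gt0 dot_simple dot_self clo H3_spectrum3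
  (isT : all (leq^~ 15) [:: 10; 15])%N.
have b4 := bd_spectrum Phi_root Delta_simple L_gt0 dot_simple dot_self clo H3_spectrum4
  (isT : all (leq^~ 15) [:: 0; 12; 15])%N.
by apply: (unitary_cert Phi_root Delta_simple L_gt0 dot_simple dot_self H3_convergence om_dual S_min _ _ _ b3 b4).
Qed.

Theorem proposition6p11 (R : realType) :
  [/\ (forall (Phi : seq 'rV[R]_6) (Delta : 6.-tuple 'rV[R]_6)
          (S : set (cpoly R 6)),
        root_system_of_type E6 Phi Delta ->
        minimal_submodule Phi Delta (1 / 8) S ->
        gaussian_converges Phi Delta (1 / 8) S /\
        unitary Phi Delta (1 / 8) S),
      (forall (Phi : seq 'rV[R]_7) (Delta : 7.-tuple 'rV[R]_7)
          (S : set (cpoly R 7)),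
        root_system_of_type E7 Phi Delta ->
        minimal_submodule Phi Delta (1 / 12) S ->
        gaussian_converges Phi Delta (1 / 12) S /\
        unitary Phi Delta (1 / 12) S)
    & (forall (Phi : seq 'rV[R]_3) (Delta : 3.-tuple 'rV[R]_3)
          (S : set (cpoly R 3)),
        root_system_of_type H3 Phi Delta ->
        minimal_submodule Phi Delta (1 / 5) S ->
        gaussian_converges Phi Delta (1 / 5) S /\
        unitary Phi Delta (1 / 5) S)].
Proof.
by split=> Phi Delta S; [exact: E6_main | exact: E7_main | exact: H3_main].
Qed.
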